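(* Let $n\ge5$. The generic $C_2^1$-cofactor matroid $\mathcal{C}^1_{2,n}$ is the free elevation of $R_n$. Here $R_n$ is the rank-$10$ matroid on $E(K_n)$ whose non-spanning circuits are exactly the edge sets of the copies of $K_5$ in $K_n$.
   Context: $\mathcal{C}^1_{2,n}$ is defined as follows. Take vertices $v_1,\dots,v_n$ of $K_n$ and points $p(v_i)=(x_i,y_i)\in\mathbb{R}^2$ with algebraically independent coordinates over $\mathbb{Q}$. It is the row matroid of the $|E(K_n)|\times 3n$ matrix with three columns per vertex. The row of edge $v_iv_j$ with $i<j$ has $D_{ij}=((x_i-x_j)^2,(x_i-x_j)(y_i-y_j),(y_i-y_j)^2)$ in the columns of $v_i$, $-D_{ij}$ in the columns of $v_j$, and zeros elsewhere. Let $M,N$ be matroids on the same ground set $E$. The weak order is defined by $M\preceq N$ if every independent set of $M$ is independent in $N$. $M$ is the truncation of $N$ if $r_N(E)=r_M(E)+1$ and $r_M(X)=\min\{r_N(X),r_M(E)\}$ for all $X$. An erection of $M$ is any $N$ of which $M$ is the truncation, together with $M$ itself (the trivial erection). The erections of $M$ form a lattice under the weak order; its maximum is the free erection of $M$. The free elevation of $M$ is the last matroid of the sequence $M=M_0,M_1,\dots,M_k$, where each $M_i$ is the free erection of $M_{i-1}$ and is non-trivial, and $M_k$ has no non-trivial erection. *)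

(* Defs.v *)
From HB Require Import structures.
From mathcomp Require Import all_boot all_order all_algebra.
From mathcomp Require Import mpoly.
Set Implicit Arguments. Unset Strict Implicit. Unset Printing Implicit Defensive.
Import Order.TTheory GRing.Theory Num.Theory.

Section Matroids.
Variable T : finType.

(* a matroid is represented by its predicate of independent sets *)
Definition matroid := {set T} -> bool.

Definition is_matroid (M : matroid) : Prop :=
  [/\ M set0,
      (forall X Y : {set T}, Y \subset X -> M X -> M Y) &
      (forall X Y : {set T}, M X -> M Y -> #|X| < #|Y| ->
         exists2 e, e \in Y :\: X & M (e |: X))].

Definition mrank (M : matroid) (X : {set T}) : nat :=
  \max_(Y : {set T} | (Y \subset X) && M Y) #|Y|.

Definition meq (M N : matroid) : Prop := forall X, M X = N X.

Definition is_circuit (M : matroid) (C : {set T}) : bool :=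
  ~~ M C && [forall e in C, M (C :\ e)].

Definition spanning (M : matroid) (X : {set T}) : bool :=
  mrank M X == mrank M setT.

Definition weak_le (M N : matroid) : Prop := forall X, M X -> N X.

Definition is_truncation (M N : matroid) : Prop :=
  mrank N setT = (mrank M setT).+1 /\
  forall X, mrank M X = minn (mrank N X) (mrank M setT).

Definition is_erection (M N : matroid) : Prop :=
  is_matroid N /\ (meq N M \/ is_truncation M N).

Definition is_free_erection (M N : matroid) : Prop :=
  is_erection M N /\ forall N', is_erection M N' -> weak_le N' N.

Definition is_free_elevation (M N : matroid) : Prop :=
  exists (k : nat) (s : nat -> matroid),
    [/\ s 0%N = M,
        (forall i, i < k -> is_free_erection (s i) (s i.+1) /\ ~ meq (s i.+1) (s i)),
        meq (s k) N &
        (forall N', is_erection N N' -> meq N' N)].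

End Matroids.

Notation edge n := {p : 'I_n * 'I_n | (p.1 < p.2)%N}.

Definition is_K5 (n : nat) (C : {set edge n}) : bool :=
  [exists V : {set 'I_n},
     (#|V| == 5) && (C == [set e : edge n | ((val e).1 \in V) && ((val e).2 \in V)])].

Local Open Scope ring_scope.

Definition coords (R : ringType) (n : nat) (x y : 'I_n -> R) : 'I_(n + n) -> R :=
  fun k => match split k with inl i => x i | inr i => y i end.

Definition alg_indep_Q (R : fieldType) (m : nat) (v : 'I_m -> R) : Prop :=
  forall p : {mpoly rat[m]}, p != 0 -> (map_mpoly (ratr : rat -> R) p).@[v] != 0.

Definition Dvec (R : ringType) (n : nat) (x y : 'I_n -> R) (i j : 'I_n) : 'I_3 -> R :=
  fun l => let a := x i - x j in let b := y i - y j in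
    if val l == 0%N then a ^+ 2 else if val l == 1%N then a * b else b ^+ 2.

(* the row of edge v_i v_j (i < j), as an n x 3 matrix: row k holds the three
   columns of vertex v_k; D_ij at v_i, -D_ij at v_j, zero elsewhere *)
Definition cof_row (R : ringType) (n : nat) (x y : 'I_n -> R) (e : edge n) : 'M[R]_(n, 3) :=
  let i := (val e).1 in let j := (val e).2 in
  \matrix_(k < n, l < 3)
    (if k == i then Dvec x y i j l else if k == j then - Dvec x y i j l else 0).

Definition cofactor_matroid (R : fieldType) (n : nat) (x y : 'I_n -> R) : matroid (edge n) :=
  fun S => row_free (\matrix_(k < #|S|) mxvec (cof_row x y (enum_val k))).

(* Main.v *)
(** Let C be the cofactor matroid. An erection N of the rank-r truncation of C
    agrees with C on all sets of at most r edges, so it suffices to show that a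
    C-circuit X with r + 1 > 10 edges is dependent in N. Since C has rank
    3|V| - 6 on the complete graph on V, some vertex v of X has degree 4 or 5.

    Modulo the row space U of X - v, the dependence of X persists for every
    position of v, because v is generic. Placing v where two lines spanned by its
    neighbours cross, or on one such line, gives relations among the rows of the
    complete graph on the neighbours of v. Solving them leaves three cases.
    Either these rows have rank at most 1 modulo U, and then a basis of their
    span together with four edges at v would make a K_5 independent in N; or they
    vanish off one neighbour, and then a proper subset of X is dependent; or
    they form a "twisted quadrilateral", a rank-2 configuration on four
    neighbours in which opposite edges carry the same value.

    Twisted quadrilaterals do not exist, by induction on the number of vertices.
    In a maximal counterexample the row space is a hyperplane, and counting
    degrees gives a vertex w outside the configuration of degree at most 5. As w
    moves, the relations of the quadrilateral stay in the row space; the same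
    local analysis at w either removes w or yields a smaller twisted
    quadrilateral among the neighbours of w. *)

(* A matrix of polynomials has its largest rank at a generic point, so no position of [v] lifts the
   rank of [X] above [|X| - 1]. Three rows at [v] in pairwise nonparallel directions are independent
   modulo everything that vanishes at [v]. Hence the combinations of rows at [v] that vanish at [v]
   have rank at most [d - 4] modulo [U], where [d] is the degree of [v]: rank 0 for [d = 4], and
   rank 1 for [d = 5]. In the second case any two such combinations found at one position are
   proportional modulo [U], and all relations that are solved are proportionalities of this kind.
   The number 10 is the size of [K_5]: once [r >= 10], the dependence of [K_5] is inherited by [N].
   The obstacle is the twisted quadrilateral. It satisfies both kinds of relations, so these
   positions of [v] cannot exclude it and a global argument is required. There the degree count has
   a margin of one only, which is why the row space is first enlarged to a hyperplane and its basis
   is chosen to contain six prescribed edges. *)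
Require Import Defs.
From HB Require Import structures.
From mathcomp Require Import all_boot all_order all_algebra.
From mathcomp Require Import mpoly.
From mathcomp Require Import ring zify.
Set Implicit Arguments. Unset Strict Implicit. Unset Printing Implicit Defensive.
Import Order.TTheory GRing.Theory Num.Theory.

(** * Matroids: augmentation, circuits, truncation *)

Section MatroidTheory.
Variables (T : finType) (M : matroid T).
Hypothesis mM : is_matroid M.

Lemma indep_sub (X Y : {set T}) : Y \subset X -> M X -> M Y.
Proof. by case: mM => _ H _; apply: H. Qed.

Lemma leq_mrank (X Y : {set T}) : Y \subset X -> M Y -> #|Y| <= mrank M X.
Proof.
move=> sYX MY; rewrite /mrank.
by apply: (@leq_bigmax_cond _ _ (fun Z : {set T} => #|Z|)); rewrite sYX.
Qed.

Lemma mrank_basis (X : {set T}) :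
  exists Y : {set T}, [/\ Y \subset X, M Y & #|Y| = mrank M X].
Proof.
case: (@eq_bigmax_cond _ [pred Y : {set T} | (Y \subset X) && M Y] (fun Y : {set T} => #|Y|)).
  by apply/card_gt0P; exists set0; rewrite inE sub0set; case: mM.
move=> Y; rewrite inE => /andP[sYX MY] E; by exists Y; split.
Qed.

Lemma mrank_indep (X : {set T}) : M X -> mrank M X = #|X|.
Proof.
move=> MX; apply/eqP; rewrite eqn_leq leq_mrank // andbT.
by have [Y [sYX _ <-]] := mrank_basis X; apply: subset_leq_card.
Qed.

Lemma mrank_leq_card (X : {set T}) : mrank M X <= #|X|.
Proof. by have [Y [sYX _ <-]] := mrank_basis X; apply: subset_leq_card. Qed.

Lemma indep_mrank (X : {set T}) : mrank M X = #|X| -> M X.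
Proof.
have [Y [sYX MY <-]] := mrank_basis X => E.
by move/eqP: E; rewrite eqn_leq => /andP[_ E]; rewrite -(eqP (_ : Y == X)) // eqEcard sYX.
Qed.

Lemma augment (X Y : {set T}) (k : nat) : M X -> M Y -> #|X| <= k <= #|Y| ->
  exists Z : {set T}, [/\ X \subset Z, Z \subset X :|: Y, M Z & #|Z| = k].
Proof.
move=> MX MY; elim: k => [|k IH].
  rewrite leqn0 => /andP[/eqP cX _]; exists X; split=> //; exact: subsetUl.
case/andP; rewrite leq_eqVlt => /orP[/eqP cX _|].
  by exists X; split=> //; exact: subsetUl.
rewrite ltnS => lX lY; have [|Z [sXZ sZ MZ cZ]] := IH; first by rewrite lX ltnW.
have [_ _ H] := mM; have [|e] := H Z Y MZ MY; first by rewrite cZ.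
rewrite inE => /andP[eZ eY] Me; exists (e |: Z); split=> //.
- exact: subset_trans sXZ (subsetUr _ _).
- by rewrite subUset sZ sub1set inE eY orbT.
- by rewrite cardsU1 eZ cZ.
Qed.

Lemma dep_circuit (X : {set T}) : ~~ M X ->
  exists2 C : {set T}, C \subset X & is_circuit M C.
Proof.
move=> nMX.
have [C /minsetP[nC minC] sCX] := @minset_exists _ (fun Y => ~~ M Y) X nMX.
exists C => //; rewrite /is_circuit nC; apply/forall_inP => e eC.
apply/negPn/negP => nCe; have := minC _ nCe (subsetDl _ _).
by move/setP/(_ e); rewrite !inE eqxx eC.
Qed.

Lemma circuit_proper (C X : {set T}) : is_circuit M C -> X \proper C -> M X.
Proof.
case/andP=> _ /forall_inP H /properP[sXC [e eC eX]].
apply: indep_sub (H e eC); apply/subsetP=> f fX; rewrite !inE (subsetP sXC) // andbT.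
by apply: contraNneq eX => <-.
Qed.

Lemma circuit_mrank (C : {set T}) : is_circuit M C -> (mrank M C).+1 = #|C|.
Proof.
move=> cC; have nC : ~~ M C by case/andP: cC.
have ltC : mrank M C < #|C|.
  rewrite ltn_neqAle mrank_leq_card andbT; apply: contraNneq nC; exact: indep_mrank.
apply/eqP; rewrite eqn_leq ltC.
have [e eC] : exists e, e \in C.
  by apply/set0Pn; apply: contraNneq nC => ->; case: mM.
rewrite (cardsD1 e) eC add1n ltnS.
by apply: leq_mrank (subsetDl _ _) (circuit_proper cC _); rewrite properD1.
Qed.

(** A basis of [B] through [Q] is enlarged by elements of [X]; none of the new ones lies in [B],
    where the basis is already maximal. This allows the part inside [B] to be prescribed without
    losing elements outside [B]. *)
Lemma extend_in_span (B Q X : {set T}) (d : nat) : Q \subset B -> M Q -> M X ->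
  mrank M B + d <= #|X| ->
  exists I : {set T}, [/\ M I, Q \subset I, I :\: B \subset X, #|I :\: B| = d &
    #|I| = mrank M B + d].
Proof.
move=> sQB MQ MX leX.
have [I0 [sI0 MI0 cI0]] := mrank_basis B.
have [|I1 [sQI1 sI1 MI1 cI1]] := @augment Q I0 (mrank M B) MQ MI0.
  by rewrite cI0 leqnn andbT leq_mrank.
have sI1B : I1 \subset B by apply: subset_trans sI1 _; rewrite subUset sQB.
have [|I2 [sI12 sI2 MI2 cI2]] := @augment I1 X (mrank M B + d) MI1 MX.
  by rewrite cI1 leq_addr leX.
have E : I2 :\: B = I2 :\: I1.
  apply/setP=> e; rewrite !inE; have [eI1|eI1] := boolP (e \in I1).
    by rewrite (subsetP sI1B).
  have [eI2|] := boolP (e \in I2); rewrite ?andbF // andbT; apply/negP => eB.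
  have : #|e |: I1| <= mrank M B.
    apply: leq_mrank; first by rewrite subUset sub1set eB.
    by apply: indep_sub MI2; rewrite subUset sub1set eI2.
  by rewrite cardsU1 eI1 cI1 add1n ltnn.
exists I2; split=> //; first exact: subset_trans sQI1 sI12.
  rewrite E; apply/subsetP=> e; rewrite !inE => /andP[eI1 /(subsetP sI2)].
  by rewrite inE (negPf eI1).
by rewrite E cardsD (setIidPr sI12) cI2 cI1 addKn.
Qed.

Definition trunc (r : nat) : matroid T := fun X => M X && (#|X| <= r).

Lemma trunc_matroid r : is_matroid (trunc r).
Proof.
case: (mM) => M0 MS MA; split.
- by rewrite /trunc M0 cards0.
- move=> X Y sYX /andP[MX lX]; rewrite /trunc (MS X) //=.
  exact: leq_trans (subset_leq_card sYX) lX.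
- move=> X Y /andP[MX lX] /andP[MY lY] lt.
  have [e eYX Me] := MA _ _ MX MY lt; exists e => //; rewrite /trunc Me /=.
  by move: eYX; rewrite inE cardsU1 => /andP[-> _]; apply: leq_trans lY.
Qed.

End MatroidTheory.

Lemma mrank_trunc (T : finType) (M : matroid T) (r : nat) (X : {set T}) :
  is_matroid M -> mrank (trunc M r) X = minn (mrank M X) r.
Proof.
move=> mM; apply/eqP; rewrite eqn_leq; apply/andP; split.
  have [Y [sY /andP[MY lY] <-]] := mrank_basis (trunc_matroid mM r) X.
  by rewrite leq_min lY andbT leq_mrank.
have [Y [sY MY cY]] := mrank_basis mM X.
have M0 : M set0 by case: mM.
have [|Z [_ sZ MZ cZ]] := @augment _ _ mM set0 Y (minn (mrank M X) r) M0 MY.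
  by rewrite cards0 cY geq_minl.
rewrite -cZ; apply: leq_mrank; first by apply: subset_trans sZ _; rewrite set0U.
by rewrite /trunc MZ cZ geq_minr.
Qed.

Lemma mrank_meq (T : finType) (M N : matroid T) (X : {set T}) :
  meq M N -> mrank M X = mrank N X.
Proof. by move=> E; apply: eq_bigl => Y; rewrite E. Qed.

Lemma is_matroid_meq (T : finType) (M N : matroid T) :
  meq M N -> is_matroid M -> is_matroid N.
Proof.
move=> E [M0 MS MA]; split; first by rewrite -E.
- by move=> X Y s; rewrite -!E; apply: MS.
- by move=> X Y; rewrite -!E => MX MY /(MA _ _ MX MY)[e eY Me]; exists e; rewrite -?E.
Qed.

(** * Spans of vectors *)

Local Open Scope ring_scope.

Section Spans.
Variables (K : fieldType) (vT : vectType K).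
Implicit Types (U V W : {vspace vT}) (u v : vT).

Lemma dim_add_line U v : (\dim (U + <[v]>)%VS <= (\dim U).+1)%N.
Proof.
apply: leq_trans (dimv_add_leqif U <[v]>%VS) _.
by rewrite dim_vline; case: (v == 0); rewrite ?addn0 ?addn1.
Qed.

Lemma dim_add_line_notin U v : v \notin U -> \dim (U + <[v]>)%VS = (\dim U).+1.
Proof.
move=> vU; have v0 : v != 0 by apply: contraNneq vU => ->; apply: mem0v.
rewrite dimv_disjoint_sum ?dim_vline ?v0 ?addn1 //.
apply/eqP; rewrite -subv0; apply/subvP=> z; rewrite memv_cap => /andP[zU /vlineP[k E]].
rewrite memv0; move: zU; rewrite {}E; have [->|k0] := eqVneq k 0.
  by rewrite scale0r.
by move=> /(memvZ k^-1); rewrite scalerA mulVf // scale1r (negPf vU).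
Qed.

Lemma mem_add_line U v z :
  reflect (exists k, z - k *: v \in U) (z \in (U + <[v]>)%VS).
Proof.
apply: (iffP idP) => [/memv_addP[u uU [_ /vlineP[k ->] ->]]|[k H]].
  by exists k; rewrite addrK.
by rewrite -(subrK (k *: v) z) memv_add // memvZ // memv_line.
Qed.

Lemma line_exchange U v z : z \notin U -> z \in (U + <[v]>)%VS -> v \in (U + <[z]>)%VS.
Proof.
move=> zU /mem_add_line[k H]; apply/mem_add_line.
have [k0|k0] := eqVneq k 0; first by move: H zU; rewrite k0 scale0r subr0 => ->.
exists k^-1; rewrite -memvN opprB; move/(memvZ k^-1): H.
by rewrite scalerBr scalerA mulVf // scale1r.
Qed.

(** The basis is recorded by its positions, so that the same positions can be selected after
    evaluation at another point. *)
Lemma free_mask (s : seq vT) :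
  exists m : bitseq, free (mask m s) /\ (<<mask m s>> = <<s>>)%VS.
Proof.
elim: s => [|v s [m [fm em]]]; first by exists [::]; rewrite /= nil_free.
have [vin|vout] := boolP (v \in <<s>>%VS).
  exists (false :: m); rewrite /= fm; split=> //.
  by rewrite span_cons em; symmetry; apply/addv_idPr; rewrite -memvE.
by exists (true :: m); rewrite /= free_cons em vout fm !span_cons em.
Qed.

Lemma subv_dim_eq U V : (U <= V)%VS -> (\dim V <= \dim U)%N -> U = V.
Proof. by move=> sUV d; apply/eqP; rewrite eqEdim sUV. Qed.

(** Modulo [U], [ad] is [-(ab + ac)], so [ad], [ac] span the same plane as [ab], [ac]. This carries
    the independence condition of a twisted quadrilateral over to another labelling of it. *)
Lemma plane_relabel (U : {vspace vT}) (ab ac ad bc : vT) : ad - bc \in U ->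
  bc + (ab + ac) \in U -> ab \notin U -> ac \notin (U + <[ab]>)%VS -> ac \notin (U + <[ad]>)%VS.
Proof.
move=> h3 h4 nab; apply: contra => /mem_add_line[k Hk].
have H : (1 + k) *: ac + k *: ab \in U.
  have -> : (1 + k) *: ac + k *: ab = (ac - k *: ad) + k *: (ad - bc) + k *: (bc + (ab + ac)).
    rewrite -addrA -scalerDr [ad - bc + _]addrA subrK scalerDr [_ - _ + _]addrA subrK.
    by rewrite scalerDl scale1r scalerDr -addrA [k *: ac + _]addrC.
  by apply: memvD; [apply: memvD|]; rewrite // memvZ.
have [k1|k1] := eqVneq (1 + k) 0.
  case/negP: nab; move: H; rewrite k1 scale0r add0r.
  have -> : k = -1 by apply/eqP; rewrite -addr_eq0 addrC k1.
  by rewrite scaleN1r memvN.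
apply/mem_add_line; exists (- ((1 + k)^-1 * k)); move/(memvZ (1 + k)^-1): H.
by rewrite scalerDr !scalerA mulVf // scale1r scaleNr opprK.
Qed.

Lemma plane_trivial (U : {vspace vT}) (ab ac : vT) (k1 k2 : K) : ab \notin U ->
  ac \notin (U + <[ab]>)%VS -> k2 *: ac + k1 *: ab \in U -> k1 = 0 /\ k2 = 0.
Proof.
move=> nab nac H; have k20 : k2 = 0.
  apply/eqP; apply: contraNT nac => k20; apply/mem_add_line; exists (- (k2^-1 * k1)).
  by move/(memvZ k2^-1): H; rewrite scalerDr !scalerA mulVf // scale1r scaleNr opprK.
split=> //; apply/eqP; apply: contraNT nab => k10; move: H.
by rewrite k20 scale0r add0r => /(memvZ k1^-1); rewrite scalerA mulVf // scale1r.
Qed.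

(** Modulo [U], the triangle [ABC] and the star of [D] have opposite sums by the ten-term relation
    and equal sums by the pairing of opposite edges. So twice the triangle lies in [U]. *)
Lemma double_sum (U : {vspace vT}) (AB AC AD AE BC BD BE CD CE DE : vT) : (2 : K) != 0 ->
  AB + AC + AD + AE + BC + BD + BE + CD + CE + DE = 0 ->
  [/\ AE \in U, BE \in U, CE \in U & DE \in U] ->
  BD - AC \in U -> CD - AB \in U -> BC - AD \in U -> AB + AC + BC \in U.
Proof.
move=> two0 sum0 [ae be ce de] h1 h2 h3.
have H1 : AB + AC + BC + (AD + BD + CD) \in U.
  have : AB + AC + BC + (AD + BD + CD) + (AE + BE + CE + DE) \in U.
    suff -> : AB + AC + BC + (AD + BD + CD) + (AE + BE + CE + DE) = 0 by apply: mem0v.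
    by rewrite -[RHS]sum0 addrA !addrA; rewrite [LHS](ACl (1*2*4*7*3*5*8*6*9*10))%AC.
  by rewrite rpredDr // !rpredD.
have H2 : AB + AC + BC - (AD + BD + CD) \in U.
  have -> : AB + AC + BC - (AD + BD + CD) = (BC - AD) - (BD - AC) - (CD - AB).
    by rewrite !opprB !opprD !addrA [LHS](ACl (3*4*2*5*1*6))%AC.
  by apply: memvB => //; apply: memvB.
have := memvD H1 H2; rewrite addrACA subrr addr0 -mulr2n -scaler_nat => /(memvZ 2^-1).
by rewrite scalerA mulVf // scale1r.
Qed.

End Spans.

Definition span_set (K : fieldType) (vT : vectType K) (T : finType) (f : T -> vT)
  (S : {set T}) : {vspace vT} := (\sum_(e in S) <[f e]>)%VS.

Section SpanSet.
Variables (K : fieldType) (vT : vectType K) (T : finType) (f : T -> vT).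
Local Notation RS := (span_set f).

Lemma span_set_mem (S : {set T}) e : e \in S -> f e \in RS S.
Proof. by move=> eS; rewrite memvE /span_set (sumv_sup e). Qed.

Lemma span_set_subP (S : {set T}) (U : {vspace vT}) :
  reflect (forall e, e \in S -> f e \in U) (RS S <= U)%VS.
Proof.
apply: (iffP subv_sumP) => H e /H; by rewrite memvE.
Qed.

Lemma span_setS (S S' : {set T}) : S \subset S' -> (RS S <= RS S')%VS.
Proof.
by move=> s; apply/span_set_subP => e eS; apply: span_set_mem; apply: (subsetP s).
Qed.

Lemma span_setU (S S' : {set T}) : RS (S :|: S') = (RS S + RS S')%VS.
Proof.
apply/eqP; rewrite eqEsubv; apply/andP; split; last first.
  by rewrite subv_add; apply/andP; split; apply: span_setS; rewrite ?subsetUl ?subsetUr.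
apply/span_set_subP => e; rewrite inE => /orP[] /span_set_mem H.
  exact: subvP (addvSl _ _) _ H.
exact: subvP (addvSr _ _) _ H.
Qed.

Lemma span_set1 e : RS [set e] = <[f e]>%VS.
Proof. by rewrite /span_set big_set1. Qed.

Lemma span_set0 : RS set0 = 0%VS.
Proof. by rewrite /span_set big_set0. Qed.

Lemma span_set_card (S : {set T}) : (\dim (RS S) <= #|S|)%N.
Proof.
rewrite /span_set -sum1_card (leq_trans (dimv_leq_sum _ _ _)) //.
by apply: leq_sum => e _; rewrite dim_vline leq_b1.
Qed.

Lemma span_set_seq (S : {set T}) : RS S = <<[seq f e | e <- enum S]>>%VS.
Proof. by rewrite span_def big_map big_enum. Qed.

End SpanSet.

(** * Independence of rows and its behaviour under specialization *)

Section RowFree.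
Variables (K : fieldType) (n p : nat).

Lemma row_free_free (m : nat) (s : m.-tuple 'M[K]_(n, p)) :
  row_free (\matrix_(k < m) mxvec (tnth s k)) = free s.
Proof.
apply/idP/freeP => [|H].
  rewrite -kermx_eq0 => /eqP k0 k Hk i.
  have /sub_kermxP : (\row_j k j) *m (\matrix_(k < m) mxvec (tnth s k)) = 0.
    rewrite mulmx_sum_row -[RHS](linear0 mxvec) -Hk linear_sum /=.
    by apply: eq_bigr => j _; rewrite mxE rowK linearZ /= (tnth_nth 0).
  rewrite k0 submx0 => /eqP/rowP/(_ i); by rewrite !mxE.
rewrite -kermx_eq0; apply/eqP/row_matrixP => r; rewrite row0.
set u := row r _.
have : u *m (\matrix_(k < m) mxvec (tnth s k)) = 0.
  by apply/sub_kermxP; rewrite row_sub.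
rewrite mulmx_sum_row => E.
have /H : \sum_(i < m) u 0 i *: s`_i = 0.
  apply: (can_inj mxvecK); rewrite linear0 -[RHS]E linear_sum /=.
  by apply: eq_bigr => j _; rewrite rowK linearZ /= (tnth_nth 0).
by move=> u0; apply/rowP => j; rewrite u0 mxE.
Qed.

End RowFree.

(** Some maximal minor is nonzero at [ev'], with columns given by [fullrankfun]. The same minor over
    [A] is then nonzero at [ev]. *)
Lemma row_free_special (A : comNzRingType) (K : fieldType) (ev ev' : {rmorphism A -> K})
    (m N : nat) (B : 'M[A]_(m, N)) :
  (forall a, ev' a != 0 -> ev a != 0) ->
  row_free (map_mx ev' B) -> row_free (map_mx ev B).
Proof.
move=> H fB.
have fB' : row_full (map_mx ev' B)^T by rewrite /row_full mxrank_tr.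
have := fullrowsub_unit fB'; set g := fullrankfun fB'.
have E (f : {rmorphism A -> K}) : rowsub g (map_mx f B)^T = map_mx f (rowsub g B^T).
  by apply/matrixP=> i j; rewrite !mxE.
rewrite E unitmxE det_map_mx unitfE => /H; rewrite -det_map_mx -unitfE -unitmxE -E => U.
rewrite -row_leq_rank -mxrank_tr -[leqLHS](mxrank_unit U).
by apply: mxrankS; apply: rowsub_sub.
Qed.

(** * Rows of the cofactor matrix and the stress of K_5 *)

Definition rowv (R : nzRingType) (n : nat) (x y : 'I_n -> R) (i j : 'I_n) : 'M[R]_(n, 3) :=
  \matrix_(k < n, l < 3)
    (if k == i then Dvec x y i j l else if k == j then - Dvec x y i j l else 0).

(** Twice the signed area of the triangle [i j k]; it vanishes exactly when the three points are
    collinear. *)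
Definition br (R : nzRingType) (n : nat) (x y : 'I_n -> R) (i j k : 'I_n) : R :=
  (x j - x i) * (y k - y i) - (x k - x i) * (y j - y i).

Definition tri (R : nzRingType) (n : nat) (x y : 'I_n -> R) (i j k l m : 'I_n) : R :=
  br x y i j k * br x y i j l * br x y i j m.

(* The row of [ij] weighted by its coefficient in the stress of the [K_5] on
   [i, j, k, l, m]; it is symmetric in [i] and [j]. *)
Definition stress (R : fieldType) (n : nat) (x y : 'I_n -> R) (i j k l m : 'I_n) : 'M[R]_(n, 3) :=
  (tri x y i j k l m)^-1 *: rowv x y i j.

Section Rows.
Variables (R : fieldType) (n : nat).
Implicit Types (x y : 'I_n -> R) (i j k l m : 'I_n).

Lemma DvecC x y i j (t : 'I_3) : Dvec x y j i t = Dvec x y i j t.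
Proof. by rewrite /Dvec; case: ifP => _; [|case: ifP => _]; ring. Qed.

Lemma rowvC x y i j : i != j -> rowv x y j i = - rowv x y i j.
Proof.
move=> ij; apply/matrixP=> k l; rewrite !mxE DvecC.
have [->|_] := eqVneq k j; first by rewrite (eq_sym j i) (negPf ij) opprK.
by case: eqP; rewrite ?opprK ?oppr0.
Qed.

Lemma br_swap x y i j k : br x y j i k = - br x y i j k.
Proof. by rewrite /br; ring. Qed.

Lemma br_swapr x y i j k : br x y i k j = - br x y i j k.
Proof. by rewrite /br; ring. Qed.

Lemma triC x y i j k l m : tri x y j i k l m = - tri x y i j k l m.
Proof. by rewrite /tri !(br_swap x y i j); ring. Qed.

Lemma stressC x y i j k l m : i != j -> stress x y j i k l m = stress x y i j k l m.
Proof. by move=> ij; rewrite /stress rowvC // triC invrN scalerN scaleNr opprK. Qed.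

Lemma stress_swap12 x y i j k l m : stress x y i j l k m = stress x y i j k l m.
Proof. by rewrite /stress /tri -!mulrA (mulrCA (br x y i j l)). Qed.

Lemma row_rowv x y i j : row i (rowv x y i j) = \row_l Dvec x y i j l.
Proof. by apply/rowP=> l; rewrite !mxE eqxx. Qed.

Lemma row_rowv_off x y i j k : k != i -> k != j -> row k (rowv x y i j) = 0.
Proof. by move=> /negPf ki /negPf kj; apply/rowP=> l; rewrite !mxE ki kj. Qed.

Lemma eq_rowv x y x' y' i j : x i = x' i -> x j = x' j -> y i = y' i -> y j = y' j ->
  rowv x y i j = rowv x' y' i j.
Proof. by move=> e1 e2 e3 e4; apply/matrixP=> k l; rewrite !mxE /Dvec e1 e2 e3 e4. Qed.

(* The coefficients are a local stress at [i]: for directions d_1..d_4 in the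
   plane, sum_j D(d_j) / prod_(k <> j) (d_j x d_k) = 0. *)
Lemma local_stress x y i j k l m (t : 'I_3) :
  br x y i j k != 0 -> br x y i j l != 0 -> br x y i j m != 0 ->
  br x y i k l != 0 -> br x y i k m != 0 -> br x y i l m != 0 ->
  (tri x y i j k l m)^-1 * Dvec x y i j t + (tri x y i k j l m)^-1 * Dvec x y i k t
  + (tri x y i l j k m)^-1 * Dvec x y i l t + (tri x y i m j k l)^-1 * Dvec x y i m t = 0.
Proof.
rewrite /tri (br_swapr x y i j k) (br_swapr x y i j l) (br_swapr x y i j m).
rewrite (br_swapr x y i k l) (br_swapr x y i k m) (br_swapr x y i l m).
rewrite /br /Dvec.
set a1 := x j - x i; set b1 := y j - y i; set a2 := x k - x i; set b2 := y k - y i.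
set a3 := x l - x i; set b3 := y l - y i; set a4 := x m - x i; set b4 := y m - y i.
rewrite -(opprB (x j)) -(opprB (y j)) -(opprB (x k)) -(opprB (y k)).
rewrite -(opprB (x l)) -(opprB (y l)) -(opprB (x m)) -(opprB (y m)).
rewrite -/a1 -/a2 -/a3 -/a4 -/b1 -/b2 -/b3 -/b4.
clearbody a1 a2 a3 a4 b1 b2 b3 b4.
move=> h1 h2 h3 h4 h5 h6.
case: ifP => _; [|case: ifP => _]; field;
  by rewrite !oppr_eq0 h1 h2 h3 h4 h5 h6.
Qed.

(** At each of the five vertices the identity is [local_stress]: the minus sign of a row at its
    second end cancels the sign that [tri] acquires when the two ends are exchanged. *)
Lemma K5_stress x y (a b c d e : 'I_n) : uniq [:: a; b; c; d; e] ->
  (forall i j k, i \in [:: a; b; c; d; e] -> j \in [:: a; b; c; d; e] ->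
     k \in [:: a; b; c; d; e] -> uniq [:: i; j; k] -> br x y i j k != 0) ->
  stress x y a b c d e + stress x y a c b d e + stress x y a d b c e + stress x y a e b c d
  + stress x y b c a d e + stress x y b d a c e + stress x y b e a c d
  + stress x y c d a b e + stress x y c e a b d + stress x y d e a b c = 0.
Proof.
move=> /= /and5P[]; rewrite !inE !negb_or => /and4P[ab ac ad ae] /and3P[bc bd be] /andP[cd ce] de _ H.
have B i j k : i \in [:: a; b; c; d; e] -> j \in [:: a; b; c; d; e] ->
     k \in [:: a; b; c; d; e] -> i != j -> i != k -> j != k -> br x y i j k != 0.
  by move=> *; apply: H => //=; rewrite !inE !negb_or; apply/and3P; split=> //; apply/andP.
have N := (negPf ab, negPf ac, negPf ad, negPf ae, negPf bc, negPf bd, negPf be, negPf cd, negPf ce, negPf de).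
have S i j : i != j -> (j == i) = false by rewrite eq_sym => /negPf.
have N' := (S _ _ ab, S _ _ ac, S _ _ ad, S _ _ ae, S _ _ bc, S _ _ bd, S _ _ be, S _ _ cd, S _ _ ce, S _ _ de).
apply/matrixP=> k t; rewrite !mxE.
have [->|ka] := eqVneq k a.
  rewrite ?(N, N') ?mulr0 ?addr0.
  by apply: local_stress; apply: B; rewrite ?inE ?eqxx ?orbT.
have [->|kb] := eqVneq k b.
  rewrite ?(N, N') ?mulr0 ?(addr0, add0r) mulrN -DvecC -mulNr -invrN -triC.
  by apply: local_stress; apply: B; rewrite ?inE ?eqxx ?orbT ?N ?N'.
have [->|kc] := eqVneq k c.
  rewrite ?(N, N') ?mulr0 ?(addr0, add0r) !mulrN -!mulNr -!invrN -!triC -!(DvecC _ _ _ c).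
  by apply: local_stress; apply: B; rewrite ?inE ?eqxx ?orbT ?N ?N'.
have [->|kd] := eqVneq k d.
  rewrite ?(N, N') ?mulr0 ?(addr0, add0r) !mulrN -!mulNr -!invrN -!triC -!(DvecC _ _ _ d).
  by apply: local_stress; apply: B; rewrite ?inE ?eqxx ?orbT ?N ?N'.
have [_|_] := eqVneq k e; last by rewrite !mulr0 !addr0.
rewrite ?(N, N') ?mulr0 ?(addr0, add0r) !mulrN -!mulNr -!invrN -!triC -!(DvecC _ _ _ e).
by apply: local_stress; apply: B; rewrite ?inE ?eqxx ?orbT ?N ?N'.
Qed.

Lemma Dvec_indep x y i j k l (c1 c2 c3 : R) :
  br x y i j k != 0 -> br x y i j l != 0 -> br x y i k l != 0 ->
  (forall t, c1 * Dvec x y i j t + c2 * Dvec x y i k t + c3 * Dvec x y i l t = 0) ->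
  [/\ c1 = 0, c2 = 0 & c3 = 0].
Proof.
move=> h1 h2 h3 H.
have E0 := H 0; have E1 := H 1; have E2 := H (inord 2).
move: E0 E1 E2; rewrite /Dvec /= !inordK //= => E0 E1 E2.
have z (c u v : R) : u != 0 -> v != 0 -> c * u * v = 0 -> c = 0.
  by move=> u0 v0 /eqP; rewrite !mulf_eq0 (negPf u0) (negPf v0) !orbF => /eqP.
(* evaluate on the quadratic form vanishing in the two other directions *)
have Q (p q r s : R) : p * r * (c1 * (x i - x j) ^+ 2 + c2 * (x i - x k) ^+ 2 + c3 * (x i - x l) ^+ 2)
  - (p * s + q * r) * (c1 * ((x i - x j) * (y i - y j)) + c2 * ((x i - x k) * (y i - y k)) + c3 * ((x i - x l) * (y i - y l)))
  + q * s * (c1 * (y i - y j) ^+ 2 + c2 * (y i - y k) ^+ 2 + c3 * (y i - y l) ^+ 2) = 0.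
  by rewrite E0 E1 E2; ring.
split.
- apply: (z _ (br x y i j k) (br x y i j l)) => //.
  rewrite -(Q (y k - y i) (x k - x i) (y l - y i) (x l - x i)) /br; ring.
- apply: (z _ (br x y i j k) (br x y i k l)) => //; apply/eqP; rewrite -oppr_eq0; apply/eqP.
  rewrite -(Q (y j - y i) (x j - x i) (y l - y i) (x l - x i)) /br; ring.
- apply: (z _ (br x y i j l) (br x y i k l)) => //.
  rewrite -(Q (y j - y i) (x j - x i) (y k - y i) (x k - x i)) /br; ring.
Qed.

End Rows.

(** * Genericity *)

Section Evaluation.
Variables (A B : comNzRingType) (f : {rmorphism A -> B}) (n : nat).
Variables (p q : 'I_n -> A) (x y : 'I_n -> B).
Hypotheses (fp : forall i, f (p i) = x i) (fq : forall i, f (q i) = y i).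

Lemma br_map i j k : f (br p q i j k) = br x y i j k.
Proof. by rewrite /br rmorphB !rmorphM !rmorphB !fp !fq. Qed.

Lemma tri_map i j k l m : f (tri p q i j k l m) = tri x y i j k l m.
Proof. by rewrite /tri !rmorphM !br_map. Qed.

Lemma Dvec_map i j t : f (Dvec p q i j t) = Dvec x y i j t.
Proof.
rewrite /Dvec; case: ifP => _; [|case: ifP => _];
  by rewrite ?rmorphXn ?rmorphM !rmorphB ?fp ?fq.
Qed.

Lemma rowv_map i j : map_mx f (rowv p q i j) = rowv x y i j.
Proof.
apply/matrixP=> k t; rewrite !mxE; case: ifP => _; first by rewrite Dvec_map.
by case: ifP => _; rewrite ?rmorphN ?Dvec_map ?rmorph0.
Qed.

End Evaluation.

Section Generic.
Variables (R : realFieldType) (n : nat).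
Local Notation A := {mpoly rat[n + n]}.

Definition evp (x y : 'I_n -> R) : {rmorphism A -> R} :=
  (meval (coords x y) \o map_mpoly (ratr : rat -> R)).

Definition px (i : 'I_n) : A := 'X_(lshift n i).
Definition py (i : 'I_n) : A := 'X_(rshift n i).

Lemma evp_px x y i : evp x y (px i) = x i.
Proof.
rewrite /evp /px /= map_mpolyX mevalXU /coords.
by rewrite -[lshift n i]/(unsplit (inl i)) unsplitK.
Qed.

Lemma evp_py x y i : evp x y (py i) = y i.
Proof.
rewrite /evp /py /= map_mpolyX mevalXU /coords.
by rewrite -[rshift n i]/(unsplit (inr i)) unsplitK.
Qed.

Lemma ev_br x y i j k : evp x y (br px py i j k) = br x y i j k.
Proof. exact: br_map (evp_px x y) (evp_py x y) i j k. Qed.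

Lemma ev_rowv x y i j : map_mx (evp x y) (rowv px py i j) = rowv x y i j.
Proof. exact: rowv_map (evp_px x y) (evp_py x y) i j. Qed.

Variables (x y : 'I_n -> R).
Hypothesis gen : alg_indep_Q (coords x y).

Lemma gen_ne0 (x' y' : 'I_n -> R) (P : A) : evp x' y' P != 0 -> evp x y P != 0.
Proof. by move=> H; apply: gen; apply: contraNneq H => ->; rewrite rmorph0. Qed.

Lemma gen_free (x' y' : 'I_n -> R) (s : seq 'M[A]_(n, 3)) :
  free [seq map_mx (evp x' y') v | v <- s] -> free [seq map_mx (evp x y) v | v <- s].
Proof.
have E (f : {rmorphism A -> R}) : row_free (map_mx f (\matrix_(k < size s) mxvec (tnth (in_tuple s) k)))
    = free [seq map_mx f v | v <- s].
  rewrite -[RHS]/(free (map_tuple (map_mx f) (in_tuple s))) -row_free_free; congr row_free.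
  by apply/row_matrixP=> k; rewrite -map_row !rowK tnth_map map_mxvec.
rewrite -(E (evp x' y')) -(E (evp x y)) => H.
exact: (row_free_special (ev' := evp x' y') (@gen_ne0 x' y') H).
Qed.

(** Semicontinuity of rank: positions that form a basis at [(x', y')] stay independent at the
    generic point. *)
Lemma gen_dim (x' y' : 'I_n -> R) (s : seq 'M[A]_(n, 3)) :
  (\dim <<[seq map_mx (evp x' y') v | v <- s]>> <= \dim <<[seq map_mx (evp x y) v | v <- s]>>)%N.
Proof.
have [m [fm <-]] := free_mask [seq map_mx (evp x' y') v | v <- s].
rewrite -map_mask in fm *; rewrite (eqP fm) size_map.
have := gen_free fm; rewrite /free => /eqP; rewrite size_map => <-; rewrite map_mask.
apply: dimvS; apply/span_subvP => v vin; apply: memv_span; exact: mem_mask vin.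
Qed.

Lemma gen_br i j k : i != j -> i != k -> j != k -> br x y i j k != 0.
Proof.
move=> ij ik jk; rewrite -ev_br.
(* The witness puts [j] at [(1, 0)], [k] at [(0, 1)] and all other vertices at the origin, where the
   bracket is 1. *)
apply: (@gen_ne0 (fun t => (t == j)%:R) (fun t => (t == k)%:R)).
rewrite ev_br /br !eqxx (negPf ij) (negPf ik) (negPf jk) (eq_sym k) (negPf jk).
by rewrite !subr0 mul0r subr0 mulr1 oner_eq0.
Qed.

(** The bracket is affine in its first point, so this sum is twice the bracket of the midpoint of
    [a b] with [c] and [d]: the midpoint is not on the line [c d]. *)
Lemma gen_br_mid a b c d : a != c -> a != d -> b != c -> b != d -> c != d ->
  br x y a c d + br x y b c d != 0.
Proof.
move=> ac ad bc bd cd; rewrite -!ev_br -rmorphD.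
apply: (@gen_ne0 (fun t => (t == c)%:R) (fun t => (t == d)%:R)).
rewrite rmorphD !ev_br /br !eqxx (negPf ac) (negPf ad) (negPf bc) (negPf bd) (eq_sym d) (negPf cd).
by rewrite !subr0 mul0r subr0 mulr1 lt0r_neq0 // addr_gt0 // ltr01.
Qed.

(** The lines [a b] and [c d] are not parallel, so they have a crossing point at which a vertex can
    be placed. *)
Lemma gen_cross a b c d : a != b -> a != d -> b != c -> b != d -> c != d ->
  (x b - x a) * (y d - y c) - (x d - x c) * (y b - y a) != 0.
Proof.
move=> ab ad bc bd cd.
have E x' y' : evp x' y' ((px b - px a) * (py d - py c) - (px d - px c) * (py b - py a))
    = (x' b - x' a) * (y' d - y' c) - (x' d - x' c) * (y' b - y' a).
  by rewrite rmorphB !rmorphM !rmorphB !evp_px !evp_py.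
rewrite -E; apply: (@gen_ne0 (fun t => (t == b)%:R) (fun t => (t == d)%:R)).
rewrite E !eqxx (eq_sym d) (eq_sym c b) (negPf ab) (negPf bc) (negPf bd) (negPf ad) (negPf cd).
by rewrite !subr0 mul0r subr0 mulr1 oner_eq0.
Qed.

End Generic.

(** * Labelled five-element sets and the classification of local obstructions *)

Section Labels.
Variables (I : finType) (A : {set I}).

Definition labels (s : seq I) : bool := uniq s && all (mem A) s.

Lemma labels_perm s t : perm_eq s t -> labels s -> labels t.
Proof. by move=> st; rewrite /labels (perm_uniq st) (perm_all _ st). Qed.

Lemma labels_cat s t : labels (s ++ t) -> labels s.
Proof. by rewrite /labels cat_uniq all_cat => /andP[/and3P[-> _ _] /andP[-> _]]. Qed.

Lemma labels_cons z s : labels (z :: s) = [&& z \in A, z \notin s & labels s].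
Proof. by rewrite /labels /=; do !case: (_ \in _) => //=; rewrite ?andbF. Qed.

Lemma labels_extend k s : labels s -> (size s + k <= #|A|)%N ->
  exists t, size t = k /\ labels (s ++ t).
Proof.
elim: k s => [|k IH] s Ls; first by exists [::]; rewrite cats0.
move=> le; have [us /allP as_] := andP Ls.
have [z zA zs] : exists2 z, z \in A & z \notin s.
  apply/subsetPn; apply: contraTN le => /subset_leq_card.
  by rewrite (card_uniqP us); lia.
have [||t [st Lt]] := IH (z :: s); rewrite ?labels_cons ?zA ?zs //=; first lia.
exists (z :: t); rewrite /= st; split=> //.
by apply: labels_perm Lt; rewrite -[z :: t]cat1s perm_sym perm_catCA.
Qed.

Lemma labels_all s z : labels s -> size s = #|A| -> z \in A -> z \in s.
Proof.
case/andP=> us /allP as_ sz zA.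
suff -> : s =i A by [].
apply/subset_cardP; first by rewrite (card_uniqP us).
by apply/subsetP => t /as_.
Qed.

Lemma labels2E a b : labels [:: a; b] = [&& a != b, a \in A & b \in A].
Proof. by rewrite /labels /= mem_seq1 !andbT. Qed.

Lemma labels4P a b c d : labels [:: a; b; c; d] ->
  [/\ [/\ a \in A, b \in A, c \in A & d \in A], [/\ a != b, a != c & a != d],
      b != c, b != d & c != d].
Proof.
rewrite /labels /= !inE !negb_or !andbT => /andP[/and3P[/and3P[-> -> ->] /andP[-> ->] ->]].
by case/and4P => -> -> -> ->.
Qed.

Lemma labels5P a b c d e : labels [:: a; b; c; d; e] ->
  [/\ [/\ a \in A, b \in A, c \in A, d \in A & e \in A], [/\ a != b, a != c, a != d & a != e],
      [/\ b != c, b != d & b != e], c != d /\ c != e & d != e].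
Proof.
rewrite /labels /= !inE !negb_or !andbT.
case/andP => /and4P[/and4P[-> -> -> ->] /and3P[-> -> ->] /andP[-> ->] ->].
by case/and5P => -> -> -> -> ->.
Qed.

End Labels.

(** Two lists are permutations of each other when all counts agree; for explicit lists these are
    sums of the same terms, which [ring] compares. *)
Ltac perm_labels L := refine (labels_perm _ L); apply/permP => ? /=; ring.
Ltac sub_labels L t := apply: (@labels_cat _ _ _ t); perm_labels L.

Section Classification.
Variables (K : fieldType) (V : vectType K) (I : finType) (A : {set I}) (F : I -> I -> V).

(** Linear dependence of two vectors. It is symmetric but not transitive, since zero is parallel to
    everything; [par_common] therefore needs a nonzero middle vector. *)
Definition par (u v : V) : bool := (u == 0) || (v \in <[u]>%VS).

Lemma line_sym (u v : V) : u != 0 -> u \in <[v]>%VS -> v \in <[u]>%VS.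
Proof.
move=> u0 /vlineP[k E]; have k0 : k != 0.
  by apply: contraNneq u0 => k0; rewrite E k0 scale0r.
by apply/vlineP; exists k^-1; rewrite E scalerA mulVf // scale1r.
Qed.

Lemma line_trans (u v w : V) : u \in <[v]>%VS -> v \in <[w]>%VS -> u \in <[w]>%VS.
Proof. by rewrite !memvE; apply: subv_trans. Qed.

Lemma par_sym u v : par u v = par v u.
Proof.
suff H a b : par a b -> par b a by apply/idP/idP => /H.
case/orP => [/eqP ->|]; first by rewrite /par mem0v orbT.
by move=> ba; rewrite /par; case: eqP => //= /eqP b0; apply: line_sym.
Qed.

Lemma par_line u v : u != 0 -> par u v -> v \in <[u]>%VS.
Proof. by rewrite /par => /negPf ->. Qed.

Lemma par_common u v w : w != 0 -> par u w -> par v w -> par u v.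
Proof.
rewrite par_sym (par_sym v) => w0 /(par_line w0) uw /(par_line w0) vw.
rewrite /par; have [//|u0 /=] := eqVneq u 0.
by apply: line_trans vw _; apply: line_sym.
Qed.

Hypothesis FC : forall i j, i != j -> F j i = F i j.
Hypothesis cA : #|A| = 5%N.
Hypothesis disj : forall i j k l, labels A [:: i; j; k; l] -> par (F i j) (F k l).
Hypothesis vert : forall i j k l m, labels A [:: i; j; k; l; m] ->
  par (F i j) (F i j + F i k + F i l + F i m).

Definition spread_line := exists a b, labels A [:: a; b] /\
  forall i j, labels A [:: i; j] -> F i j \in <[F a b]>%VS.
Definition spread_star := exists2 a, a \in A &
  forall i j, labels A [:: i; j] -> i != a -> j != a -> F i j = 0.
(** The twisted quadrilateral. Its three values sum to zero, so all five vertex sums vanish and both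
    [disj] and [vert] hold: it is a true solution of the relations. *)
Definition spread_K4 := exists a b c d e,
  [/\ labels A [:: a; b; c; d; e],
      [/\ F a e = 0, F b e = 0, F c e = 0 & F d e = 0],
      [/\ F b d = F a c, F c d = F a b, F a d = F b c & F b c = - (F a b + F a c)] &
      ~~ par (F a b) (F a c)].

Lemma labels_neq i j : labels A [:: i; j] -> i != j.
Proof. by rewrite !labels_cons inE => /and3P[]. Qed.

Lemma labels_FC i j : labels A [:: i; j] -> F j i = F i j.
Proof. by move/labels_neq/FC. Qed.

Lemma labels5_FC a b c d e : labels A [:: a; b; c; d; e] ->
  (F b a = F a b) * (F c a = F a c) * (F d a = F a d) * (F e a = F a e) *
  (F c b = F b c) * (F d b = F b d) * (F e b = F b e) *
  (F d c = F c d) * (F e c = F c e) * (F e d = F d e).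
Proof.
move=> L; do !split; apply: labels_FC.
- by sub_labels L [:: c; d; e].
- by sub_labels L [:: b; d; e].
- by sub_labels L [:: b; c; e].
- by sub_labels L [:: b; c; d].
- by sub_labels L [:: a; d; e].
- by sub_labels L [:: a; c; e].
- by sub_labels L [:: a; c; d].
- by sub_labels L [:: a; b; e].
- by sub_labels L [:: a; b; d].
- by sub_labels L [:: a; b; c].
Qed.

(** The sum at [u] lies outside [L], while each of the other three values lies in [L] and is
    parallel to that sum; hence it is zero. *)
Lemma off_line_zero (L : {vspace V}) b u p q r : labels A [:: u; b; p; q; r] ->
  F u b \notin L -> F u p \in L -> F u q \in L -> F u r \in L ->
  [/\ F u p = 0, F u q = 0 & F u r = 0].
Proof.
move=> Lb ub up uq ur; set s := F u b + F u p + F u q + F u r.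
have sL : s \notin L by rewrite /s !rpredDr.
have s0 : s != 0 by apply: contraNneq sL => ->; apply: mem0v.
have Z z : z \in L -> par z s -> z = 0.
  move=> zL pz; apply/eqP; apply: contraNT sL => z0.
  have := par_line z0 pz; rewrite memvE => /subv_trans; rewrite memvE; apply.
  by rewrite -memvE.
have P p' q' r' : labels A [:: u; p'; b; q'; r'] -> F u b + F u p' + F u q' + F u r' = s -> F u p' \in L -> F u p' = 0.
  move=> L' E pL; apply: Z => //; have := vert L'; congr (par _ _).
  by rewrite -E (addrC (F u p')).
split; [apply: (P p q r)|apply: (P q p r)|apply: (P r p q)] => //.
- by perm_labels Lb.
- by perm_labels Lb.
- by rewrite /s (addrAC (F u b)).
- by perm_labels Lb.
- by rewrite /s [RHS]addrAC (addrAC _ (F u r) (F u p)).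
Qed.

Lemma labels5_pairs a b c d e (P : I -> I -> Prop) : labels A [:: a; b; c; d; e] ->
  (forall i j, P i j -> P j i) ->
  P a b -> P a c -> P a d -> P a e -> P b c -> P b d -> P b e -> P c d -> P c e -> P d e ->
  forall i j, labels A [:: i; j] -> P i j.
Proof.
move=> L5 sP ab ac ad ae bc bd be cd ce de i j Lij.
have Hall z : z \in A -> z \in [:: a; b; c; d; e] by apply: labels_all; rewrite ?cA.
have ij := labels_neq Lij.
have [/Hall iL /Hall jL] : i \in A /\ j \in A by move: Lij; rewrite !labels_cons => /and4P[-> _ ->].
move: iL jL ij; rewrite !inE => /or4P[/eqP->|/eqP->|/eqP->|/orP[]/eqP->] /or4P[/eqP->|/eqP->|/eqP->|/orP[]/eqP->];
  rewrite ?eqxx // => _; solve [by [] | by apply: sP].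
Qed.

Lemma star_at b a c d e : labels A [:: a; b; c; d; e] ->
  F a c = 0 -> F a d = 0 -> F a e = 0 -> F c d = 0 -> F c e = 0 -> F d e = 0 -> spread_star.
Proof.
move=> L5 ac ad ae cd ce de; exists b; first by move: L5; rewrite !labels_cons => /and4P[_ _ ->].
move=> i j Lij ib jb; pose P i j := i != b -> j != b -> F i j = 0 /\ F j i = 0.
suff : P i j by case.
move: Lij; apply: (labels5_pairs L5); rewrite /P ?eqxx //; first by move=> u v H vb ub; have [] := H ub vb.
all: by move=> _ _; rewrite ?(labels5_FC L5).
Qed.

(** At [c] and at [d] only the edge to [b] leaves the line, so [off_line_zero] kills the other edges
    there. The edge [a e] is parallel to [b c], which is off the line, and so vanishes too. *)
Lemma sigma_case_off2 a b c d e : labels A [:: a; b; c; d; e] ->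
  (forall j, j \in [:: c; d; e] -> F a j \in <[F a b]>%VS) -> F a b != 0 ->
  F b c \notin <[F a b]>%VS -> F b d \notin <[F a b]>%VS -> spread_star.
Proof.
move=> L5 aL ab0 bc bd; have E := labels5_FC L5.
have D i j : labels A [:: a; b; i; j] -> F i j \in <[F a b]>%VS.
  by move=> L4; apply: par_line ab0 _; apply: disj.
have cd : F c d \in <[F a b]>%VS by apply: D; sub_labels L5 [:: e].
have ce : F c e \in <[F a b]>%VS by apply: D; sub_labels L5 [:: d].
have de : F d e \in <[F a b]>%VS by apply: D; sub_labels L5 [:: c].
have ac : F a c \in <[F a b]>%VS by apply: aL; rewrite !inE eqxx ?orbT.
have ad : F a d \in <[F a b]>%VS by apply: aL; rewrite !inE eqxx ?orbT.
have ae : F a e \in <[F a b]>%VS by apply: aL; rewrite !inE eqxx ?orbT.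
have [|||||ca0 cd0 ce0] := @off_line_zero <[F a b]>%VS b c a d e; rewrite ?E //; first by perm_labels L5.
have [|||||da0 _ de0] := @off_line_zero <[F a b]>%VS b d a c e; rewrite ?E //; first by perm_labels L5.
rewrite !E in ca0 da0; apply: (star_at L5) => //.
apply/eqP; apply: contraNT bc => ea0; apply: line_trans (_ : _ \in <[F a e]>%VS) ae.
apply: par_line ea0 _; rewrite par_sym.
by apply: disj; sub_labels L5 [:: d].
Qed.

(** If the sum at [b] were nonzero, [b a] and [b c] would both be parallel to it and [b c] would be
    on the line. So the sum is zero, and a second edge at [b] must leave the line. *)
Lemma sigma_case_off a b c d e : labels A [:: a; b; c; d; e] ->
  (forall j, j \in [:: c; d; e] -> F a j \in <[F a b]>%VS) -> F a b != 0 ->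
  F b c \notin <[F a b]>%VS -> spread_star.
Proof.
move=> L5 aL ab0 bc; have E := labels5_FC L5.
have sb0 : F b c + F b a + F b d + F b e = 0.
  apply/eqP; apply: contraNT bc => s0.
  have H1 : par (F b c) (F b c + F b a + F b d + F b e) by apply: vert; perm_labels L5.
  have H2 : par (F b a) (F b c + F b a + F b d + F b e).
    by rewrite (addrC (F b c)); apply: vert; perm_labels L5.
  by apply: par_line ab0 _; rewrite -E; apply: par_common s0 H2 H1.
have [bd|bd] := boolP (F b d \in <[F a b]>%VS); last exact: (sigma_case_off2 L5).
apply: (@sigma_case_off2 a b c e d) => //; first by perm_labels L5.
  by move=> j jin; apply: aL; move: jin; rewrite !inE => /or3P[]/eqP->; rewrite eqxx ?orbT.
apply: contraNN bc => be; move/eqP: sb0; rewrite -!addrA addr_eq0 => /eqP ->.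
by rewrite memvN !rpredD // E memv_line.
Qed.

(** The nonzero sum puts all edges at [a] on one line, and [disj] does the same for edges disjoint
    from [a b]. Only the edges from [b] to [c], [d], [e] can leave it. *)
Lemma sigma_case a b c d e : labels A [:: a; b; c; d; e] -> F a b != 0 ->
  F a b + F a c + F a d + F a e != 0 -> spread_line \/ spread_star.
Proof.
move=> L5 ab0 s0; have E := labels5_FC L5.
have sL : F a b + F a c + F a d + F a e \in <[F a b]>%VS.
  by apply: par_line ab0 _; apply: vert.
have aL j : j \in [:: c; d; e] -> F a j \in <[F a b]>%VS.
  have P u v w : labels A [:: a; u; b; v; w] ->
      F a u + F a b + F a v + F a w = F a b + F a c + F a d + F a e -> F a u \in <[F a b]>%VS.
    move=> L' E'; apply: line_trans sL; apply: par_line s0 _; rewrite par_sym -E'.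
    exact: vert L'.
  rewrite !inE => /or3P[]/eqP->.
  - by apply: (P c d e); [perm_labels L5|rewrite (addrC (F a c))].
  - by apply: (P d c e); [perm_labels L5|rewrite (addrC (F a d)) (addrAC (F a b))].
  - by apply: (P e c d); [perm_labels L5|rewrite (addrC (F a e)) (addrAC (F a b) (F a e)) [RHS]addrAC (addrAC (F a b + F a c))].
have Lc : F a c \in <[F a b]>%VS by apply: aL; rewrite !inE eqxx ?orbT.
have Ld : F a d \in <[F a b]>%VS by apply: aL; rewrite !inE eqxx ?orbT.
have Le : F a e \in <[F a b]>%VS by apply: aL; rewrite !inE eqxx ?orbT.
have [bc|bc] := boolP (F b c \in <[F a b]>%VS); last by right; apply: (sigma_case_off L5).
have [bd|bd] := boolP (F b d \in <[F a b]>%VS); last first.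
  right; apply: (@sigma_case_off a b d c e) => //; first by perm_labels L5.
  by move=> j; rewrite !inE => /or3P[]/eqP->.
have [be|be] := boolP (F b e \in <[F a b]>%VS); last first.
  right; apply: (@sigma_case_off a b e c d) => //; first by perm_labels L5.
  by move=> j; rewrite !inE => /or3P[]/eqP->.
left; exists a, b; split; first by sub_labels L5 [:: c; d; e].
have D i j : labels A [:: a; b; i; j] -> F i j \in <[F a b]>%VS.
  by move=> L4; apply: par_line ab0 _; apply: disj.
have cd : F c d \in <[F a b]>%VS by apply: D; sub_labels L5 [:: e].
have ce : F c e \in <[F a b]>%VS by apply: D; sub_labels L5 [:: d].
have de : F d e \in <[F a b]>%VS by apply: D; sub_labels L5 [:: c].
move=> i j Lij; pose P i j := F i j \in <[F a b]>%VS /\ F j i \in <[F a b]>%VS.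
suff : P i j by case.
move: Lij; apply: (labels5_pairs L5); rewrite /P; first (by move=> ? ? []); by rewrite ?E ?memv_line; split.
Qed.

(** [F a b] and [F a c] serve as a basis: [d e] is disjoint from both edges and vanishes, and [disj]
    with the zero sums expresses all other values by four scalars. *)
Lemma K4_case a b c d e : labels A [:: a; b; c; d; e] ->
  (forall i j k l m, labels A [:: i; j; k; l; m] -> F i j + F i k + F i l + F i m = 0) ->
  ~~ par (F a b) (F a c) -> spread_K4.
Proof.
move=> L5 S0 npar; have E := labels5_FC L5.
have := npar; rewrite /par negb_or => /andP[u0 wu].
have w0 : F a c != 0 by apply: contraNneq wu => ->; apply: mem0v.
have lin s t : s *: F a b + t *: F a c = 0 -> s = 0 /\ t = 0.
  move=> H; have t0 : t = 0.
    apply/eqP; apply: contraNT wu => t0; apply/vlineP; exists (- t^-1 * s).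
    apply: (scalerI t0); rewrite scalerA mulNr mulrN mulrA mulfV // mul1r scaleNr.
    by move/eqP: H; rewrite addrC addr_eq0 => /eqP.
  split=> //; move: H; rewrite t0 scale0r addr0 => /eqP; rewrite scaler_eq0 (negPf u0) orbF.
  by move/eqP.
have de0 : F d e = 0.
  apply/eqP; apply: contraNT npar => de; apply: par_common de _ _; apply: disj.
    by sub_labels L5 [:: c].
  by sub_labels L5 [:: b].
have [z Ez] : exists z, F c d = z *: F a b.
  by apply/vlineP; apply: par_line u0 _; apply: disj; sub_labels L5 [:: e].
have [z' Ez'] : exists z, F c e = z *: F a b.
  by apply/vlineP; apply: par_line u0 _; apply: disj; sub_labels L5 [:: d].
have [y Ey] : exists z, F b d = z *: F a c.
  by apply/vlineP; apply: par_line w0 _; apply: disj; sub_labels L5 [:: e].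
have [y' Ey'] : exists z, F b e = z *: F a c.
  by apply/vlineP; apply: par_line w0 _; apply: disj; sub_labels L5 [:: d].
have Sd : F a d = - (y *: F a c + z *: F a b).
  have /eqP : F a d + F b d + F c d + F d e = 0.
    rewrite -(S0 d a b c e); last by perm_labels L5.
    by rewrite !E.
  by rewrite de0 addr0 -addrA addr_eq0 Ey Ez => /eqP.
have Se : F a e = - (y' *: F a c + z' *: F a b).
  have /eqP : F a e + F b e + F c e + F d e = 0.
    rewrite -(S0 e a b c d); last by perm_labels L5.
    by rewrite !E.
  by rewrite de0 addr0 -addrA addr_eq0 Ey' Ez' => /eqP.
have Sb : F b c = - (F a b + (y + y') *: F a c).
  have /eqP : F b c + (F a b + F b d + F b e) = 0.
    rewrite -(S0 b c a d e); last by perm_labels L5.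
    by rewrite !E !addrA.
  by rewrite addr_eq0 Ey Ey' -addrA -scalerDl => /eqP.
have Sc : F b c = - ((z + z') *: F a b + F a c).
  have /eqP : F b c + (F a c + F c d + F c e) = 0.
    rewrite -(S0 c b a d e); last by perm_labels L5.
    by rewrite !E !addrA.
  by rewrite addr_eq0 Ez Ez' -addrA -scalerDl => /eqP ->; rewrite (addrC (F a c)).
(* The sums at [b] and at [c] give two expressions for [F b c]; their coefficients are compared. *)
have [Ezz Eyy] : z + z' = 1 /\ y + y' = 1.
  have [|/eqP h1 /eqP h2] := lin ((z + z') - 1) (1 - (y + y')).
    rewrite !scalerBl !scale1r; move/eqP: Sc; rewrite Sb eqr_opp => /eqP Sc.
    apply/eqP; rewrite addrACA -opprD subr_eq0 -Sc; apply/eqP; congr (_ + _).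
  by split; apply/eqP; [rewrite -subr_eq0|rewrite eq_sym -subr_eq0].
have Ebc : F b c = - (F a b + F a c) by rewrite Sb Eyy scale1r.
have bc0 : F b c != 0.
  rewrite Ebc oppr_eq0; apply/eqP => H; have [|/eqP] := lin 1 1; first by rewrite !scale1r.
  by rewrite oner_eq0.
have yz : y = z.
  have /vlineP[k] : F a d \in <[F b c]>%VS.
    by apply: par_line bc0 _; apply: disj; perm_labels (labels_cat (s := [:: a; b; c; d]) (t := [:: e]) L5).
  rewrite Sd Ebc scalerN => /eqP; rewrite eqr_opp scalerDr => /eqP H.
  have [|/eqP h1 /eqP h2] := lin (z - k) (y - k).
    by rewrite !scalerBl addrACA (addrC (z *: _)) H -opprD subrr.
  by move: h1 h2; rewrite !subr_eq0 => /eqP-> /eqP->.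
(* These are [y] times [F a c] and [z'] times [F a b], so [y = 0] or [z' = 0]. As [y = z] and
   [z' = 1 - z], the first case isolates [d] and the second isolates [e]. *)
have : par (F b d) (F c e) by apply: disj; sub_labels L5 [:: a].
have z'E : z' = 1 - z by rewrite -Ezz addrC addKr.
have y'E : y' = 1 - y by rewrite -Eyy addrC addKr.
case/orP => [|/vlineP[k]].
  rewrite Ey scaler_eq0 (negPf w0) orbF => /eqP y0.
  exists a, b, c, e, d; split=> //; first by perm_labels L5.
    by rewrite (_ : F e d = F d e) ?E // de0 Sd Ey Ez -yz y0 !scale0r addr0 oppr0.
  by rewrite Ey' Ez' Se Ebc y'E z'E -yz y0 subr0 !scale1r (addrC (F a c)).
rewrite Ey Ez' => /eqP; rewrite -subr_eq0 scalerA -scaleNr => /eqP /lin[z'0 _].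
have z1 : z = 1 by apply/eqP; rewrite eq_sym -subr_eq0 -z'E z'0.
exists a, b, c, d, e; split=> //.
  by rewrite Se Ey' Ez' y'E yz z'0 z1 subrr !scale0r addr0 oppr0.
by rewrite Ey Ez Sd Ebc yz z1 !scale1r (addrC (F a c)).
Qed.

(** A nonzero vertex sum leads to a line or a star. If all sums vanish, two nonparallel edges with a
    common end give the quadrilateral; without such a pair all values are pairwise parallel. *)
Lemma classification : [\/ spread_line, spread_star | spread_K4].
Proof.
have [|t [st L5]] := @labels_extend _ A 5 [::] isT; first by rewrite cA.
case: t st L5 => [|a [|b [|c [|d [|e []]]]]] //= _ L5.
have sig_or : (exists i j k l m, labels A [:: i; j; k; l; m] /\ F i j + F i k + F i l + F i m != 0)
   \/ (forall i j k l m, labels A [:: i; j; k; l; m] -> F i j + F i k + F i l + F i m = 0).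
  have [/existsP[i /existsP[j /existsP[k /existsP[l /existsP[m /andP[? ?]]]]]]|H] :=
    boolP [exists i, exists j, exists k, exists l, exists m,
      labels A [:: i; j; k; l; m] && (F i j + F i k + F i l + F i m != 0)].
    by left; exists i, j, k, l, m.
  right=> i j k l m L; apply/eqP; apply: contraNT H => H.
  by do 5!(apply/existsP; eexists); apply/andP; split; [exact: L|exact: H].
case: sig_or => [[i [j [k [l [m [L H]]]]]]|S0].
  suff : spread_line \/ spread_star by case=> ?; [apply: Or31|apply: Or32].
  have [j0|j0] := eqVneq (F i j) 0; last exact: (sigma_case L).
  have [k0|k0] := eqVneq (F i k) 0; last first.
    apply: (@sigma_case i k j l m) => //; first by perm_labels L.
    by rewrite (addrC (F i k)).
  have [l0|l0] := eqVneq (F i l) 0; last first.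
    apply: (@sigma_case i l j k m) => //; first by perm_labels L.
    by move: H; rewrite j0 k0 !add0r !addr0.
  apply: (@sigma_case i m j k l) => //; first by perm_labels L.
    by move: H; rewrite j0 k0 l0 !add0r.
  by move: H; rewrite j0 k0 l0 !add0r !addr0.
have [/existsP[i /existsP[j /existsP[k /andP[L npar]]]]|H] :=
  boolP [exists i, exists j, exists k, labels A [:: i; j; k] && ~~ par (F i j) (F i k)].
  have [|t [st L']] := @labels_extend _ A 2 _ L; first by rewrite cA.
  case: t st L' => [|l [|m []]] //= _ L'.
  by apply: Or33; apply: (K4_case L').
have P3 i j k : labels A [:: i; j; k] -> par (F i j) (F i k).
  move=> L; apply: contraNT H => H; do 3!(apply/existsP; eexists).
  by apply/andP; split; [exact: L|exact: H].
have Pall i j k l : labels A [:: i; j] -> labels A [:: k; l] -> par (F i j) (F k l).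
  move=> Lij Lkl; have ij := labels_neq Lij; have kl := labels_neq Lkl.
  have := Lij; have := Lkl; rewrite !labels_cons !inE /= !andbT => /and3P[kA _ lA] /and3P[iA _ jA].
  have mk u v w : u \in A -> v \in A -> w \in A -> u != v -> u != w -> v != w -> labels A [:: u; v; w].
    by move=> uA vA wA uv uw vw; rewrite /labels /= !inE negb_or uv uw vw uA vA wA.
  have refl u : par u u by rewrite /par memv_line orbT.
  have [ik|ik] := eqVneq i k.
    subst k; have [->|jl] := eqVneq j l; first exact: refl.
    by apply: P3; apply: mk.
  have [il|il] := eqVneq i l.
    subst l; rewrite -(FC kl); have [->|jk] := eqVneq j k; first exact: refl.
    by apply: P3; apply: mk.
  have [jk|jk] := eqVneq j k.
    subst k; rewrite -(FC ij); apply: P3; apply: mk => //; by rewrite eq_sym.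
  have [jl|jl] := eqVneq j l.
    subst l; rewrite -(FC ij) -(FC kl); apply: P3; apply: mk => //; by rewrite eq_sym.
  by apply: disj; rewrite /labels /= !inE !negb_or ij ik il jk jl kl iA jA kA lA.
apply: Or31; have [/existsP[i /existsP[j /andP[L n0]]]|H0] :=
  boolP [exists i, exists j, labels A [:: i; j] && (F i j != 0)].
  by exists i, j; split=> // k l L'; apply: par_line n0 _; apply: Pall.
exists a, b; split; first by sub_labels L5 [:: c; d; e].
move=> i j L; suff -> : F i j = 0 by apply: mem0v.
apply/eqP; apply: contraNT H0 => n0; do 2!(apply/existsP; eexists).
by apply/andP; split; [exact: L|exact: n0].
Qed.

End Classification.

(** * Moving one vertex *)

(** A projection with kernel [U] takes the place of the quotient by [U], so that the classification
    can be applied to vectors. *)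
Lemma quotient_map (K : fieldType) (vT : vectType K) (U : {vspace vT}) :
  exists f : 'End(vT), forall v, (f v == 0) = (v \in U).
Proof.
exists (daddv_pi U^C U) => v.
have d0 : (U^C :&: U = 0)%VS by rewrite capvC capv_compl.
have vin : v \in (U^C + U)%VS by rewrite addvC addv_complf memvf.
apply/eqP/idP => [f0|vU].
  by rewrite -(daddv_pi_add d0 vin) f0 add0r memv_pi.
apply: (addIr (daddv_pi U U^C v)); rewrite daddv_pi_add // add0r daddv_pi_id //.
by rewrite capvC.
Qed.

Section Stars.
Variables (R : realFieldType) (n : nat).
Implicit Types (x y : 'I_n -> R) (w i j k l m : 'I_n) (A : {set 'I_n}).
Local Notation vT := 'M[R]_(n, 3).

Definition off (w : 'I_n) : {vspace vT} := lker (linfun (row w : vT -> 'rV[R]_3)).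

Lemma mem_off w (v : vT) : (v \in off w) = (row w v == 0).
Proof. by rewrite memv_ker lfunE. Qed.

Lemma rowv_off x y w i j : w != i -> w != j -> rowv x y i j \in off w.
Proof. by move=> wi wj; rewrite mem_off row_rowv_off. Qed.

Definition star x y w A : {vspace vT} := span_set (rowv x y w) A.

Lemma three_indep x y w i j k (c1 c2 c3 : R) :
  br x y w i j != 0 -> br x y w i k != 0 -> br x y w j k != 0 ->
  c1 *: rowv x y w i + c2 *: rowv x y w j + c3 *: rowv x y w k \in off w ->
  [/\ c1 = 0, c2 = 0 & c3 = 0].
Proof.
move=> h1 h2 h3; rewrite mem_off !linearD !linearZ /= !row_rowv => /eqP/rowP E.
by apply: (Dvec_indep h1 h2 h3) => t; have := E t; rewrite !mxE.
Qed.

Definition line3 x y w i j k : {vspace vT} :=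
  (<[rowv x y w i]> + <[rowv x y w j]> + <[rowv x y w k]>)%VS.

Lemma mem_line3 x y w i j k (v : vT) :
  v \in line3 x y w i j k -> exists c1 c2 c3,
    v = c1 *: rowv x y w i + c2 *: rowv x y w j + c3 *: rowv x y w k.
Proof.
case/memv_addP=> v1 /memv_addP[_ /vlineP[c1 ->] [_ /vlineP[c2 ->] ->]] [_ /vlineP[c3 ->] ->].
by exists c1, c2, c3.
Qed.

(** Three rows in pairwise nonparallel directions have independent blocks at [w], so a vector
    vanishing at [w] involves none of them. *)
Lemma line3_off x y w i j k (U : {vspace vT}) (v : vT) :
  br x y w i j != 0 -> br x y w i k != 0 -> br x y w j k != 0 ->
  (U <= off w)%VS -> v \in (U + line3 x y w i j k)%VS -> v \in off w -> v \in U.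
Proof.
move=> h1 h2 h3 Uoff /memv_addP[u uU [t /mem_line3[c1 [c2 [c3 E]]] ->]] H.
have toff : t \in off w.
  by rewrite -(addKr u t) addrC memvB // (subvP Uoff).
have [e1 e2 e3] := three_indep h1 h2 h3 (etrans (congr1 _ (esym E)) toff).
by rewrite E e1 e2 e3 !scale0r !addr0.
Qed.

Lemma dim_line3 x y w i j k (U : {vspace vT}) :
  br x y w i j != 0 -> br x y w i k != 0 -> br x y w j k != 0 ->
  (U <= off w)%VS -> \dim (U + line3 x y w i j k)%VS = (\dim U + 3)%N.
Proof.
move=> h1 h2 h3 Uoff; rewrite dimv_disjoint_sum; last first.
  apply/eqP; rewrite -subv0; apply/subvP => v; rewrite memv_cap => /andP[/(subvP Uoff) vo vl].
  by apply: (line3_off h1 h2 h3 (sub0v _)) vo; rewrite add0v.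
congr (_ + _)%N; rewrite /line3.
have I c1 c2 c3 : c1 *: rowv x y w i + c2 *: rowv x y w j + c3 *: rowv x y w k = 0 ->
    [/\ c1 = 0, c2 = 0 & c3 = 0].
  by move=> E; apply: (three_indep h1 h2 h3); rewrite E mem0v.
have Di : \dim <[rowv x y w i]>%VS = 1%N.
  rewrite dim_vline; case: eqP => //= E; have [|/eqP] := I 1 0 0; last by rewrite oner_eq0.
  by rewrite !scale0r E scaler0 !addr0.
rewrite dim_add_line_notin; last first.
  apply/negP => /memv_addP[_ /vlineP[c1 ->] [_ /vlineP[c2 ->] E]].
  have [|_ _ /eqP] := I c1 c2 (-1); last by rewrite oppr_eq0 oner_eq0.
  by rewrite scaleN1r E subrr.
rewrite dim_add_line_notin ?Di //; apply/negP => /vlineP[c1 E].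
have [|_ /eqP] := I c1 (-1) 0; last by rewrite oppr_eq0 oner_eq0.
by rewrite scaleN1r E subrr scale0r addr0.
Qed.

Lemma line3_star x y w i j k A : i \in A -> j \in A -> k \in A ->
  (line3 x y w i j k <= star x y w A)%VS.
Proof.
move=> iA jA kA; rewrite /line3 !subv_add -!memvE /star.
by rewrite !(span_set_mem (rowv x y w)).
Qed.

Definition mv (x : 'I_n -> R) w (t : R) : 'I_n -> R := fun i => if i == w then t else x i.

Lemma mv_off x w t i : i != w -> mv x w t i = x i.
Proof. by rewrite /mv => /negPf ->. Qed.

Lemma mv_at x w t : mv x w t w = t.
Proof. by rewrite /mv eqxx. Qed.

Lemma rowv_mv x y w s t i j : w != i -> w != j -> rowv (mv x w s) (mv y w t) i j = rowv x y i j.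
Proof. by rewrite eq_sym (eq_sym w j) => wi wj; apply: eq_rowv; rewrite mv_off. Qed.

Lemma br_mv x y w s t i j k : w != i -> w != j -> w != k ->
  br (mv x w s) (mv y w t) i j k = br x y i j k.
Proof. by rewrite eq_sym (eq_sym w j) (eq_sym w k) => wi wj wk; rewrite /br !mv_off. Qed.

(** [D] is quadratic: at this position [D_wi] and [D_wj] are [s^2] and [(1 - s)^2] times [D_ij], and
    the two blocks at [w] cancel. *)
Lemma rowv_on_line x y w i j s :
  w != i -> w != j -> i != j -> s != 0 -> s != 1 ->
  let x' := mv x w (x i + s * (x j - x i)) in
  let y' := mv y w (y i + s * (y j - y i)) in
  rowv x y i j = ((1 - s) ^+ 2)^-1 *: rowv x' y' w j - (s ^+ 2)^-1 *: rowv x' y' w i.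
Proof.
move=> wi wj ij s0 s1 x' y'.
have s1' : 1 - s != 0 by rewrite subr_eq0 eq_sym.
have iw : i != w by rewrite eq_sym.
have jw : j != w by rewrite eq_sym.
have ji : j != i by rewrite eq_sym.
apply/matrixP=> k t; rewrite !mxE /Dvec /x' /y' !(mv_off _ _ iw) !(mv_off _ _ jw) !mv_at.
have [->|kw] := eqVneq k w.
  rewrite (negPf wi) (negPf wj).
  by case: ifP => _; [|case: ifP => _]; field; rewrite s0 s1'.
have [->|ki] := eqVneq k i.
  rewrite (negPf ij).
  by case: ifP => _; [|case: ifP => _]; field; rewrite s0 s1'.
have [_|kj] := eqVneq k j; last by rewrite !mulr0 subr0.
by case: ifP => _; [|case: ifP => _]; field; rewrite s0 s1'.
Qed.

Lemma br_on_line x y w i j k s :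
  let x' := mv x w (x i + s * (x j - x i)) in
  let y' := mv y w (y i + s * (y j - y i)) in
  k != w -> i != w -> br x' y' w i k = - s * br x y i j k.
Proof. by move=> x' y' kw iw; rewrite /br /x' /y' !mv_at !mv_off //; ring. Qed.

Lemma br_on_line2 x y w i j k l s :
  let x' := mv x w (x i + s * (x j - x i)) in
  let y' := mv y w (y i + s * (y j - y i)) in
  k != w -> l != w -> br x' y' w k l = (1 - s) * br x y i k l + s * br x y j k l.
Proof. by move=> x' y' kw lw; rewrite /br /x' /y' !mv_at !mv_off //; ring. Qed.

Lemma dim_two_notin (U W : {vspace vT}) (u v : vT) (d : nat) :
  (forall W' : {vspace vT}, (U <= W')%VS -> (W' <= U + <[u]> + <[v]>)%VS ->
     (\dim W' + d <= \dim W)%N) ->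
  (\dim W < \dim U + d + 2)%N -> u \in U \/ v \in (U + <[u]>)%VS.
Proof.
move=> H ltW; have [uU|uU] := boolP (u \in U); first by left.
have [vU|vU] := boolP (v \in (U + <[u]>)%VS); first by right.
have := H (U + <[u]> + <[v]>)%VS; rewrite !dim_add_line_notin // subvv.
have -> : (U <= U + <[u]> + <[v]>)%VS by rewrite -addvA addvSl.
by move=> /(_ isT isT); move: ltW; lia.
Qed.

End Stars.

(** * Relations among the neighbours of a movable vertex *)

Section Local.
Variables (R : realFieldType) (n : nat) (x y : 'I_n -> R).
Hypothesis gen : alg_indep_Q (coords x y).
Local Notation vT := 'M[R]_(n, 3).
Lemma tri_neq0 (A : {set 'I_n}) i j k l m : labels A [:: i; j; k; l; m] -> tri x y i j k l m != 0.
Proof. by case/labels5P => _ [ij ik il im] [jk jl jm] _ _; rewrite /tri !mulf_neq0 // gen_br. Qed.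

Lemma tri_stress (A : {set 'I_n}) i j k l m : labels A [:: i; j; k; l; m] ->
  rowv x y i j = tri x y i j k l m *: stress x y i j k l m.
Proof. by move/tri_neq0 => t0; rewrite scalerA divff // scale1r. Qed.

Lemma stress_in (A : {set 'I_n}) (W : {vspace vT}) i j k l m : labels A [:: i; j; k; l; m] ->
  (stress x y i j k l m \in W) = (rowv x y i j \in W).
Proof.
move=> L; apply/idP/idP => [H|]; last exact: memvZ.
by rewrite (tri_stress L) memvZ.
Qed.

Variables (w : 'I_n) (A : {set 'I_n}) (U : {vspace vT}).
Hypotheses (wA : w \notin A) (Uoff : (U <= off R w)%VS).

Let neqw i : i \in A -> i != w.
Proof. by move=> iA; apply: contraNneq wA => <-. Qed.

Let two0 : (2 : R) != 0.
Proof. by rewrite pnatr_eq0. Qed.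

Let half0 : (2^-1 : R) != 0.
Proof. by rewrite invr_eq0. Qed.

Let half1 : (2^-1 : R) != 1.
Proof. by rewrite invr_eq1; apply/eqP => /eqP; rewrite -subr_eq0 -[X in 2 - X]/(1%:R) -natrB // oner_eq0. Qed.

Let br_half i j k l : i \in A -> j \in A -> k \in A -> l \in A ->
  i != k -> i != l -> j != k -> j != l -> k != l ->
  br (mv x w (x i + 2^-1 * (x j - x i))) (mv y w (y i + 2^-1 * (y j - y i))) w k l != 0.
Proof.
move=> iA jA kA lA ik il jk jl kl; rewrite br_on_line2 ?neqw //.
have -> : 1 - 2^-1 = 2^-1 :> R by field.
by rewrite -mulrDr mulf_neq0 // gen_br_mid.
Qed.

Let br_half' i j k : i \in A -> j \in A -> k \in A -> i != j -> i != k -> j != k ->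
  br (mv x w (x i + 2^-1 * (x j - x i))) (mv y w (y i + 2^-1 * (y j - y i))) w i k != 0.
Proof.
move=> iA jA kA ij ik jk; rewrite br_on_line ?neqw //.
by rewrite mulf_neq0 ?oppr_eq0 // gen_br.
Qed.

(** With [w] at the midpoint of [i j], the row of [i j] is in the star and vanishes at [w], while
    the rows to [i], [k], [l] already account for rank 3. From the midpoint [j] is seen along the
    same line as [i], so a fourth neighbour is needed for the third direction. *)
Lemma star_tight3 i j : (3 < #|A|)%N ->
  (forall s t, \dim (U + star (mv x w s) (mv y w t) w A)%VS <= \dim U + 3)%N ->
  labels A [:: i; j] -> rowv x y i j \in U.
Proof.
move=> cA H L2; have [|t [st L4]] := @labels_extend _ A 2 _ L2; first by rewrite /=.
case: t st L4 => [|k [|l []]] //= _ L4.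
have [[iA jA kA lA] [ij ik il] jk jl kl] := labels4P L4.
pose x' := mv x w (x i + 2^-1 * (x j - x i)); pose y' := mv y w (y i + 2^-1 * (y j - y i)).
apply: contraTT (H (x i + 2^-1 * (x j - x i)) (y i + 2^-1 * (y j - y i))) => fU.
rewrite -/x' -/y' -ltnNge.
have fS : rowv x y i j \in star x' y' w A.
  rewrite (rowv_on_line x y (w := w) (s := 2^-1)) // 1?eq_sym ?neqw //.
  by rewrite memvB // memvZ // (span_set_mem (rowv x' y' w)).
have foff : rowv x y i j \in off R w by rewrite rowv_off // eq_sym neqw.
have Uoff' : (U + <[rowv x y i j]> <= off R w)%VS by rewrite subv_add Uoff -memvE.
have b1 : br x' y' w i k != 0 by apply: br_half'.
have b2 : br x' y' w i l != 0 by apply: br_half'.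
have b3 : br x' y' w k l != 0 by apply: br_half.
have D := dim_line3 b1 b2 b3 Uoff'.
have : (\dim (U + <[rowv x y i j]> + line3 x' y' w i k l)%VS <= \dim (U + star x' y' w A)%VS)%N.
  by apply: dimvS; rewrite -addvA addvS // subv_add -memvE fS line3_star.
by rewrite D dim_add_line_notin // addSn.
Qed.

Hypothesis cA : #|A| = 5%N.
Hypothesis tight4 : forall s t,
  (\dim (U + star (mv x w s) (mv y w t) w A)%VS <= \dim U + 4)%N.

(** Of the four dimensions granted by [tight4], three are used by the rows to [i], [j], [k]; one is
    left for vectors vanishing at [w]. *)
Lemma local_pair (s t : R) (u v : vT) i j k :
  i \in A -> j \in A -> k \in A ->
  br (mv x w s) (mv y w t) w i j != 0 -> br (mv x w s) (mv y w t) w i k != 0 ->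
  br (mv x w s) (mv y w t) w j k != 0 ->
  u \in star (mv x w s) (mv y w t) w A -> v \in star (mv x w s) (mv y w t) w A ->
  u \in off R w -> v \in off R w -> u \in U \/ v \in (U + <[u]>)%VS.
Proof.
move=> iA jA kA h1 h2 h3 uS vS uo vo.
apply: (@dim_two_notin _ _ _ (U + star (mv x w s) (mv y w t) w A)%VS _ _ 3).
  move=> W' UW W'U; rewrite -(dim_line3 h1 h2 h3).
    apply: dimvS; rewrite subv_add (subv_trans (line3_star _ _ _ iA jA kA)) ?addvSr // andbT.
    by apply: subv_trans W'U _; rewrite -addvA addvS // subv_add -!memvE uS.
  by apply: subv_trans W'U _; rewrite !subv_add Uoff -!memvE uo.
by apply: leq_ltn_trans (tight4 s t) _; rewrite -addnA ltn_add2l.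
Qed.

Lemma local_disjoint i j k l : labels A [:: i; j; k; l] ->
  rowv x y i j \in U \/ rowv x y k l \in (U + <[rowv x y i j]>)%VS.
Proof.
move=> L4; have [|t [st L5]] := @labels_extend _ A 1 _ L4; first by rewrite cA.
case: t st L5 => [|m []] //= _ L5.
have [[iA jA kA lA mA] [ij ik il im] [jk jl jm] [kl km] lm] := labels5P L5.
(* Cramer's rule: [s] and [s'] are the parameters of the crossing point on the lines [i j] and
   [k l]. They differ from 0 and 1 because no three of the points are collinear. *)
pose den := (x j - x i) * (y l - y k) - (x l - x k) * (y j - y i).
have den0 : den != 0 by apply: gen_cross.
pose s := br x y i k l / den; pose s' := - br x y k i j / den.
have b1 : br x y i k l != 0 by apply: gen_br.
have b2 : br x y k i j != 0 by apply: gen_br; rewrite // eq_sym.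
have b3 : br x y j k l != 0 by apply: gen_br.
have b4 : br x y l i j != 0 by apply: gen_br; rewrite // eq_sym.
have s0 : s != 0 by rewrite mulf_neq0 // invr_eq0.
have s'0 : s' != 0 by rewrite mulf_neq0 ?oppr_eq0 // invr_eq0.
have s1 : s != 1.
  rewrite -subr_eq0 (_ : s - 1 = br x y j k l / den) ?mulf_neq0 ?invr_eq0 //.
  by apply: (mulIf den0); rewrite mulrBl !divfK // /den /br; ring.
have s'1 : s' != 1.
  rewrite -subr_eq0 (_ : s' - 1 = - br x y l i j / den) ?mulf_neq0 ?oppr_eq0 ?invr_eq0 //.
  by apply: (mulIf den0); rewrite mulrBl !divfK // /den /br; ring.
have sE : s * den = br x y i k l by rewrite divfK.
have s'E : s' * den = - br x y k i j by rewrite divfK.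
have dd p q r : (p + q * r) * den = p * den + q * den * r by ring.
have Ex : x i + s * (x j - x i) = x k + s' * (x l - x k).
  by apply: (mulIf den0); rewrite !dd sE s'E /den /br; ring.
have Ey : y i + s * (y j - y i) = y k + s' * (y l - y k).
  by apply: (mulIf den0); rewrite !dd sE s'E /den /br; ring.
have wi : w != i by rewrite eq_sym neqw.
have wj : w != j by rewrite eq_sym neqw.
have wk : w != k by rewrite eq_sym neqw.
have wl : w != l by rewrite eq_sym neqw.
(* Seen from the crossing point, the four ends give only two directions; the fifth label [m]
   provides the third. *)
apply: (@local_pair (x i + s * (x j - x i)) (y i + s * (y j - y i)) _ _ i k m) => //.
- by rewrite br_on_line ?neqw // mulf_neq0 ?oppr_eq0 // gen_br.
- by rewrite br_on_line ?neqw // mulf_neq0 ?oppr_eq0 // gen_br.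
- by rewrite Ex Ey br_on_line ?neqw // mulf_neq0 ?oppr_eq0 // gen_br.
- rewrite (rowv_on_line x y (w := w) (s := s)) //.
  by rewrite memvB // memvZ // (span_set_mem (rowv _ _ w)).
- rewrite Ex Ey (rowv_on_line x y (w := w) (i := k) (s := s')) //.
  by rewrite memvB // memvZ // (span_set_mem (rowv _ _ w)).
- exact: rowv_off.
- exact: rowv_off.
Qed.

(** With [w] at the midpoint of [i j], the stress of the [K_5] on [w, i, k, l, m] shows that its six
    edges away from [w] sum to a vector [g] of the star. Those disjoint from [i j] drop out by
    [local_disjoint]; the remaining ones are at [i]. *)
Lemma local_vertex i j k l m : labels A [:: i; j; k; l; m] ->
  rowv x y i j \in U \/
  stress x y i j k l m + stress x y i k j l m + stress x y i l j k m + stress x y i m j k l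
    \in (U + <[rowv x y i j]>)%VS.
Proof.
move=> L5; have [[iA jA kA lA mA] [ij ik il im] [jk jl jm] [kl km] lm] := labels5P L5.
have wi : w != i by rewrite eq_sym neqw.
have wj : w != j by rewrite eq_sym neqw.
have wk : w != k by rewrite eq_sym neqw.
have wl : w != l by rewrite eq_sym neqw.
have wm : w != m by rewrite eq_sym neqw.
pose xw := x i + 2^-1 * (x j - x i); pose yw := y i + 2^-1 * (y j - y i).
pose x' := mv x w xw; pose y' := mv y w yw.
pose q := [:: i; k; l; m].
have uq : uniq q by rewrite /= !inE !negb_or ik il im kl km lm.
have qA v : v \in q -> v \in A by rewrite !inE => /or4P[]/eqP->.
have qj v : v \in q -> j != v by rewrite !inE => /or4P[]/eqP->; rewrite // eq_sym.
have Bw u v : u \in q -> v \in q -> u != v -> br x' y' w u v != 0.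
  move=> uq' vq uv; have [ui|ui] := eqVneq u i.
    rewrite ui in uv *; apply: br_half' => //; first exact: qA.
    exact: qj.
  have [vi|vi] := eqVneq v i.
    rewrite br_swapr oppr_eq0 vi; apply: br_half' => //; first exact: qA.
      by rewrite eq_sym.
    exact: qj.
  by apply: br_half => //; [exact: qA|exact: qA|rewrite eq_sym|rewrite eq_sym|exact: qj|exact: qj].
have S5 : uniq [:: w; i; k; l; m].
  by rewrite cons_uniq -/q uq !inE !negb_or wi wk wl wm.
have Wq v : v \in q -> w != v by move/qA/neqw; rewrite eq_sym.
have := @K5_stress _ _ x' y' w i k l m S5.
have -> : [:: w; i; k; l; m] = w :: q by [].
move=> /(_ _) K5.
pose g := stress x' y' i k w l m + stress x' y' i l w k m + stress x' y' i m w k l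
  + stress x' y' k l w i m + stress x' y' k m w i l + stress x' y' l m w i k.
have gS : g \in star x' y' w A.
  have : g = - (stress x' y' w i k l m + stress x' y' w k i l m + stress x' y' w l i k m + stress x' y' w m i k l).
    apply/eqP; rewrite -addr_eq0 addrC /g !addrA; apply/eqP; apply: K5.
    move=> a b c; rewrite !in_cons => aq bq cq /and3P[]; rewrite !inE negb_or => /andP[ab ac] bc _.
    case/predU1P: aq ab ac => [->|aq] ab ac.
      case/predU1P: bq ab bc => [->|bq] ab bc; first by rewrite eqxx in ab.
      case/predU1P: cq ac bc => [->|cq] ac bc; first by rewrite eqxx in ac.
      exact: Bw.
    case/predU1P: bq ab bc => [->|bq] ab bc.
      rewrite br_swap oppr_eq0; case/predU1P: cq ac bc => [->|cq] ac bc; first by rewrite eqxx in bc.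
      exact: Bw.
    case/predU1P: cq ac bc => [->|cq] ac bc; first by rewrite br_swapr br_swap opprK; apply: Bw.
    by rewrite /x' /y' br_mv ?Wq //; apply: gen_br.
  by move=> ->; rewrite memvN !memvD // memvZ // (span_set_mem (rowv x' y' w)).
have goff : g \in off R w by rewrite !memvD // memvZ // rowv_off.
have [|||||fU|gU] := @local_pair xw yw (rowv x y i j) g i k l iA kA lA _ _ _ _ gS _ goff.
- by apply: Bw; rewrite ?inE ?eqxx ?orbT.
- by apply: Bw; rewrite ?inE ?eqxx ?orbT.
- by apply: Bw; rewrite ?inE ?eqxx ?orbT.
- rewrite (rowv_on_line x y (w := w) (s := 2^-1)) //.
  by rewrite memvB // memvZ // (span_set_mem (rowv _ _ w)).
- exact: rowv_off.
- by left.
have [fU|fU] := boolP (rowv x y i j \in U); [by left|right].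
have D u v : labels A [:: i; j; u; v] -> rowv x y u v \in (U + <[rowv x y i j]>)%VS.
  by case/local_disjoint => // H; rewrite H in fU.
have gU3 : stress x' y' i k w l m + stress x' y' i l w k m + stress x' y' i m w k l
    \in (U + <[rowv x y i j]>)%VS.
  move: gU; rewrite /g -/x' -/y' -!(addrA (_ + _ + _)) rpredDr //.
  rewrite !memvD // memvZ // rowv_mv // D //.
  - by sub_labels L5 [:: m].
  - by sub_labels L5 [:: l].
  - by sub_labels L5 [:: k].
(* Replacing [j] by the midpoint [w] halves exactly one factor of the denominator, the bracket of
   [i], [u] with that point. *)
have half u v t : u \in q -> v \in q -> t \in q -> u != i -> v != i -> t != i ->
    stress x' y' i u w v t = 2 *: stress x y i u j v t.
  move=> uq' vq tq ui vi ti; rewrite /stress /tri (rowv_mv _ _ _ _ wi (Wq _ uq')) scalerA; congr (_ *: _).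
  rewrite (br_mv _ _ _ _ wi (Wq _ uq') (Wq _ vq)) (br_mv _ _ _ _ wi (Wq _ uq') (Wq _ tq)) [br x' y' i u w](_ : _ = 2^-1 * br x y i u j).
    by rewrite -!mulrA invfM invrK !invfM.
  by rewrite br_swapr (br_swap x' y' w i) opprK br_on_line ?(neqw iA) ?(neqw (qA _ uq')) // (br_swapr x y i j u) mulNr mulrN.
move: gU3; rewrite !half ?inE ?eqxx ?orbT // 1?eq_sym // -!scalerDr => /(memvZ 2^-1).
rewrite scalerA mulVf // scale1r => gU3.
by rewrite -!addrA memvD ?addrA // memvZ // (subvP (addvSr _ _)) // memv_line.
Qed.

(** The stress coefficient without an ordering of the other three labels, as the classification
    works with a function of two labels. *)
Let weight i j : R := (\prod_(k in A | (k != i) && (k != j)) br x y i j k)^-1.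

Let weight_stress i j k l m : labels A [:: i; j; k; l; m] ->
  weight i j *: rowv x y i j = stress x y i j k l m.
Proof.
move=> L5; congr (_^-1 *: _).
have [[iA jA kA lA mA] [ij ik il im] [jk jl jm] [kl km] lm] := labels5P L5.
have /andP[u5 _] := L5.
transitivity (\prod_(z <- [:: i; j; k; l; m] | (z != i) && (z != j)) br x y i j z).
  rewrite -big_filter -[RHS]big_filter; apply: perm_big; apply: uniq_perm.
  - by rewrite filter_uniq // index_enum_uniq.
  - by rewrite filter_uniq.
  move=> z; rewrite !mem_filter mem_index_enum andbT andbC; congr (_ && _).
  apply/idP/idP => [zA|]; first by apply: labels_all L5 _ zA; rewrite cA.
  by rewrite !inE => /or4P[/eqP->|/eqP->|/eqP->|/orP[]/eqP->].
rewrite !big_cons big_nil !eqxx (eq_sym k i) (eq_sym k j) (eq_sym l i) (eq_sym l j).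
by rewrite (eq_sym m i) (eq_sym m j) ik il im jk jl jm /= andbF mulr1 mulrA.
Qed.

Lemma local_trichotomy :
  [\/ exists b, forall i j, labels A [:: i; j] -> rowv x y i j \in (U + <[b]>)%VS,
      exists2 i0, i0 \in A & forall i j, labels A [:: i; j] -> i != i0 -> j != i0 ->
        rowv x y i j \in U |
      exists a b c d e, [/\ labels A [:: a; b; c; d; e],
        [/\ rowv x y a e \in U, rowv x y b e \in U, rowv x y c e \in U & rowv x y d e \in U],
        [/\ stress x y b d a c e - stress x y a c b d e \in U,
            stress x y c d a b e - stress x y a b c d e \in U,
            stress x y a d b c e - stress x y b c a d e \in U &
            stress x y b c a d e + (stress x y a b c d e + stress x y a c b d e) \in U],
        stress x y a b c d e \notin U &
        stress x y a c b d e \notin (U + <[stress x y a b c d e]>)%VS]].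
Proof.
have [f fE] := quotient_map U.
pose F i j := f (weight i j *: rowv x y i j).
have Fst i j k l m : labels A [:: i; j; k; l; m] -> F i j = f (stress x y i j k l m).
  by move=> L; rewrite /F (weight_stress L).
have fline u v : (f v \in <[f u]>%VS) = (v \in (U + <[u]>)%VS).
  apply/vlineP/mem_add_line => [[k E]|[k H]]; exists k.
    by rewrite -fE linearB linearZ /= E subrr.
  by apply/eqP; rewrite -subr_eq0 -linearZ -linearB fE.
have fpar u v : u \in U \/ v \in (U + <[u]>)%VS -> par (f u) (f v).
  by rewrite /par fE fline => -[->|->]; rewrite ?orbT.
have ext2 i j : labels A [:: i; j] -> exists k l m, labels A [:: i; j; k; l; m].
  move=> L; have [|t [st L5]] := @labels_extend _ A 3 _ L; first by rewrite cA.
  by case: t st L5 => [|k [|l [|m []]]] //= _ L5; exists k, l, m.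
have scaleU (V : {vspace vT}) i j k l m : labels A [:: i; j; k; l; m] ->
  (rowv x y i j \in V) = (stress x y i j k l m \in V) by move=> L; rewrite (stress_in _ L).
have lineE i j k l m : labels A [:: i; j; k; l; m] ->
    (U + <[rowv x y i j]> = U + <[stress x y i j k l m]>)%VS.
  move=> L; have ml (v : vT) : v \in (U + <[v]>)%VS by rewrite (subvP (addvSr _ _)) // memv_line.
  apply/eqP; rewrite eqEsubv !subv_add !addvSl -!memvE /=; apply/andP; split.
    by rewrite (scaleU _ _ _ _ _ _ L) ml.
  by rewrite -(scaleU _ _ _ _ _ _ L) ml.
have FC i j : labels A [:: i; j] -> F j i = F i j.
  move=> L; have [k [l [m L5]]] := ext2 _ _ L; rewrite (Fst _ _ _ _ _ L5).
  rewrite (Fst j i k l m); last by perm_labels L5.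
  by rewrite stressC //; case/labels5P: L5 => _ [].
(* [F] is only symmetric on distinct labels in [A]; symmetrize it *)
pose F' i j := if labels A [:: i; j] then F i j else 0.
have F'C i j : i != j -> F' j i = F' i j.
  move=> ij; rewrite /F'; have -> : labels A [:: j; i] = labels A [:: i; j].
    by apply/idP/idP => L; perm_labels L.
  by case: ifP => // /FC.
have F'E i j k l m : labels A [:: i; j; k; l; m] -> F' i j = f (stress x y i j k l m).
  by move=> L; rewrite /F' (@labels_cat _ _ [:: i; j] [:: k; l; m] L) (Fst _ _ _ _ _ L).
have disj i j k l : labels A [:: i; j; k; l] -> par (F' i j) (F' k l).
  move=> L4; have [|t [st L5]] := @labels_extend _ A 1 _ L4; first by rewrite cA.
  case: t st L5 => [|m []] //= _ L5; rewrite (F'E _ _ _ _ _ L5).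
  have L5' : labels A [:: k; l; i; j; m] by perm_labels L5.
  rewrite (F'E _ _ _ _ _ L5'); apply: fpar; rewrite -(scaleU _ _ _ _ _ _ L5) -(lineE _ _ _ _ _ L5).
  by rewrite -(scaleU _ _ _ _ _ _ L5'); apply: local_disjoint.
have vert i j k l m : labels A [:: i; j; k; l; m] ->
    par (F' i j) (F' i j + F' i k + F' i l + F' i m).
  move=> L5; rewrite (F'E _ _ _ _ _ L5) (F'E i k j l m); last by perm_labels L5.
  rewrite (F'E i l j k m) ?(F'E i m j k l); try by perm_labels L5.
  rewrite -!linearD; apply: fpar; rewrite -(scaleU _ _ _ _ _ _ L5) -(lineE _ _ _ _ _ L5).
  exact: local_vertex.
have [[a [b [Lab H]]]|[i0 i0A H]|[a [b [c [d [e [L [e1 e2 e3 e4] [g1 g2 g3 g4] np]]]]]]] :=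
    classification F'C cA disj vert.
- apply: Or31; have [k [l [m L5]]] := ext2 _ _ Lab; exists (stress x y a b k l m) => i j Lij.
  have [k' [l' [m' L5']]] := ext2 _ _ Lij; rewrite (scaleU _ _ _ _ _ _ L5') -fline.
  by rewrite -(F'E _ _ _ _ _ L5) -(F'E _ _ _ _ _ L5'); apply: H.
- apply: Or32; exists i0 => // i j Lij ii jj; have [k [l [m L5]]] := ext2 _ _ Lij.
  by rewrite (scaleU _ _ _ _ _ _ L5) -fE -(F'E _ _ _ _ _ L5); apply/eqP; apply: H.
apply: Or33; exists a, b, c, d, e; split=> //.
- have Z i j k l m : labels A [:: i; j; k; l; m] -> F' i j = 0 -> rowv x y i j \in U.
    by move=> L' E; rewrite (scaleU _ _ _ _ _ _ L') -fE -(F'E _ _ _ _ _ L') E.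
  split.
  + by apply: (Z a e b c d) e1; perm_labels L.
  + by apply: (Z b e a c d) e2; perm_labels L.
  + by apply: (Z c e a b d) e3; perm_labels L.
  + by apply: (Z d e a b c) e4; perm_labels L.
- have Lac : labels A [:: a; c; b; d; e] by perm_labels L.
  have Lbc : labels A [:: b; c; a; d; e] by perm_labels L.
  split; rewrite -fE ?linearB ?linearD /= ?subr_eq0.
  + by rewrite -(F'E _ _ _ _ _ Lac) -(F'E b d a c e) ?g1 //; perm_labels L.
  + by rewrite -(F'E _ _ _ _ _ L) -(F'E c d a b e) ?g2 //; perm_labels L.
  + by rewrite -(F'E _ _ _ _ _ Lbc) -(F'E a d b c e) ?g3 //; perm_labels L.
  + by rewrite -(F'E _ _ _ _ _ Lbc) -(F'E _ _ _ _ _ L) -(F'E _ _ _ _ _ Lac) g4 addNr.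
- apply: contraNN np => H; rewrite /par (F'E _ _ _ _ _ L).
  by move: H; rewrite -fE => ->.
- apply: contraNN np; rewrite -fline -(F'E _ _ _ _ _ L) -(F'E a c b d e).
    by rewrite /par => ->; rewrite orbT.
  by perm_labels L.
Qed.

End Local.

(** * Edge sets and their row spaces *)

Section Edges.
Variable n : nat.
Implicit Types (e : edge n) (S : {set edge n}) (w i j : 'I_n) (V : {set 'I_n}).

(** Edges are stored as increasing pairs; this forgets the order, and [cof_row_joins] absorbs the
    resulting sign. *)
Definition joins e i j : bool := (val e == (i, j)) || (val e == (j, i)).
Definition inc w e : bool := ((val e).1 == w) || ((val e).2 == w).
Definition complete V : {set edge n} :=
  [set e | ((val e).1 \in V) && ((val e).2 \in V)].
Definition starset S w : {set edge n} := [set e in S | inc w e].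
Definition without S w : {set edge n} := [set e in S | ~~ inc w e].
Definition nbhd S w : {set 'I_n} := [set i | [exists e in S, joins e w i]].

Lemma joinsC e i j : joins e i j = joins e j i.
Proof. by rewrite /joins orbC. Qed.

Lemma edge_ends e : joins e (val e).1 (val e).2.
Proof. by rewrite /joins -surjective_pairing eqxx. Qed.

Lemma joins_neq e i j : joins e i j -> i != j.
Proof.
have := valP e; rewrite /joins => lt /orP[]/eqP E; move: lt; rewrite E /= => lt.
  by apply: contraTneq lt => ->; rewrite ltnn.
by apply: contraTneq lt => ->; rewrite ltnn.
Qed.

Lemma edge_ends_neq e : (val e).1 != (val e).2.
Proof. exact: joins_neq (edge_ends e). Qed.

Lemma joins_ex i j : i != j -> exists e, joins e i j.
Proof.
move=> ij; have [lt|lt|E] := ltngtP i j.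
- by exists (exist (fun p : 'I_n * 'I_n => (p.1 < p.2)%N) (i, j) lt); rewrite /joins eqxx.
- by exists (exist (fun p : 'I_n * 'I_n => (p.1 < p.2)%N) (j, i) lt); rewrite /joins eqxx orbT.
by case/eqP: ij; apply: val_inj.
Qed.

Lemma joins_inj e e' i j : joins e i j -> joins e' i j -> e = e'.
Proof.
have := valP e; have := valP e'; rewrite /joins => l' l.
case/orP=> /eqP E /orP[]/eqP E'; apply: val_inj; rewrite E E' //;
  by move: l l'; rewrite E E' /= => l /(ltn_trans l); rewrite ltnn.
Qed.

Lemma joins_inc e i j w : joins e i j -> inc w e = (i == w) || (j == w).
Proof. by rewrite /joins /inc => /orP[]/eqP -> //=; rewrite orbC. Qed.

Lemma inc_joins w e : inc w e -> exists i, joins e w i.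
Proof.
case/orP=> /eqP <-; first by exists (val e).2; rewrite edge_ends.
by exists (val e).1; rewrite joinsC edge_ends.
Qed.

Lemma joins_complete e i j V : joins e i j -> (e \in complete V) = (i \in V) && (j \in V).
Proof. by rewrite inE /joins => /orP[]/eqP -> //=; rewrite andbC. Qed.

Lemma nbhdP S w i : reflect (exists2 e, e \in S & joins e w i) (i \in nbhd S w).
Proof. by rewrite inE; apply: exists_inP. Qed.

Lemma nbhd_neq S w : w \notin nbhd S w.
Proof. by apply/nbhdP => -[e _ /joins_neq]; rewrite eqxx. Qed.

Lemma card_nbhd S w : #|nbhd S w| = #|starset S w|.
Proof.
pose other e := if (val e).1 == w then (val e).2 else (val e).1.
have oE e i : joins e w i -> other e = i.
  rewrite /other /joins => J; have := joins_neq J.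
  by case/orP: J => /eqP -> /=; rewrite ?eqxx // eq_sym => /negPf ->.
have -> : nbhd S w = other @: starset S w.
  apply/setP=> i; apply/nbhdP/imsetP => [[e eS J]|[e]].
    by exists e; rewrite ?(oE _ _ J) // inE eS (joins_inc _ J) eqxx.
  by rewrite inE => /andP[eS /inc_joins[j J]] ->; exists e => //; rewrite (oE _ _ J).
rewrite card_in_imset // => e e'; rewrite !inE => /andP[_ /inc_joins[i J]] /andP[_ /inc_joins[j J']].
by rewrite (oE _ _ J) (oE _ _ J') => E; apply: joins_inj J _; rewrite E.
Qed.

Lemma without_starset S w : without S w :|: starset S w = S.
Proof. by apply/setP=> e; rewrite !inE -andb_orr orNb andbT. Qed.

Lemma card_without S w : #|S| = (#|without S w| + #|nbhd S w|)%N.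
Proof.
rewrite card_nbhd -[in LHS](without_starset S w) cardsU -[RHS]subn0; congr (_ - _)%N.
by apply/eqP; rewrite cards_eq0; apply/eqP/setP=> e; rewrite !inE; case: (inc w e); rewrite ?andbF.
Qed.

Lemma nbhd_sub S V w : S \subset complete V -> nbhd S w \subset V :\ w.
Proof.
move=> sSV; apply/subsetP=> i /nbhdP[e eS J]; rewrite !inE eq_sym (joins_neq J) /=.
by have := subsetP sSV _ eS; rewrite (joins_complete _ J) => /andP[].
Qed.

Lemma without_sub S V w : S \subset complete V -> without S w \subset complete (V :\ w).
Proof.
move=> sSV; apply/subsetP=> e; rewrite !inE /inc negb_or => /andP[/(subsetP sSV)].
by rewrite inE => /andP[-> ->] /andP[-> ->].
Qed.

Lemma nbhd_complete V w : w \in V -> nbhd (complete V) w = V :\ w.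
Proof.
move=> wV; apply/setP=> i; apply/nbhdP/idP => [[e + J]|].
  by rewrite (joins_complete _ J) !inE eq_sym (joins_neq J) => /andP[].
rewrite !inE eq_sym => /andP[wi iV]; have [e J] := joins_ex wi.
by exists e; rewrite // (joins_complete _ J) wV.
Qed.

Lemma completeS V V' : V \subset V' -> complete V \subset complete V'.
Proof.
by move=> s; apply/subsetP=> e; rewrite !inE => /andP[/(subsetP s)-> /(subsetP s)->].
Qed.

Lemma sum_deg S V :
  (\sum_(w in V) #|nbhd S w| = \sum_(e in S) (((val e).1 \in V) + ((val e).2 \in V)))%N.
Proof.
transitivity (\sum_(w in V) \sum_(e in S) inc w e)%N.
  apply: eq_bigr => w _; rewrite card_nbhd -sum1_card /starset big_mkcond [RHS]big_mkcond /=.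
  by apply: eq_bigr => e _; rewrite inE; case: (e \in S); case: (inc w e).
rewrite exchange_big; apply: eq_bigr => e _ /=; rewrite /inc.
transitivity (\sum_(w in V) (((val e).1 == w) + ((val e).2 == w)))%N.
  apply: eq_bigr => w _; have := edge_ends_neq e.
  by case: ((val e).1 =P w) => [->|_]; case: ((val e).2 =P w) => [->|_] //; rewrite eqxx.
have H i : (\sum_(w in V) (i == w) = (i \in V))%N.
  have [iV|iV] := boolP (i \in V); last first.
    by apply: big1 => w wV; case: eqVneq => // E; rewrite E wV in iV.
  rewrite (bigD1 i) //= eqxx big1 ?addn0 // => w /andP[_ wi].
  by rewrite eq_sym (negPf wi).
by rewrite big_split /= !H.
Qed.

End Edges.

(** * Row spaces of edge sets and the cofactor matroid as a linear matroid *)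

Section Rigidity.
Variables (R : realFieldType) (n : nat).
Local Notation vT := 'M[R]_(n, 3).
Implicit Types (x y : 'I_n -> R) (e : edge n) (S : {set edge n}) (W : {vspace vT}).

Definition rowspan x y S : {vspace vT} := span_set (cof_row x y) S.

Lemma cof_row_joins x y e i j : joins e i j ->
  cof_row x y e = rowv x y i j \/ cof_row x y e = - rowv x y i j.
Proof.
move=> J; have ij := joins_neq J; rewrite -[cof_row x y e]/(rowv x y (val e).1 (val e).2).
by case/orP: J => /eqP -> /=; [left|right; rewrite rowvC].
Qed.

Lemma cof_row_mem x y e i j W : joins e i j -> (cof_row x y e \in W) = (rowv x y i j \in W).
Proof. by case/(cof_row_joins x y) => ->; rewrite ?memvN. Qed.

Lemma rowv_rowspan x y e i j S : joins e i j -> e \in S -> rowv x y i j \in rowspan x y S.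
Proof. by move=> J eS; rewrite -(cof_row_mem _ _ _ J) (span_set_mem (cof_row x y)). Qed.

Lemma rowspan_subP x y S W :
  reflect (forall e i j, e \in S -> joins e i j -> rowv x y i j \in W) (rowspan x y S <= W)%VS.
Proof.
apply: (iffP (span_set_subP _ _ _)) => H e.
  by move=> i j /H eW J; rewrite -(cof_row_mem _ _ _ J).
by move=> eS; rewrite (cof_row_mem _ _ _ (edge_ends e)); apply: H (edge_ends e).
Qed.

Lemma rowspanS x y S S' : S \subset S' -> (rowspan x y S <= rowspan x y S')%VS.
Proof. exact: span_setS. Qed.

Lemma rowspan_add x y e S : rowspan x y (e |: S) = (<[cof_row x y e]> + rowspan x y S)%VS.
Proof. by rewrite /rowspan span_setU span_set1. Qed.

Lemma rowspan_starset x y S w : rowspan x y (starset S w) = star x y w (nbhd S w).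
Proof.
apply/eqP; rewrite eqEsubv; apply/andP; split.
  apply/span_set_subP => e; rewrite inE => /andP[eS /inc_joins[i J]].
  rewrite (cof_row_mem _ _ _ J) (span_set_mem (rowv x y w)) //.
  by apply/nbhdP; exists e.
apply/span_set_subP => i /nbhdP[e eS J]; apply: (rowv_rowspan _ _ J).
by rewrite inE eS (joins_inc _ J) eqxx.
Qed.

Lemma rowspan_split x y S w :
  rowspan x y S = (rowspan x y (without S w) + star x y w (nbhd S w))%VS.
Proof. by rewrite -rowspan_starset -span_setU without_starset. Qed.

Lemma rowspan_off x y S w V : S \subset complete V -> w \notin V ->
  (rowspan x y S <= off R w)%VS.
Proof.
move=> sSV wV; apply/rowspan_subP => e i j /(subsetP sSV) eV J; move: eV.
rewrite (joins_complete _ J) => /andP[iV jV].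
by apply: rowv_off; [apply: contraNneq wV => ->|apply: contraNneq wV => ->].
Qed.

Lemma without_off x y S w : (rowspan x y (without S w) <= off R w)%VS.
Proof.
apply: (@rowspan_off _ _ _ _ [set~ w]); last by rewrite !inE eqxx.
by apply/subsetP=> e; rewrite !inE /inc negb_or => /andP[_].
Qed.

Lemma rowspan_mv x y S w s t :
  rowspan (mv x w s) (mv y w t) (without S w) = rowspan x y (without S w).
Proof.
apply: eq_bigr => e; rewrite inE /inc negb_or => /andP[_ /andP[e1 e2]]; congr <[_]>%VS.
by rewrite -[LHS]/(rowv _ _ _ _) rowv_mv // eq_sym.
Qed.

Lemma cofactorE x y S : cofactor_matroid x y S = (\dim (rowspan x y S) == #|S|).
Proof.
rewrite /cofactor_matroid.
pose s := [tuple cof_row x y (enum_val k) | k < #|S|].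
have -> : \matrix_(k < #|S|) mxvec (cof_row x y (enum_val k)) = \matrix_(k < #|S|) mxvec (tnth s k).
  by apply/row_matrixP=> k; rewrite !rowK tnth_mktuple.
rewrite row_free_free /free size_tuple; congr (\dim _ == _).
apply/eqP; rewrite eqEsubv; apply/andP; split.
  apply/span_subvP => v /mapP[k _ ->]; apply: (span_set_mem (cof_row x y)); exact: enum_valP.
apply/span_set_subP => e eS; apply: memv_span; apply/mapP.
by exists (enum_rank_in eS e); rewrite ?mem_enum // enum_rankK_in.
Qed.

Lemma cofactor_matroidP x y : is_matroid (cofactor_matroid x y).
Proof.
have add X e : cofactor_matroid x y X -> cof_row x y e \notin rowspan x y X ->
    cofactor_matroid x y (e |: X).
  rewrite !cofactorE => /eqP dX eX; rewrite rowspan_add addvC dim_add_line_notin // dX.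
  rewrite cardsU1; case: (boolP (e \in X)) => // /(span_set_mem (cof_row x y)).
  by rewrite (negPf eX).
split.
- by rewrite cofactorE /rowspan span_set0 dimv0 cards0.
- move=> X Y sYX; rewrite !cofactorE => /eqP dX; rewrite eqn_leq span_set_card /=.
  have XE : X = Y :|: (X :\: Y).
    by apply/setP=> e; rewrite !inE; have := subsetP sYX e; case: (e \in Y) => //= ->.
  have cX : #|X| = (#|Y| + #|X :\: Y|)%N.
    by rewrite cardsD (setIidPr sYX) subnKC // subset_leq_card.
  rewrite -(leq_add2r #|X :\: Y|) -cX -dX {1}XE /rowspan span_setU.
  by rewrite (leq_trans (dimv_add_leqif _ _)) // leq_add2l span_set_card.
- move=> X Y CX CY lt.
  have [e eY eX] : exists2 e, e \in Y & cof_row x y e \notin rowspan x y X.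
    apply/exists_inP; apply: contraLR lt; rewrite negb_exists_in => /forall_inP H.
    have [/eqP dX /eqP dY] : \dim (rowspan x y X) == #|X| /\ \dim (rowspan x y Y) == #|Y|.
      by rewrite -!cofactorE.
    rewrite -leqNgt -dX -dY; apply: dimvS; apply/span_set_subP => e /H.
    by rewrite negbK.
  exists e; last exact: add.
  by rewrite inE eY andbT; apply: contra eX; apply: (span_set_mem (cof_row x y)).
Qed.

Lemma mrank_cofactor x y S : mrank (cofactor_matroid x y) S = \dim (rowspan x y S).
Proof.
have mC := cofactor_matroidP x y.
apply/eqP; rewrite eqn_leq; apply/andP; split.
  have [Y [sY CY <-]] := mrank_basis mC S.
  by move: CY; rewrite cofactorE => /eqP <-; apply: dimvS; apply: rowspanS.
have [Y [sY CY cY]] := mrank_basis mC S; rewrite -cY.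
move: (CY); rewrite cofactorE => /eqP <-; apply: dimvS; apply/span_set_subP => e eS.
apply/negPn/negP => eY; have eY' : e \notin Y.
  by apply: contra eY; apply: (span_set_mem (cof_row x y)).
have : (#|e |: Y| <= mrank (cofactor_matroid x y) S)%N.
  apply: leq_mrank; first by rewrite subUset sub1set eS.
  move: CY; rewrite !cofactorE => /eqP dY.
  by rewrite rowspan_add addvC dim_add_line_notin // dY cardsU1 eY'.
by rewrite cardsU1 eY' cY ltnn.
Qed.

End Rigidity.

(** * Ranks of complete graphs *)

(* Writing F for [stress], these are, up to nonzero factors, F_ae, F_be, F_ce,
   F_de, F_ab, F_cd, F_ac - F_bd, F_ac + F_ad and F_ac + F_bc; denominators are
   cleared so that the vectors are polynomial in the coordinates. *)
Definition twist_rows (A : comNzRingType) (n : nat) (x y : 'I_n -> A) (a b c d e : 'I_n) :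
    seq 'M[A]_(n, 3) :=
  [:: rowv x y a e; rowv x y b e; rowv x y c e; rowv x y d e; rowv x y a b; rowv x y c d;
      tri x y b d a c e *: rowv x y a c - tri x y a c b d e *: rowv x y b d;
      tri x y a d b c e *: rowv x y a c + tri x y a c b d e *: rowv x y a d;
      tri x y b c a d e *: rowv x y a c + tri x y a c b d e *: rowv x y b c].

Lemma twist_rows_map (A B : comNzRingType) (f : {rmorphism A -> B}) (n : nat)
    (p q : 'I_n -> A) (x y : 'I_n -> B) (a b c d e : 'I_n) :
  (forall i, f (p i) = x i) -> (forall i, f (q i) = y i) ->
  [seq map_mx f v | v <- twist_rows p q a b c d e] = twist_rows x y a b c d e.
Proof.
move=> fp fq; rewrite /twist_rows /= !map_mxB !map_mxD !map_mxZ.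
by rewrite !(rowv_map fp fq) !(tri_map fp fq).
Qed.

Section Ranks.
Variables (R : realFieldType) (n : nat) (x y : 'I_n -> R).
Hypothesis gen : alg_indep_Q (coords x y).
Local Notation vT := 'M[R]_(n, 3).
Local Notation RS := (rowspan x y).
Implicit Types (S : {set edge n}) (V A : {set 'I_n}) (U W : {vspace vT}).

(** Rows avoiding [w] do not change, so the left side is a specialization of the right side. [L]
    consists of polynomial vectors in order to specialize along with them; it will carry the
    relations of a twisted quadrilateral. *)
Lemma move_dim S w s t (L : seq 'M[{mpoly rat[n + n]}]_(n, 3)) :
  (\dim (RS (without S w) + star (mv x w s) (mv y w t) w (nbhd S w)
      + <<[seq map_mx (evp (mv x w s) (mv y w t)) v | v <- L]>>)
   <= \dim (RS S + <<[seq map_mx (evp x y) v | v <- L]>>))%N.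
Proof.
have E (x' y' : 'I_n -> R) : (rowspan x' y' S + <<[seq map_mx (evp x' y') v | v <- L]>>)%VS
  = <<[seq map_mx (evp x' y') v | v <- [seq rowv (@px n) (@py n) (val e).1 (val e).2 | e <- enum S] ++ L]>>%VS.
  rewrite map_cat span_cat /rowspan span_set_seq -map_comp; congr (<<_>> + _)%VS.
  by apply: eq_map => e /=; rewrite ev_rowv.
by rewrite -(rowspan_mv x y S w s t) -rowspan_split !E; apply: gen_dim.
Qed.

Lemma twist_mv w s t a b c d e : w \notin [:: a; b; c; d; e] ->
  twist_rows (mv x w s) (mv y w t) a b c d e = twist_rows x y a b c d e.
Proof.
rewrite !inE !negb_or => /and5P[wa wb wc wd we].
by rewrite /twist_rows /tri !rowv_mv // !br_mv.
Qed.

Lemma dim_line2 w i j k U : uniq [:: w; i; j; k] -> (U <= off R w)%VS ->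
  \dim (U + <[rowv x y w i]> + <[rowv x y w j]>)%VS = (\dim U + 2)%N.
Proof.
rewrite /= !inE !negb_or andbT => /and3P[/and3P[wi wj wk] /andP[ij ik] jk] Uoff.
have b1 : br x y w i j != 0 by apply: gen_br.
have b2 : br x y w i k != 0 by apply: gen_br.
have b3 : br x y w j k != 0 by apply: gen_br.
have H c1 c2 : c1 *: rowv x y w i + c2 *: rowv x y w j \in U -> c1 = 0 /\ c2 = 0.
  move=> /(subvP Uoff) H; have [|-> ->] // := three_indep (c1 := c1) (c2 := c2) (c3 := 0) b1 b2 b3.
  by rewrite scale0r addr0.
rewrite dim_add_line_notin ?dim_add_line_notin ?addn2 //.
  by apply/negP => h; have [|/eqP] := H 1 0; rewrite ?scale1r ?scale0r ?addr0 // oner_eq0.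
apply/negP => /mem_add_line[k' h]; have [|_ /eqP] := H (- k') 1; last by rewrite oner_eq0.
by rewrite scale1r scaleNr addrC.
Qed.

(** The stress of the [K_5] on [w, a, b, c, d] expresses the row of [w d] by the three chosen rows,
    modulo rows inside [A]. *)
Lemma star_line3 w A U a b c : labels A [:: a; b; c] -> w \notin A ->
  (forall i j, labels A [:: i; j] -> rowv x y i j \in U) ->
  (star x y w A <= U + line3 x y w a b c)%VS.
Proof.
move=> L wA UA; apply/span_set_subP => d dA.
have l3 : (line3 x y w a b c <= U + line3 x y w a b c)%VS by apply: addvSr.
have rl (i : 'I_n) : i \in [:: a; b; c] -> rowv x y w i \in line3 x y w a b c.
  rewrite !inE /line3 => /or3P[]/eqP->.
  - by rewrite -addvA (subvP (addvSl _ _)) ?memv_line.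
  - by rewrite (subvP (addvSl _ _)) // (subvP (addvSr _ _)) ?memv_line.
  - by rewrite (subvP (addvSr _ _)) ?memv_line.
have [/rl H|dabc] := boolP (d \in [:: a; b; c]); first exact: subvP l3 _ H.
have L4 : labels A [:: a; b; c; d].
  have : labels A [:: d; a; b; c] by rewrite labels_cons dA dabc.
  by move=> L'; perm_labels L'.
have [[aA bA cA _] [ab ac ad] bc bd cd] := labels4P L4.
have wi i : i \in A -> w != i by move=> iA; apply: contraNneq wA => ->.
have u5 : uniq [:: w; a; b; c; d].
  rewrite cons_uniq (andP L4).1 andbT !inE !negb_or.
  by rewrite !wi.
have Hbr i j k : i \in [:: w; a; b; c; d] -> j \in [:: w; a; b; c; d] ->
    k \in [:: w; a; b; c; d] -> uniq [:: i; j; k] -> br x y i j k != 0.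
  move=> _ _ _; rewrite /= !inE !negb_or andbT => /andP[/andP[ij ik] jk].
  exact: gen_br.
have K5 := K5_stress u5 Hbr; rewrite /stress in K5.
have t0 : (tri x y w d a b c)^-1 != 0 by rewrite invr_eq0 /tri !mulf_neq0 // gen_br ?wi // eq_sym.
suff H : (tri x y w d a b c)^-1 *: rowv x y w d \in (U + line3 x y w a b c)%VS.
  by move/(memvZ (tri x y w d a b c)): H; rewrite scalerA divff ?scale1r // -invr_eq0.
have : 0 \in (U + line3 x y w a b c)%VS by apply: mem0v.
have UW i j : labels A [:: i; j] -> forall k : R, k *: rowv x y i j \in (U + line3 x y w a b c)%VS.
  by move=> L2 k; rewrite memvZ // (subvP (addvSl _ _)) // UA.
have lW i : i \in [:: a; b; c] -> forall k : R, k *: rowv x y w i \in (U + line3 x y w a b c)%VS.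
  by move=> /rl H k; rewrite memvZ // (subvP l3).
rewrite -{1}K5.
rewrite rpredDr; last by apply: UW; sub_labels L4 [:: a; b].
rewrite rpredDr; last by apply: UW; sub_labels L4 [:: a; c].
rewrite rpredDr; last by apply: UW; sub_labels L4 [:: a; d].
rewrite rpredDr; last by apply: UW; sub_labels L4 [:: b; c].
rewrite rpredDr; last by apply: UW; sub_labels L4 [:: b; d].
rewrite rpredDr; last by apply: UW; sub_labels L4 [:: c; d].
by rewrite rpredDl // !rpredD // lW // !inE eqxx ?orbT.
Qed.

Lemma complete_split V w : w \in V ->
  RS (complete V) = (RS (complete (V :\ w)) + star x y w (V :\ w))%VS.
Proof.
move=> wV; rewrite (rowspan_split x y _ w); congr (RS _ + star _ _ _ _)%VS.
  apply/setP=> e; rewrite !inE /inc negb_or.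
  by case: (_ == w); case: (_ == w); rewrite ?andbF ?andbT.
exact: nbhd_complete.
Qed.

Lemma complete_off V w : w \notin V -> (RS (complete V) <= off R w)%VS.
Proof. exact: rowspan_off. Qed.

Lemma complete_rowv V i j : labels V [:: i; j] -> rowv x y i j \in RS (complete V).
Proof.
rewrite /labels /= inE !andbT => /and3P[ij iV jV]; have [e J] := joins_ex ij.
by apply: (rowv_rowspan _ _ J); rewrite (joins_complete _ J) iV.
Qed.

Lemma star_tight V w : w \notin V -> (3 <= #|V|)%N ->
  exists a b c, labels V [:: a; b; c] /\
    (RS (complete V) + star x y w V = RS (complete V) + line3 x y w a b c)%VS.
Proof.
move=> wV cV; have [|t [st L]] := @labels_extend _ V 3 [::] isT; first by rewrite /=.
case: t st L => [|a [|b [|c []]]] //= _ L; exists a, b, c; split=> //.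
have [aV bV cV'] : [/\ a \in V, b \in V & c \in V].
  by move: L; rewrite !labels_cons => /and5P[-> _ -> _ /andP[->]].
apply/eqP; rewrite eqEsubv; apply/andP; split; rewrite subv_add addvSl /=.
  by apply: star_line3 => //; apply: complete_rowv.
by apply: subv_trans (line3_star _ _ _ aV bV cV') (addvSr _ _).
Qed.

Lemma br_labels V w a b c : w \notin V -> labels V [:: a; b; c] ->
  [/\ br x y w a b != 0, br x y w a c != 0 & br x y w b c != 0].
Proof.
rewrite /labels /= !inE !negb_or !andbT => wV /andP[/andP[/andP[ab ac] bc] /and3P[aV bV cV]].
have wi i : i \in V -> w != i by move=> iV; apply: contraNneq wV => ->.
by split; apply: gen_br; rewrite ?wi.
Qed.

(** Beyond a triangle each vertex adds exactly three: at most three by [star_line3], at least three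
    by [dim_line3]. *)
Lemma rank_complete V : (3 < n)%N -> (3 <= #|V|)%N -> (\dim (RS (complete V)) + 6 = 3 * #|V|)%N.
Proof.
move=> n4; have [m] := ubnP #|V|; elim: m V => [|m IH] V; first by rewrite ltn0.
move=> leVm cV; have cn : (3 < #|[set: 'I_n]|)%N by rewrite cardsT card_ord.
have [w wV] : exists w, w \in V by apply/card_gt0P; exact: (leq_trans _ cV).
have cVw : #|V| = (#|V :\ w|).+1 by rewrite (cardsD1 w V) wV.
have [c3|] := leqP 3 #|V :\ w|.
  have wVw : w \notin V :\ w by rewrite !inE eqxx.
  have [a [b [c [L E]]]] := star_tight wVw c3; have [b1 b2 b3] := br_labels wVw L.
  rewrite (complete_split wV) E dim_line3 ?complete_off // cVw.
  rewrite cVw ltnS in leVm; have := IH (V :\ w) leVm c3.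
  by rewrite mulnS => <-; rewrite addnAC addnC.
rewrite ltnS => c2; have {}c2 : #|V :\ w| = 2%N by move: cV c2; rewrite cVw; lia.
have /cards2P[i [j [ij EV]]] : #|V :\ w| == 2%N by rewrite c2.
have iVw : i \in V :\ w by rewrite EV !inE eqxx.
have jVw : j \in V :\ w by rewrite EV !inE eqxx orbT.
have [wi iV] : w != i /\ i \in V by move: iVw; rewrite !inE eq_sym => /andP[].
have [wj jV] : w != j /\ j \in V by move: jVw; rewrite !inE eq_sym => /andP[].
(* The triangle lacks a third direction at its vertices; a fourth vertex of the ambient set supplies
   the brackets that [dim_line2] needs. *)
have u3 : labels [set: 'I_n] [:: w; i; j] by rewrite /labels /= !inE !negb_or wi wj ij.
have [|t [st L4]] := @labels_extend _ _ 1 _ u3; first by rewrite /=.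
case: t st L4 => [|k []] //= _ L4.
have [_ [_ _ wk] _ ik jk] := labels4P L4.
rewrite (complete_split wV) (complete_split iVw).
have EVi : V :\ w :\ i = [set j] by apply/setP=> z; rewrite EV !inE; case: eqVneq => //= ->; rewrite (negPf ij).
have c0 : RS (complete (V :\ w :\ i)) = 0%VS.
  apply/eqP; rewrite -subv0; apply/rowspan_subP => e p q + J; rewrite EVi (joins_complete _ J) !inE.
  by case/andP=> /eqP E1 /eqP E2; have := joins_neq J; rewrite E1 E2 eqxx.
rewrite c0 add0v {1}EVi EV /star {1}/span_set big_set1 /span_set big_setU1 ?inE // big_set1.
rewrite addvA (dim_line2 (k := k)) ?dim_vline.
(* Here [dim_line2] serves to see that the row of [i j] is nonzero. *)
- have u4 : uniq [:: i; j; k; w].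
    by rewrite /= !inE !negb_or ij ik jk /= !(eq_sym _ w) wi wj wk.
  have := dim_line2 u4 (sub0v _); rewrite cVw c2 dimv0 add0v.
  case: eqP => //= -> D; have := dim_add_line (<[0]> : {vspace vT})%VS (rowv x y i k).
  by rewrite D dim_vline eqxx.
- by case/andP: L4.
- by rewrite -memvE rowv_off.
Qed.

(** The constant is 3 and not 6 so that the bound holds down to a single vertex, where it is
    attained. *)
Lemma rank_complete_lt V (S : {set edge n}) : (3 < n)%N -> (0 < #|V|)%N -> S \subset complete V ->
  cofactor_matroid x y S -> (#|S| + 3 <= 3 * #|V|)%N.
Proof.
move=> n4 cV sSV; rewrite cofactorE => /eqP dS.
have leS : (\dim (RS S) <= \dim (RS (complete V)))%N by apply: dimvS; apply: rowspanS.
have [c3|c2] := leqP 3 #|V|; first by have := rank_complete n4 c3; move: leS; rewrite dS; lia.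
suff : (#|complete V| <= #|V|.-1)%N.
  by have := subset_leq_card sSV; move: cV c2; lia.
have [w wV] : exists w, w \in V by apply/card_gt0P.
suff H : complete V \subset starset (complete V) w.
  apply: leq_trans (subset_leq_card H) _; rewrite -card_nbhd (cardsD1 w V) wV /=.
  by apply: subset_leq_card; apply: nbhd_sub.
apply/subsetP=> e; rewrite inE => eV; rewrite inE inE eV /=; apply: contraTT c2.
rewrite /inc negb_or -leqNgt => /andP[e1 e2]; move: eV; case/andP => e1V e2V.
have sub : [set w; (val e).1; (val e).2] \subset V.
  by apply/subsetP=> z; rewrite !inE -orbA => /or3P[]/eqP->.
have := subset_leq_card sub; rewrite -setUA !cardsU1 cards1 !inE negb_or.
by rewrite (eq_sym w) e1 (eq_sym w) e2 edge_ends_neq.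
Qed.

End Ranks.

(** * Twisted quadrilaterals *)

Section Twist.
Variables (R : realFieldType) (n : nat) (x y : 'I_n -> R).
Hypothesis gen : alg_indep_Q (coords x y).
Local Notation vT := 'M[R]_(n, 3).
Local Notation RS := (rowspan x y).
Local Notation Cof := (cofactor_matroid x y).
Implicit Types (S : {set edge n}) (V A : {set 'I_n}) (U W : {vspace vT}).

(** [W] already contains the pair of opposite edges [ab], [cd]. This lowers the rank of the
    quadrilateral from two to one: what remains modulo [W] are multiples of [ac], and its
    nonexistence reads [ac \in W]. *)
Definition twisted W (a b c d e : 'I_n) : bool := (<<twist_rows x y a b c d e>> <= W)%VS.

Lemma twistedP W a b c d e : reflect
  [/\ [/\ rowv x y a e \in W, rowv x y b e \in W, rowv x y c e \in W & rowv x y d e \in W],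
      rowv x y a b \in W, rowv x y c d \in W,
      tri x y b d a c e *: rowv x y a c - tri x y a c b d e *: rowv x y b d \in W &
      tri x y a d b c e *: rowv x y a c + tri x y a c b d e *: rowv x y a d \in W /\
      tri x y b c a d e *: rowv x y a c + tri x y a c b d e *: rowv x y b c \in W]
  (twisted W a b c d e).
Proof.
rewrite /twisted; apply: (iffP span_subvP) => [H|[[h1 h2 h3 h4] h5 h6 h7 [h8 h9]] v].
  by do !split; apply: H; rewrite /twist_rows !inE eqxx ?orbT.
by rewrite /twist_rows !inE => /orP[/eqP->|/orP[/eqP->|/orP[/eqP->|/orP[/eqP->|/orP[/eqP->|/orP[/eqP->|/or3P[]/eqP->]]]]]].
Qed.

Lemma twistedS W W' a b c d e : (W <= W')%VS -> twisted W a b c d e -> twisted W' a b c d e.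
Proof. by move=> s t; apply: subv_trans t s. Qed.

Lemma twisted_stress A W a b c d e : labels A [:: a; b; c; d; e] ->
  [/\ rowv x y a e \in W, rowv x y b e \in W, rowv x y c e \in W & rowv x y d e \in W] ->
  [/\ stress x y b d a c e - stress x y a c b d e \in W,
      stress x y c d a b e - stress x y a b c d e \in W,
      stress x y a d b c e - stress x y b c a d e \in W &
      stress x y b c a d e + (stress x y a b c d e + stress x y a c b d e) \in W] ->
  stress x y a b c d e \in W -> twisted W a b c d e.
Proof.
move=> L he [g1 g2 g3 g4] ab.
have Lac : labels A [:: a; c; b; d; e] by perm_labels L.
have Lbd : labels A [:: b; d; a; c; e] by perm_labels L.
have Lcd : labels A [:: c; d; a; b; e] by perm_labels L.
have Lad : labels A [:: a; d; b; c; e] by perm_labels L.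
have Lbc : labels A [:: b; c; a; d; e] by perm_labels L.
have acbc : stress x y a c b d e + stress x y b c a d e \in W.
  by move: g4; rewrite addrCA rpredDl // addrC.
have combB (p q : R) (u v : vT) : q *: (p *: u) - p *: (q *: v) = (p * q) *: (u - v).
  by rewrite !scalerA (mulrC q) scalerBr.
have combD (p q : R) (u v : vT) : q *: (p *: u) + p *: (q *: v) = (p * q) *: (u + v).
  by rewrite !scalerA (mulrC q) scalerDr.
apply/twistedP; split=> //.
- by rewrite -(stress_in gen _ L).
- by rewrite -(stress_in gen _ Lcd) -(subrK (stress x y a b c d e) (stress x y c d a b e)) memvD.
- by rewrite (tri_stress gen Lac) (tri_stress gen Lbd) combB memvZ // -memvN opprB.
split; last by rewrite (tri_stress gen Lac) (tri_stress gen Lbc) combD memvZ.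
rewrite (tri_stress gen Lac) (tri_stress gen Lad) combD memvZ //.
by rewrite -(subrK (stress x y b c a d e) (stress x y a d b c e)) addrCA memvD.
Qed.

Lemma indep_dim S : Cof S -> \dim (RS S) = #|S|.
Proof. by rewrite cofactorE => /eqP. Qed.

(* A maximal counterexample is a hyperplane, so its bases have [3 #|V| - 7]
   edges; six of them lie in the five given vertices, and counting degrees
   leaves an outside vertex of degree at most five. *)
Lemma twisted_vertex V S a b c d e : (3 < n)%N -> S \subset complete V ->
  labels V [:: a; b; c; d; e] -> twisted (RS S) a b c d e -> rowv x y a c \notin RS S ->
  exists (B : {set edge n}) (w : 'I_n), [/\ B \subset complete V, Cof B, twisted (RS B) a b c d e,
     rowv x y a c \notin RS B & [/\ w \in V, w \notin [:: a; b; c; d; e] & (#|nbhd B w| <= 5)%N]].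
Proof.
move=> n4 sSV L tS acS.
have mC := cofactor_matroidP x y.
have [[aV bV cV dV eV] [ab ac ad ae] [bc bd be] [cd ce] de] := labels5P L.
have [S1 /maxsetP[/andP[sS1V acS1] maxS1] sSS1] :=
  @maxset_exists _ (fun T : {set edge n} => (T \subset complete V) && (rowv x y a c \notin RS T)) S
    (introT andP (conj sSV acS)).
have tS1 : twisted (RS S1) a b c d e by apply: twistedS tS; apply: rowspanS.
have closed g : g \in complete V -> cof_row x y g \in RS S1 -> g \in S1.
  move=> gV gS; have <- : g |: S1 = S1; last by rewrite !inE eqxx.
  apply: maxS1; last exact: subsetUr.
  rewrite subUset sub1set gV sS1V /= rowspan_add (addv_idPr _) //.
have hyper : (RS (complete V) <= RS S1 + <[rowv x y a c]>)%VS.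
  apply/span_set_subP => g gV; have [gS|gS] := boolP (g \in S1).
    by apply: (subvP (addvSl _ _)); apply: (span_set_mem (cof_row x y)).
  apply: line_exchange => //; rewrite addvC -rowspan_add.
  apply: contraNT gS => H.
  have <- : g |: S1 = S1; last by rewrite !inE eqxx.
  by apply: maxS1; [rewrite subUset sub1set gV sS1V H|exact: subsetUr].
have in1 i j : i \in V -> j \in V -> i != j -> rowv x y i j \in RS S1 ->
    exists2 g, g \in S1 & joins g i j.
  move=> iV jV ij H; have [g J] := joins_ex ij; exists g => //.
  by apply: closed; rewrite ?(joins_complete _ J) ?iV // (cof_row_mem _ _ _ J).
have [[ae1 be1 ce1 de1] ab1 cd1 g1 [g2 g3]] := elimT (twistedP _ _ _ _ _ _) tS1.
have [h1 h1S j1] := in1 _ _ aV bV ab ab1.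
have [h2 h2S j2] := in1 _ _ cV dV cd cd1.
have [h3 h3S j3] := in1 _ _ aV eV ae ae1.
have [h4 h4S j4] := in1 _ _ bV eV be be1.
have [h5 h5S j5] := in1 _ _ cV eV ce ce1.
have [h6 h6S j6] := in1 _ _ dV eV de de1.
pose E6 := [set h1; h2; h3; h4; h5; h6].
have sE6 : E6 \subset S1.
  by apply/subsetP=> g; rewrite !inE -!orbA => /or4P[/eqP->|/eqP->|/eqP->|/or3P[]/eqP->].
have sV i j k : i \in V -> j \in V -> k \in V -> i != j -> i != k -> j != k -> labels V [:: i; j; k].
  by move=> *; rewrite /labels /= !inE !negb_or !andbT; do ?(apply/andP; split).
(* The triangle on [c], [d], [e] has rank 3, [be] adds one at [b], and [ab], [ae] add two at [a]. *)
have E6dim : (6 <= \dim (RS E6))%N.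
  pose U3 := RS (complete [set c; d; e]).
  have cde : #|[set c; d; e]| = 3%N.
    by rewrite -setUA !cardsU1 cards1 !inE negb_or cd ce de.
  have dU3 : \dim U3 = 3%N.
    by have := rank_complete gen n4 (eq_leq (esym cde)); rewrite cde -/U3; (clear; lia).
  have oa : (U3 <= off R a)%VS by apply: complete_off; rewrite !inE !negb_or ac ad ae.
  have ob : (U3 <= off R b)%VS by apply: complete_off; rewrite !inE !negb_or bc bd be.
  have dU4 : (4 <= \dim (U3 + <[rowv x y b e]>)%VS)%N.
    have := @dim_line2 _ _ _ _ gen b e c d U3; rewrite /= !inE !negb_or be bc bd (eq_sym e) ce (eq_sym e) de cd.
    move=> /(_ isT ob); rewrite dU3 => D.
    by have := dim_add_line (U3 + <[rowv x y b e]>) (rowv x y b c); rewrite D.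
  have o4 : (U3 + <[rowv x y b e]> <= off R a)%VS by rewrite subv_add oa -memvE rowv_off.
  have := @dim_line2 _ _ _ _ gen a b e c _ _ o4; rewrite /= !inE !negb_or ab ae ac be bc (eq_sym e) ce.
  move=> /(_ isT) D; apply: (@leq_trans (\dim (U3 + <[rowv x y b e]> + <[rowv x y a b]> + <[rowv x y a e]>)%VS)).
    by rewrite D; move: dU4; (clear; lia).
  have m g i j : joins g i j -> g \in E6 -> rowv x y i j \in RS E6 by exact: rowv_rowspan.
  apply: dimvS; rewrite !subv_add -!memvE.
  rewrite (m _ _ _ j4) ?(m _ _ _ j1) ?(m _ _ _ j3) ?inE ?eqxx ?orbT // !andbT.
  apply/rowspan_subP => g i j gc J; have ij := joins_neq J.
  have jj := joins_inj J; have jC : joins g j i by rewrite joinsC.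
  have jj' := joins_inj jC.
  move: gc; rewrite (joins_complete _ J) !inE -!orbA.
  rewrite -(cof_row_mem _ _ _ J) => /andP[/or3P[]/eqP Ei /or3P[]/eqP Ej];
    rewrite Ei Ej ?eqxx // in ij jj jj' *; apply: (span_set_mem (cof_row x y));
    first [rewrite (jj _ j2) | rewrite (jj' _ j2) | rewrite (jj _ j5) | rewrite (jj' _ j5)
          | rewrite (jj _ j6) | rewrite (jj' _ j6)]; by rewrite !inE eqxx ?orbT.
have E6card : (#|E6| <= 6)%N.
  rewrite /E6 -!setUA; do 5! (rewrite cardsU1; apply: (leq_trans (leq_add (leq_b1 _) (leqnn _))); rewrite add1n ltnS).
  by rewrite cards1.
have E6leq := span_set_card (cof_row x y) E6.
have cE6 : #|E6| = 6%N by apply/eqP; rewrite eqn_leq E6card (leq_trans E6dim).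
have CE6 : Cof E6 by rewrite cofactorE eqn_leq E6leq cE6.
have [Y [sYS CY cY]] := mrank_basis mC S1.
have [|B [sE6B sB CB cB]] := @augment _ _ mC E6 Y (mrank Cof S1) CE6 CY.
  by rewrite cY leqnn leq_mrank.
have sBS : B \subset S1 by apply: subset_trans sB _; rewrite subUset sE6.
have RB : RS B = RS S1.
  by apply: subv_dim_eq; [apply: rowspanS|rewrite (indep_dim CB) cB mrank_cofactor].
have sBV : B \subset complete V by apply: subset_trans sS1V.
have cV5 : (5 <= #|V|)%N.
  rewrite -(_ : size [:: a; b; c; d; e] = 5%N) // -(card_uniqP (andP L).1).
  by apply: subset_leq_card; apply/subsetP => z; move/allP: (andP L).2; apply.
have rk := rank_complete gen n4 (leq_trans (isT : (3 <= 5)%N) cV5).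
have cardB : (#|B| + 7 = 3 * #|V|)%N.
  rewrite -rk -(indep_dim CB) RB; apply/eqP; rewrite eqn_leq.
  have l1 : (\dim (RS (complete V)) <= (\dim (RS S1)).+1)%N.
    exact: leq_trans (dimvS hyper) (dim_add_line _ _).
  have l2 : (\dim (RS S1 + <[rowv x y a c]>) <= \dim (RS (complete V)))%N.
    apply: dimvS; rewrite subv_add rowspanS // -memvE; apply: complete_rowv.
    by rewrite /labels /= inE ac aV cV.
  by rewrite dim_add_line_notin // in l2; move: l1 l2; (clear; lia).
have notB g i j : g \in B -> joins g i j -> rowv x y i j \in RS S1.
  by move=> gB J; rewrite -RB; apply: rowv_rowspan J gB.
have scaled k v : k != 0 -> k *: v \in RS S1 -> v \in RS S1.
  by move=> k0 /(memvZ k^-1); rewrite scalerA mulVf // scale1r.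
have t1 : tri x y a d b c e != 0 by apply: (tri_neq0 gen (A := V)); perm_labels L.
have t2 : tri x y b c a d e != 0 by apply: (tri_neq0 gen (A := V)); perm_labels L.
have t3 : tri x y b d a c e != 0 by apply: (tri_neq0 gen (A := V)); perm_labels L.
(* Modulo [RS S1] the rows of [ad], [bc] and [bd] are nonzero multiples of that of [ac], so [B] can
   use only the six edges of [E6] inside the five vertices. *)
have nad : rowv x y a d \notin RS S1.
  apply: contra acS1 => H; apply: (scaled _ _ t1).
  by move: g2; rewrite rpredDr // memvZ.
have nbc : rowv x y b c \notin RS S1.
  apply: contra acS1 => H; apply: (scaled _ _ t2).
  by move: g3; rewrite rpredDr // memvZ.
have nbd : rowv x y b d \notin RS S1.
  apply: contra acS1 => H; apply: (scaled _ _ t3).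
  by move: g1; rewrite rpredBr // memvZ.
pose T := [set a; b; c; d; e].
have BT : B :&: complete T \subset E6.
  apply/subsetP=> g; rewrite inE => /andP[gB gT].
  have J := edge_ends g; have := notB _ _ _ gB J; have ij := joins_neq J.
  have JC : joins g (val g).2 (val g).1 by rewrite joinsC.
  have := notB _ _ _ gB JC.
  have jj := joins_inj J; have jj' := joins_inj JC.
  move=> H1 H2; move: gT; rewrite (joins_complete _ J) !inE -!orbA; move: ij J jj jj' H1 H2.
  move: (val g).1 (val g).2 => i j ij _ jj jj' H1 H2.
  case/andP=> /or4P[/eqP Ei|/eqP Ei|/eqP Ei|/orP[]/eqP Ei] /or4P[/eqP Ej|/eqP Ej|/eqP Ej|/orP[]/eqP Ej];
    rewrite Ei Ej in ij jj jj' H1 H2; rewrite ?eqxx // in ij;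
    first [by rewrite H1 in acS1 | by rewrite H2 in acS1 | by rewrite H1 in nad | by rewrite H2 in nad
      | by rewrite H1 in nbc | by rewrite H2 in nbc | by rewrite H1 in nbd | by rewrite H2 in nbd
      | by rewrite (jj _ j1) eqxx ?orbT | by rewrite (jj' _ j1) eqxx ?orbT
      | by rewrite (jj _ j2) eqxx ?orbT | by rewrite (jj' _ j2) eqxx ?orbT
      | by rewrite (jj _ j3) eqxx ?orbT | by rewrite (jj' _ j3) eqxx ?orbT
      | by rewrite (jj _ j4) eqxx ?orbT | by rewrite (jj' _ j4) eqxx ?orbT
      | by rewrite (jj _ j5) eqxx ?orbT | by rewrite (jj' _ j5) eqxx ?orbT
      | by rewrite (jj _ j6) eqxx ?orbT | by rewrite (jj' _ j6) eqxx ?orbT].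
have cT : #|T| = 5%N.
  by rewrite /T -!setUA !cardsU1 cards1 !inE !negb_or ab ac ad ae bc bd be cd ce de.
have sTV : T \subset V.
  by apply/subsetP=> z; rewrite !inE -!orbA => /or4P[/eqP->|/eqP->|/eqP->|/orP[]/eqP->].
pose W := V :\: T.
have cW : (#|V| = #|W| + 5)%N by rewrite /W cardsD (setIidPr sTV) cT subnK.
have sET : E6 \subset B :&: complete T.
  rewrite subsetI sE6B /=.
  have H h i j : joins h i j -> i \in T -> j \in T -> ((val h).1 \in T) && ((val h).2 \in T).
    by move=> J iT jT; have := joins_complete T J; rewrite inE iT jT.
  have aT : a \in T by rewrite !inE eqxx ?orbT.
  have bT : b \in T by rewrite !inE eqxx ?orbT.
  have cT' : c \in T by rewrite !inE eqxx ?orbT.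
  have dT : d \in T by rewrite !inE eqxx ?orbT.
  have eT : e \in T by rewrite !inE eqxx ?orbT.
  apply/subsetP=> g; rewrite [g \in complete T]inE => gE.
  have : [|| g == h1, g == h2, g == h3, g == h4, g == h5 | g == h6].
    by move: gE; rewrite !in_setU !in_set1 -!orbA.
  by case/or4P=> [/eqP->|/eqP->|/eqP->|/or3P[]/eqP->];
    [apply: H j1 _ _|apply: H j2 _ _|apply: H j3 _ _|apply: H j4 _ _|apply: H j5 _ _|apply: H j6 _ _].
have [w [wW lw]] : exists w, w \in W /\ (#|nbhd B w| <= 5)%N.
  have [/exists_inP[w wW lw]|H] := boolP [exists w in W, #|nbhd B w| <= 5]%N; first by exists w.
  have big w : w \in W -> (6 <= #|nbhd B w|)%N.
    by move=> wW; rewrite ltnNge; apply: contra H => lw; apply/exists_inP; exists w.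
  (* Without outside vertices [B] has [3 * 5 - 7 = 8] edges, yet it lies in [E6]. *)
  have [W0|W0] := posnP #|W|.
    have VT : V = T by apply/eqP; rewrite eq_sym eqEcard sTV cW W0 cT.
    have := subset_leq_card BT; rewrite -VT (setIidPl sBV) cE6.
    by move: cardB; rewrite cW W0; (clear; lia).
  have lo : (6 * #|W| <= \sum_(w in W) #|nbhd B w|)%N.
    by rewrite mulnC -sum_nat_const; apply: leq_sum.
  (* This holds edge by edge. As [|B| = 3|W| + 8], the degrees sum to at most
     [(3|W| + 8) + (3|W| - 3) - 6 = 6|W| - 1]. *)
  have up : (\sum_(w in W) #|nbhd B w| + #|B :&: complete T| <= #|B| + #|B :&: complete W|)%N.
    have cI X : #|B :&: X| = (\sum_(g in B) (g \in X))%N.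
      rewrite -sum1_card big_mkcond [RHS]big_mkcond /=; apply: eq_bigr => g _.
      by rewrite inE; case: (g \in B); case: (g \in X).
    rewrite sum_deg !cI -[#|B|]sum1_card -!big_split /=; apply: leq_sum => g gB.
    have := subsetP sBV _ gB; rewrite !inE => /andP[-> ->]; rewrite !andbT.
    by case: (_ || _); case: (_ || _).
  have CW : Cof (B :&: complete W) by apply: (indep_sub mC _ CB); apply: subsetIl.
  have lW := rank_complete_lt gen n4 W0 (subsetIr B (complete W)) CW.
  have lT := subset_leq_card sET; rewrite cE6 in lT.
  by move: lo up lW lT cardB; rewrite cW; (clear; lia).
exists B, w; split=> //.
- by rewrite RB.
- by rewrite RB.
by move: wW; rewrite !inE -!orbA => /andP[wT wV].
Qed.

End Twist.

(** * Removing an outside vertex from a twisted quadrilateral *)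

Section Reduction.
Variables (R : realFieldType) (n : nat) (x y : 'I_n -> R).
Hypothesis gen : alg_indep_Q (coords x y).
Local Notation vT := 'M[R]_(n, 3).
Local Notation RS := (rowspan x y).
Local Notation Cof := (cofactor_matroid x y).

Lemma star_in_line3 (A : {set 'I_n}) w i j k :
  {subset A <= [:: i; j; k]} -> (star x y w A <= line3 x y w i j k)%VS.
Proof.
move=> sA; apply/span_set_subP => z /sA; rewrite /line3 !inE => /or3P[]/eqP->.
- by rewrite -addvA (subvP (addvSl _ _)) ?memv_line.
- by rewrite (subvP (addvSl _ _)) // (subvP (addvSr _ _)) ?memv_line.
- by rewrite (subvP (addvSr _ _)) ?memv_line.
Qed.

Variables (V : {set 'I_n}) (B : {set edge n}) (w : 'I_n).
Hypotheses (sBV : B \subset complete V) (CB : Cof B).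
Let Y := without B w.
Let A := nbhd B w.
Let V' := V :\ w.
Let H' := Y :|: complete A.

Let wA : w \notin A. Proof. exact: nbhd_neq. Qed.
Let wV' : w \notin V'. Proof. by rewrite !inE eqxx. Qed.
Let sAV : A \subset V'. Proof. exact: nbhd_sub. Qed.
Let sYV : Y \subset complete V'. Proof. exact: without_sub. Qed.
Let sHV : H' \subset complete V'.
Proof. by rewrite subUset sYV completeS. Qed.
Let Yoff : (RS Y <= off R w)%VS. Proof. exact: without_off. Qed.
Let Hoff : (RS H' <= off R w)%VS. Proof. exact: rowspan_off sHV wV'. Qed.
Let RB : RS B = (RS Y + star x y w A)%VS. Proof. exact: rowspan_split. Qed.
Let YH : (RS Y <= RS H')%VS. Proof. by apply: rowspanS; apply: subsetUl. Qed.

Lemma dim_without : \dim (RS Y) = #|Y|.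
Proof.
apply: indep_dim; apply: (indep_sub (cofactor_matroidP x y) _ CB).
by apply/subsetP=> g; rewrite inE => /andP[].
Qed.

Let HA i j : labels A [:: i; j] -> rowv x y i j \in RS H'.
Proof.
rewrite labels2E => /and3P[ij iA jA]; have [g J] := joins_ex ij.
by apply: (rowv_rowspan _ _ J); rewrite inE (joins_complete _ J) iA jA orbT.
Qed.

Lemma star_line3_H : (3 <= #|A|)%N -> exists i j k, labels A [:: i; j; k] /\
  (star x y w A <= RS H' + line3 x y w i j k)%VS.
Proof.
move=> cA; have [|t [st L]] := @labels_extend _ A 3 [::] isT; first by [].
case: t st L => [|i [|j [|k []]]] //= _ L; exists i, j, k; split=> //.
exact: (star_line3 gen L wA HA).
Qed.

(** Once its neighbourhood is completed, [w] contributes only three independent rows, and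
    [line3_off] discards them. *)
Lemma off_complete (v : vT) : (3 <= #|A|)%N -> v \in RS B -> v \in off R w -> v \in RS H'.
Proof.
move=> /star_line3_H[i [j [k [L s]]]] vB; have [b1 b2 b3] := br_labels gen wA L.
apply: (line3_off b1 b2 b3 Hoff); apply: subvP vB; rewrite RB subv_add s andbT.
exact: subv_trans YH (addvSl _ _).
Qed.

Lemma off_small (v : vT) : (3 <= #|V'|)%N -> (#|A| <= 3)%N -> v \in RS B -> v \in off R w -> v \in RS Y.
Proof.
move=> cV cA vB; have LA : labels V' (enum A).
  by rewrite /labels enum_uniq; apply/allP => z; rewrite mem_enum => /(subsetP sAV).
have [|t [st L]] := @labels_extend _ V' (3 - #|A|) _ LA; first by rewrite -cardE subnKC.
have sA : {subset A <= enum A ++ t} by move=> z zA; rewrite mem_cat mem_enum zA.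
have : size (enum A ++ t) = 3%N by rewrite size_cat -cardE st subnKC.
case: (enum A ++ t) sA L => [|i [|j [|k []]]] //= sA L _.
have [b1 b2 b3] := br_labels gen wV' L.
apply: (line3_off b1 b2 b3 Yoff); apply: subvP vB; rewrite RB subv_add addvSl /=.
exact: subv_trans (star_in_line3 _ sA) (addvSr _ _).
Qed.

(** [RS B] always lies in [RS H'] plus three star rows; the dimension bound turns this inclusion
    into an equality. *)
Lemma rowspan_H_sub : (3 <= #|A|)%N -> (\dim (RS H') + 3 <= #|B|)%N -> (RS H' <= RS B)%VS.
Proof.
move=> /star_line3_H[i [j [k [L s]]]] dH; have [b1 b2 b3] := br_labels gen wA L.
have sB : (RS B <= RS H' + line3 x y w i j k)%VS.
  by rewrite RB subv_add s andbT; apply: subv_trans YH (addvSl _ _).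
suff -> : RS B = (RS H' + line3 x y w i j k)%VS by apply: addvSl.
by apply: subv_dim_eq sB _; rewrite (dim_line3 b1 b2 b3 Hoff) (indep_dim CB).
Qed.

Hypothesis IH : forall (S : {set edge n}) a b c d e, S \subset complete V' ->
  labels V' [:: a; b; c; d; e] -> twisted x y (RS S) a b c d e -> rowv x y a c \in RS S.

Variables (a b c d e : 'I_n).
Hypotheses (L : labels V [:: a; b; c; d; e]) (wT : w \notin [:: a; b; c; d; e]).
Hypotheses (tB : twisted x y (RS B) a b c d e) (acB : rowv x y a c \notin RS B).
Hypothesis (degw : (#|A| <= 5)%N).

(** The relations of the quadrilateral, which do not involve [w]. Adjoining them to [RS Y] in [U]
    keeps them available while [w] moves. *)
Let Lam : {vspace vT} := <<twist_rows x y a b c d e>>%VS.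
Let U := (RS Y + Lam)%VS.

Let L' : labels V' [:: a; b; c; d; e].
Proof.
have /andP[uL /allP aL] := L; rewrite /labels uL; apply/allP => z zL.
have zV : z \in V := aL z zL.
by rewrite /= in_setD1 zV andbT; apply: contraNneq wT => <-.
Qed.

Let LamB : (Lam <= RS B)%VS. Proof. exact: tB. Qed.

Let Lamoff : (Lam <= off R w)%VS.
Proof.
have := wT; rewrite !inE !negb_or => /and5P[wa wb wc wd we].
apply/span_subvP => v; rewrite /twist_rows !inE.
by case/orP=> [/eqP->|/orP[/eqP->|/orP[/eqP->|/orP[/eqP->|/orP[/eqP->|/orP[/eqP->|/or3P[]/eqP->]]]]]];
  rewrite ?rpredB ?rpredD ?memvZ ?rowv_off.
Qed.

(** On fewer vertices the induction hypothesis puts [ac] into [RS S], hence into [RS B]. The space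
    [U] itself need not be spanned by edges, and the rest of the section looks for an edge set that
    can replace it. *)
Let reduce (S : {set edge n}) : S \subset complete V' -> (Lam <= RS S)%VS -> (RS S <= RS B)%VS -> False.
Proof. by move=> sS LS SB; case/negP: acB; apply: (subvP SB); apply: IH L' _. Qed.

Let UB : (U <= RS B)%VS.
Proof. by rewrite subv_add LamB andbT RB addvSl. Qed.

Let Uoff : (U <= off R w)%VS. Proof. by rewrite subv_add Yoff Lamoff. Qed.

Let cB : #|B| = (#|Y| + #|A|)%N. Proof. exact: card_without. Qed.

Let tight s t : (\dim (U + star (mv x w s) (mv y w t) w A)%VS <= #|B|)%N.
Proof.
have := @move_dim _ _ _ _ gen B w s t (twist_rows (@px n) (@py n) a b c d e).
rewrite !(twist_rows_map _ _ _ _ _ (evp_px _ _) (evp_py _ _)) twist_mv //.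
by rewrite (addv_idPl LamB) (indep_dim CB) -addvA (addvC (star _ _ _ _)) addvA.
Qed.

Let LamH : (3 <= #|A|)%N -> (Lam <= RS H')%VS.
Proof.
move=> cA; apply/subvP => v vL; apply: off_complete => //; first exact: (subvP LamB).
exact: (subvP Lamoff).
Qed.

Let cV' : (3 <= #|V'|)%N.
Proof.
have /andP[/card_uniqP cL /allP aL] := L'; apply: (@leq_trans 5) => //.
by rewrite -[5%N]cL; apply: subset_leq_card; apply/subsetP => z /aL.
Qed.

Let U_neq_Y : (#|Y| < \dim U)%N.
Proof.
rewrite ltnNge -dim_without; apply/negP => dU.
have UY : RS Y = U by apply: subv_dim_eq; rewrite ?addvSl.
by apply: (reduce sYV); rewrite UY ?addvSr.
Qed.

Let A4 : (4 <= #|A|)%N.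
Proof.
rewrite ltnNge; apply/negP => cA.
apply: (reduce sYV); last by rewrite RB addvSl.
apply/subvP => v vL; apply: off_small => //; first exact: (subvP LamB).
exact: (subvP Lamoff).
Qed.

Let dimU : (\dim U + 3 <= #|B|)%N.
Proof.
have [|t [st LA]] := @labels_extend _ A 3 [::] isT; first exact: ltnW.
case: t st LA => [|i [|j [|k []]]] //= _ LA; have [b1 b2 b3] := br_labels gen wA LA.
rewrite -(dim_line3 b1 b2 b3 Uoff) -(indep_dim CB); apply: dimvS.
have [iA jA kA] : [/\ i \in A, j \in A & k \in A].
  by move: LA; rewrite !labels_cons => /and5P[-> _ -> _ /andP[->]].
by rewrite subv_add UB RB (subv_trans (line3_star _ _ _ iA jA kA)) ?addvSr.
Qed.

Let HU_false : ~~ (RS H' <= U)%VS.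
Proof.
apply/negP => HU; apply: (reduce sHV (LamH (ltnW A4))).
exact: subv_trans HU UB.
Qed.

Let U_lt : (\dim U + 3 < #|B|)%N.
Proof.
rewrite ltn_neqAle dimU andbT; apply/eqP => E; case/negP: HU_false.
apply/rowspan_subP => g i j; rewrite inE => /orP[gY|gA] J.
  by apply: (subvP (addvSl _ _)); apply: rowv_rowspan J gY.
have Lij : labels A [:: i; j].
  by move: gA; rewrite (joins_complete _ J) labels2E (joins_neq J).
by apply: (star_tight3 gen wA Uoff A4) Lij => s t; rewrite E.
Qed.

(** [|Y| + 1 <= dim U] and [dim U + 4 <= |Y| + |A|] force degree five, and then equality in both. *)
Let A5 : #|A| = 5%N.
Proof. by apply/eqP; rewrite eqn_leq degw; move: U_lt U_neq_Y A4; rewrite cB; (clear; lia). Qed.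

Let dimU1 : \dim U = #|Y|.+1.
Proof. by apply/eqP; rewrite eqn_leq U_neq_Y andbT; move: U_lt; rewrite cB A5; (clear; lia). Qed.

Let line_Y (v : vT) : v \in U -> v \notin RS Y -> U = (RS Y + <[v]>)%VS.
Proof.
move=> vU vY; apply/esym/subv_dim_eq; first by rewrite subv_add addvSl -memvE.
by rewrite dim_add_line_notin // dim_without dimU1.
Qed.

(** Otherwise [U], being one dimension larger than [RS Y], is the span of [Y] and this edge, and
    [reduce] applies. *)
Let edge_in_Y i j : labels A [:: i; j] -> rowv x y i j \in U -> rowv x y i j \in RS Y.
Proof.
rewrite labels2E => /and3P[ij iA jA] fU; apply/negPn/negP => fY.
have [g J] := joins_ex ij; have UE := line_Y fU fY.
have E : RS (g |: Y) = U.
  rewrite rowspan_add addvC UE; congr (_ + _)%VS; apply/eqP; rewrite eqEsubv -!memvE.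
  by rewrite (cof_row_mem _ _ _ J) memv_line -(cof_row_mem _ _ _ J) memv_line.
apply: (@reduce (g |: Y)).
- by rewrite subUset sub1set (joins_complete _ J) !(subsetP sAV).
- by rewrite E addvSr.
- by rewrite E UB.
Qed.

(** If the difference were not in [RS Y], it would span [U] over [RS Y], so [Y] with the two edges
    would span all of [U] and carry a twisted quadrilateral avoiding [w]. The induction hypothesis
    then makes [a'c'] dependent on [a'b'] modulo [U]. *)
Let K4_part a' b' c' d' e' : labels A [:: a'; b'; c'; d'; e'] ->
  [/\ rowv x y a' e' \in U, rowv x y b' e' \in U, rowv x y c' e' \in U & rowv x y d' e' \in U] ->
  [/\ stress x y b' d' a' c' e' - stress x y a' c' b' d' e' \in U,
      stress x y c' d' a' b' e' - stress x y a' b' c' d' e' \in U,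
      stress x y a' d' b' c' e' - stress x y b' c' a' d' e' \in U &
      stress x y b' c' a' d' e' + (stress x y a' b' c' d' e' + stress x y a' c' b' d' e') \in U] ->
  stress x y a' c' b' d' e' \notin (U + <[stress x y a' b' c' d' e']>)%VS ->
  stress x y c' d' a' b' e' - stress x y a' b' c' d' e' \in RS Y.
Proof.
move=> L5 [he1 he2 he3 he4] [h1 h2 h3 h4] ac; apply/negPn/negP => dY.
have [[aA bA cA dA eA] [ab _ _ _] _ [cd _] _] := labels5P L5.
have Lac : labels A [:: a'; c'; b'; d'; e'] by perm_labels L5.
have Lcd : labels A [:: c'; d'; a'; b'; e'] by perm_labels L5.
have [g1 J1] := joins_ex ab; have [g2 J2] := joins_ex cd.
pose S := g1 |: (g2 |: Y).
have abS : stress x y a' b' c' d' e' \in RS S.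
  by rewrite (stress_in gen _ L5); apply: (rowv_rowspan _ _ J1); rewrite !in_setU1 eqxx.
have cdS : stress x y c' d' a' b' e' \in RS S.
  by rewrite (stress_in gen _ Lcd); apply: (rowv_rowspan _ _ J2); rewrite !in_setU1 eqxx orbT.
have YS : (RS Y <= RS S)%VS by apply: rowspanS; rewrite /S setUA subsetUr.
have US : (U <= RS S)%VS by rewrite (line_Y h2 dY) subv_add YS -memvE memvB.
have LA' : labels V' [:: a'; b'; c'; d'; e'].
  by have /andP[u5 _] := L5; rewrite /labels u5 /= !(subsetP sAV).
have sS : S \subset complete V'.
  rewrite !subUset !sub1set (joins_complete _ J1) (joins_complete _ J2).
  by rewrite !(subsetP sAV) ?sYV.
have tS : twisted x y (RS S) a' b' c' d' e'.
  by apply: (twisted_stress gen LA') abS; split; apply: (subvP US).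
have := IH sS LA' tS; rewrite -(stress_in gen _ Lac); apply/negP; apply: contra ac.
have abU : stress x y a' b' c' d' e' \in (U + <[stress x y a' b' c' d' e']>)%VS.
  by rewrite (subvP (addvSr _ _)) ?memv_line.
suff SU : (RS S <= U + <[stress x y a' b' c' d' e']>)%VS by apply: (subvP SU).
rewrite !rowspan_add !subv_add -!memvE (cof_row_mem _ _ _ J1) (cof_row_mem _ _ _ J2).
rewrite -(stress_in gen _ L5) -(stress_in gen _ Lcd) abU /=; apply/andP; split.
  rewrite -(subrK (stress x y a' b' c' d' e') (stress x y c' d' _ _ _)) memvD //.
  by apply: (subvP (addvSl _ _)).
exact: subv_trans (addvSl _ _) (addvSl _ _).
Qed.

Lemma reduction_false : False.
Proof.
have t4 s t : (\dim (U + star (mv x w s) (mv y w t) w A)%VS <= \dim U + 4)%N.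
  by rewrite dimU1 addSn -addnS -A5 -cB.
have [[v Hv]|[i0 i0A Hs]|[a' [b' [c' [d' [e' [L5 he hg ab ac]]]]]]] :=
  local_trichotomy gen wA Uoff A5 t4.
(* Now [dim (RS H') + 3] is at most [|Y| + 2 + 3 = |B|], so [rowspan_H_sub] makes [H'] admissible
   for [reduce]. *)
- have HU : (RS H' <= U + <[v]>)%VS.
    apply/rowspan_subP => g i j; rewrite inE => /orP[gY|gA] J.
      by apply: (subvP (addvSl _ _)); apply: (subvP (addvSl _ _)); apply: rowv_rowspan J gY.
    by apply: Hv; move: gA; rewrite (joins_complete _ J) labels2E (joins_neq J).
  apply: (reduce sHV (LamH (ltnW A4))); apply: rowspan_H_sub => //; first exact: ltnW.
  rewrite cB A5 (leq_trans (leq_add (dimvS HU) (leqnn _))) //.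
  by rewrite (leq_trans (leq_add (dim_add_line _ _) (leqnn _))) // dimU1 !addSn -!addnS.
- have [||t [st L0]] := @labels_extend _ A 4 [:: i0]; rewrite ?labels_cons ?i0A ?A5 //.
  case: t st L0 => [|i [|j [|k [|l []]]]] //= _ L0.
  have [[_ iA jA kA lA] [ni nj nk nl] _ _ _] := labels5P L0.
  pose A' := A :\ i0.
  have wA' : w \notin A' by rewrite in_setD1 negb_and wA orbT.
  have LA' : labels A' [:: i; j; k].
    have /andP[u3 _] : labels A [:: i; j; k] by sub_labels L0 [:: l; i0].
    by rewrite /labels u3 /= !in_setD1 !(eq_sym _ i0) ni nj nk iA jA kA.
  have UA' p q : labels A' [:: p; q] -> rowv x y p q \in RS Y.
    rewrite labels2E !in_setD1 => /and3P[pq /andP[p0 pA] /andP[q0 qA]].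
    have Lpq : labels A [:: p; q] by rewrite labels2E pq pA qA.
    by apply: edge_in_Y => //; apply: Hs.
  have sS := star_line3 gen LA' wA' UA'; have [b1 b2 b3] := br_labels gen wA' LA'.
  (* This bounds the rank of [B] by [|Y| + 4], one less than its number of edges. *)
  have SA : (RS B <= RS Y + line3 x y w i j k + <[rowv x y w i0]>)%VS.
    rewrite RB subv_add -addvA addvSl /=; apply/span_set_subP => z zA.
    rewrite addvA; have [->|z0] := eqVneq z i0; first by rewrite (subvP (addvSr _ _)) ?memv_line.
    apply: (subvP (addvSl _ _)); apply: (subvP sS); apply: (span_set_mem (rowv x y w)).
    by rewrite in_setD1 z0.
  have := leq_trans (dimvS SA) (dim_add_line _ _).
  by rewrite (dim_line3 b1 b2 b3 Yoff) dim_without (indep_dim CB) cB A5; (clear; lia).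
have [he1 he2 he3 he4] := he; have [h1 h2 h3 h4] := hg.
have Lac : labels A [:: a'; c'; b'; d'; e'] by perm_labels L5.
have Lad : labels A [:: a'; d'; c'; b'; e'] by perm_labels L5.
have Lbd : labels A [:: b'; d'; a'; c'; e'] by perm_labels L5.
have Lcd : labels A [:: c'; d'; a'; b'; e'] by perm_labels L5.
have Lad' : labels A [:: a'; d'; b'; c'; e'] by perm_labels L5.
have Lbc : labels A [:: b'; c'; a'; d'; e'] by perm_labels L5.
have [[aA bA cA dA eA] [nab nac nad nae] [nbc nbd nbe] [ncd nce] nde] := labels5P L5.
have nab' : stress x y a' b' c' d' e' \notin (U + <[stress x y a' c' b' d' e']>)%VS.
  by apply: contra ac; apply: line_exchange.
have D2 := K4_part L5 he hg ac.
have D1 : stress x y b' d' a' c' e' - stress x y a' c' b' d' e' \in RS Y.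
  apply: (K4_part Lac) => //.
  rewrite (stress_swap12 x y a' d' b' c') (stressC x y _ _ _ nbc) (addrC (stress x y a' c' _ _ _)).
  by split.
have D3 : stress x y b' c' a' d' e' - stress x y a' d' b' c' e' \in RS Y.
  rewrite -(stressC _ _ _ _ _ nbc) -(stress_swap12 x y a' d' b' c').
  apply: (K4_part Lad) => //.
    rewrite (stressC x y _ _ _ nbd) (stress_swap12 x y a' c' b' d') (stressC x y _ _ _ nbc).
    rewrite (stress_swap12 x y a' d' b' c') (stress_swap12 x y a' b' c' d') (stressC x y _ _ _ ncd).
    split; [exact: h1|by rewrite -memvN opprB|by rewrite -memvN opprB|].
    set AB := stress x y a' b' c' d' e' in h2 h4; set BC := stress x y b' c' a' d' e' in h3 h4.
    set CD := stress x y c' d' a' b' e' in h2 *; set AD := stress x y a' d' b' c' e' in h3 *.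
    set AC := stress x y a' c' b' d' e' in h4 *.
    have -> : CD + (AD + AC) = (CD - AB) + ((AD - BC) + (BC + (AB + AC))).
      by rewrite [AD - BC + _]addrA subrK [AD + (AB + _)]addrCA [CD - AB + _]addrA subrK.
    by apply: memvD => //; apply: memvD.
  rewrite (stress_swap12 x y a' c' b' d') (stress_swap12 x y a' d' b' c').
  exact: plane_relabel h3 h4 ab ac.
have T0 : stress x y a' b' c' d' e' + stress x y a' c' b' d' e' + stress x y b' c' a' d' e' \in RS Y.
  have Hbr i j k : i \in [:: a'; b'; c'; d'; e'] -> j \in [:: a'; b'; c'; d'; e'] ->
      k \in [:: a'; b'; c'; d'; e'] -> uniq [:: i; j; k] -> br x y i j k != 0.
    by move=> _ _ _; rewrite /= !inE !negb_or andbT => /andP[/andP[ij ik] jk]; apply: gen_br.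
  have K5 := K5_stress (andP L5).1 Hbr.
  have eY i j k l : labels A [:: i; e'; j; k; l] -> rowv x y i e' \in U -> stress x y i e' j k l \in RS Y.
    move=> Le H; rewrite (stress_in gen _ Le); apply: edge_in_Y => //.
    exact: (@labels_cat _ _ [:: i; e'] [:: j; k; l]).
  have e1 : stress x y a' e' b' c' d' \in RS Y by apply: eY => //; perm_labels L5.
  have e2 : stress x y b' e' a' c' d' \in RS Y by apply: eY => //; perm_labels L5.
  have e3 : stress x y c' e' a' b' d' \in RS Y by apply: eY => //; perm_labels L5.
  have e4 : stress x y d' e' a' b' c' \in RS Y by apply: eY => //; perm_labels L5.
  by apply: (double_sum _ K5); rewrite ?pnatr_eq0.
pose P3 := (RS Y + <[stress x y a' b' c' d' e']> + <[stress x y a' c' b' d' e']>)%VS.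
have YP : (RS Y <= P3)%VS by exact: subv_trans (addvSl _ _) (addvSl _ _).
have abP : stress x y a' b' c' d' e' \in P3.
  by rewrite (subvP (addvSl _ _)) // (subvP (addvSr _ _)) ?memv_line.
have acP : stress x y a' c' b' d' e' \in P3 by rewrite (subvP (addvSr _ _)) ?memv_line.
have bcP : stress x y b' c' a' d' e' \in P3.
  rewrite -(addKr (stress x y a' b' c' d' e' + stress x y a' c' b' d' e') (stress x y b' c' _ _ _)).
  by apply: memvD; [rewrite memvN; apply: memvD|apply: (subvP YP)].
have HY : (RS H' <= P3)%VS.
  apply/rowspan_subP => g i j; rewrite in_setU => /orP[gY|gA] J.
    by apply: (subvP YP); apply: rowv_rowspan J gY.
  have Lij : labels A [:: i; j] by move: gA; rewrite (joins_complete _ J) labels2E (joins_neq J).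
  pose P i j := rowv x y i j \in P3.
  apply: (@labels5_pairs _ _ A5 _ _ _ _ _ P L5) Lij; rewrite /P.
  - by move=> p q H; have [E|pq] := eqVneq p q; [rewrite -E in H *|rewrite rowvC // memvN].
  - by rewrite -(stress_in gen _ L5).
  - by rewrite -(stress_in gen _ Lac).
  - rewrite -(stress_in gen _ Lad') -(subKr (stress x y b' c' a' d' e') (stress x y a' d' _ _ _)).
    by rewrite memvB // (subvP YP).
  - by apply: (subvP YP); apply: edge_in_Y => //; sub_labels L5 [:: b'; c'; d'].
  - by rewrite -(stress_in gen _ Lbc).
  - by rewrite -(stress_in gen _ Lbd) -(subrK (stress x y a' c' b' d' e') (stress x y b' d' _ _ _)) memvD // (subvP YP).
  - by apply: (subvP YP); apply: edge_in_Y => //; sub_labels L5 [:: a'; c'; d'].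
  - by rewrite -(stress_in gen _ Lcd) -(subrK (stress x y a' b' c' d' e') (stress x y c' d' _ _ _)) memvD // (subvP YP).
  - by apply: (subvP YP); apply: edge_in_Y => //; sub_labels L5 [:: a'; b'; d'].
  - by apply: (subvP YP); apply: edge_in_Y => //; sub_labels L5 [:: a'; b'; c'].
(* The relations lie in [RS H'], hence in the plane [P3] over [RS Y]. That plane is spanned by
   vectors independent modulo [U], so it meets [U] only in [RS Y]. *)
have UY : (U <= RS Y)%VS.
  rewrite subv_add subvv /=; apply/subvP => v vL.
  have vU : v \in U by apply: (subvP (addvSr _ _)).
  have /(subvP HY)/mem_add_line[k2 /mem_add_line[k1 H]] := subvP (LamH (ltnW A4)) _ vL.
  have HU : k2 *: stress x y a' c' b' d' e' + k1 *: stress x y a' b' c' d' e' \in U.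
    have /(memvB vU) := subvP (addvSl _ Lam) _ H.
    by rewrite -addrA -opprD subKr.
  have [k1E k2E] := plane_trivial ab ac HU.
  by move: H; rewrite k1E k2E !scale0r !subr0.
by have := dimvS UY; rewrite dim_without leqNgt U_neq_Y.
Qed.

End Reduction.

Section NoTwist.
Variables (R : realFieldType) (n : nat) (x y : 'I_n -> R).
Hypothesis gen : alg_indep_Q (coords x y).
Hypothesis n4 : (3 < n)%N.

Lemma no_twist (V : {set 'I_n}) (S : {set edge n}) a b c d e : S \subset complete V ->
  labels V [:: a; b; c; d; e] -> twisted x y (rowspan x y S) a b c d e ->
  rowv x y a c \in rowspan x y S.
Proof.
have [m] := ubnP #|V|; elim: m V S a b c d e => [|m IH] V S a b c d e; first by rewrite ltn0.
move=> ltVm sSV L tS; apply/negPn/negP => acS.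
have [B [w [sBV CB tB acB [wV wT degw]]]] := twisted_vertex gen n4 sSV L tS acS.
apply: (reduction_false gen sBV CB _ L wT tB acB degw) => S' a' b' c' d' e' sS' L' tS'.
by apply: (IH (V :\ w)) sS' L' tS'; move: ltVm; rewrite (cardsD1 w V) wV.
Qed.

End NoTwist.

(** * Circuits *)

Section Circuits.
Variables (R : realFieldType) (n : nat) (x y : 'I_n -> R).
Hypothesis gen : alg_indep_Q (coords x y).
Hypothesis n4 : (3 < n)%N.
Local Notation vT := 'M[R]_(n, 3).
Local Notation RS := (rowspan x y).
Local Notation Cof := (cofactor_matroid x y).
Implicit Types (S X : {set edge n}) (V A : {set 'I_n}).

Let mC : is_matroid Cof := cofactor_matroidP x y.

Definition verts X : {set 'I_n} := [set i | nbhd X i != set0].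

Lemma sub_verts X : X \subset complete (verts X).
Proof.
apply/subsetP=> e eX; rewrite inE !inE; apply/andP; split; apply/set0Pn.
  by exists (val e).2; apply/nbhdP; exists e; rewrite // edge_ends.
by exists (val e).1; apply/nbhdP; exists e; rewrite // joinsC edge_ends.
Qed.

Lemma sum_deg_complete V S : S \subset complete V -> (\sum_(w in V) #|nbhd S w| = #|S| * 2)%N.
Proof.
move=> sSV; rewrite sum_deg -sum_nat_const; apply: eq_bigr => e /(subsetP sSV).
by rewrite inE => /andP[-> ->].
Qed.

Lemma card_complete V : (#|complete V| * 2 = #|V| * #|V|.-1)%N.
Proof.
rewrite -(sum_deg_complete (subxx _)) -sum_nat_const; apply: eq_bigr => w wV.
by rewrite nbhd_complete // (cardsD1 w V) wV.
Qed.

Lemma complete4_indep V : #|V| = 4%N -> Cof (complete V) /\ #|complete V| = 6%N.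
Proof.
move=> cV; have c6 : #|complete V| = 6%N.
  by have := card_complete V; rewrite cV; move: (#|_|) => q; (clear; lia).
split=> //; rewrite cofactorE c6; apply/eqP.
by have := rank_complete gen n4 (V := V); rewrite cV => /(_ isT); move: (\dim _) => q; (clear; lia).
Qed.

Lemma complete5_rank V : #|V| = 5%N -> \dim (RS (complete V)) = 9%N /\ #|complete V| = 10%N.
Proof.
move=> cV; split.
  by have := rank_complete gen n4 (V := V); rewrite cV => /(_ isT); move: (\dim _) => q; (clear; lia).
by have := card_complete V; rewrite cV; move: (#|_|) => q; (clear; lia).
Qed.

Lemma circuit_dim X : is_circuit Cof X -> (\dim (RS X)).+1 = #|X|.
Proof. by move=> cX; rewrite -(circuit_mrank mC cX) mrank_cofactor. Qed.

(** In a circuit every row depends on the others, but up to three rows at [v] are independent modulo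
    vectors vanishing at [v]. Missing neighbours are filled up with arbitrary labels. *)
Lemma circuit_deg X v : is_circuit Cof X -> nbhd X v != set0 -> (4 <= #|nbhd X v|)%N.
Proof.
move=> cX /set0Pn[z zA]; rewrite ltnNge; apply/negP => cA.
pose V' := [set~ v].
have cV' : (3 <= #|V'|)%N.
  by have := cardsC1 v; rewrite /V' card_ord => ->; move: n4; case: (n).
have sAV : nbhd X v \subset V'.
  by apply/subsetP=> i /nbhdP[e _ J]; rewrite !inE eq_sym (joins_neq J).
have LA : labels V' (z :: enum (nbhd X v :\ z)).
  rewrite labels_cons (subsetP sAV _ zA) mem_enum in_setD1 eqxx /= /labels enum_uniq.
  by apply/allP => t; rewrite mem_enum => /setD1P[_ /(subsetP sAV)].
have sz : size (z :: enum (nbhd X v :\ z)) = #|nbhd X v|.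
  by rewrite /= -cardE (cardsD1 z (nbhd X v)) zA.
have [|t [st L]] := @labels_extend _ V' (3 - #|nbhd X v|) _ LA; first by rewrite sz subnKC.
have sA : {subset nbhd X v <= (z :: enum (nbhd X v :\ z)) ++ t}.
  move=> q qA; rewrite mem_cat inE mem_enum !inE; case: eqP => //= _.
  by move: qA; rewrite inE => ->.
have : size ((z :: enum (nbhd X v :\ z)) ++ t) = 3%N by rewrite size_cat sz st subnKC.
move: sA L; rewrite cat_cons; case: (_ ++ t) => [|j [|k []]] //= sA L _.
have vV' : v \notin V' by rewrite !inE eqxx.
have [b1 b2 b3] := br_labels gen vV' L.
have [g gX J] := nbhdP _ _ _ zA.
have pX : X :\ g \proper X by rewrite properD1.
have CXg := circuit_proper mC cX pX.
have E : RS (X :\ g) = RS X.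
  apply: subv_dim_eq; first by apply: rowspanS; apply: subsetDl.
  by rewrite (indep_dim CXg) -ltnS (circuit_dim cX) (cardsD1 g X) gX.
have : rowv x y v z \in RS (X :\ g) by rewrite E; apply: rowv_rowspan J gX.
have sub : (RS (X :\ g) <= RS (without X v) + (<[rowv x y v j]> + <[rowv x y v k]>))%VS.
  apply/rowspan_subP => h p q; rewrite in_setD1 => /andP[hg hX] Jh.
  have [/inc_joins[i Ji]|ni] := boolP (inc v h); last first.
    apply: (subvP (addvSl _ _)); apply: rowv_rowspan Jh _.
    by rewrite inE hX ni.
  have := sA i; rewrite (_ : i \in nbhd X v); last by apply/nbhdP; exists h.
  move=> /(_ isT); rewrite !inE -(cof_row_mem _ _ _ Jh) (cof_row_mem _ _ _ Ji).
  case/or3P=> /eqP Ei; first by case/eqP: hg; apply: joins_inj Ji _; rewrite Ei.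
    apply: (subvP (addvSr _ _)); apply: (subvP (addvSl _ _)); rewrite Ei; exact: memv_line.
  apply: (subvP (addvSr _ _)); apply: (subvP (addvSr _ _)); rewrite Ei; exact: memv_line.
move/(subvP sub)/memv_addP => [u uH [_ /memv_addP[_ /vlineP[c2 ->] [_ /vlineP[c3 ->] ->]] Ez]].
have := @three_indep _ _ x y v z j k 1 (- c2) (- c3) b1 b2 b3.
rewrite scale1r !scaleNr Ez -addrA -opprD addrK => H.
by have [|/eqP] := H; [apply: (subvP (without_off x y X v))|rewrite oner_eq0].
Qed.

(** Degrees at least 4 give [4|V| <= 2|X| <= 20], so there are five vertices and all ten edges
    occur. *)
Lemma small_circuit X : is_circuit Cof X -> (#|X| <= 10)%N -> is_K5 X.
Proof.
move=> cX lX; set V := verts X.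
have deg v : v \in V -> (4 <= #|nbhd X v|)%N by rewrite inE; apply: circuit_deg.
have nz : (0 < #|X|)%N by rewrite -(circuit_dim cX).
have [e eX] : exists e, e \in X by apply/card_gt0P.
have [v vV] : exists v, v \in V.
  by exists (val e).1; have := subsetP (sub_verts X) _ eX; rewrite inE => /andP[].
have V5 : (5 <= #|V|)%N.
  rewrite (cardsD1 v V) vV ltnS (leq_trans (deg v vV)) // subset_leq_card //.
  by apply: nbhd_sub; apply: sub_verts.
have sum2 := sum_deg_complete (sub_verts X).
have lo : (#|V| * 4 <= #|X| * 2)%N by rewrite -sum2 -sum_nat_const; apply: leq_sum.
have cV : #|V| = 5%N by move: lo lX V5; rewrite /V; move: (#|_|) (#|_|) => p q; (clear; lia).
apply/existsP; exists V; rewrite cV eqxx /= -/(complete V) eqEcard sub_verts.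
have [_ ->] := complete5_rank cV; move: lo; rewrite cV; move: (#|_|) => q; (clear; lia).
Qed.

(** A circuit has at most [3|V| - 5] edges, so its average degree is below six. *)
Lemma low_degree X : is_circuit Cof X -> (4 < #|X|)%N ->
  exists v, nbhd X v != set0 /\ (#|nbhd X v| <= 5)%N.
Proof.
move=> cX lX; set V := verts X.
have [e eX] : exists e, e \in X by apply/card_gt0P; exact: (leq_ltn_trans _ lX).
have [v vV] : exists v, v \in V.
  by exists (val e).1; have := subsetP (sub_verts X) _ eX; rewrite inE => /andP[].
have V3 : (3 <= #|V|)%N.
  rewrite (cardsD1 v V) vV ltnS; move: (vV); rewrite inE => /(circuit_deg cX) d4.
  have := subset_leq_card (nbhd_sub v (sub_verts X)); rewrite -/V => H.
  by apply: leq_trans H; apply: leq_trans d4.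
have rk := rank_complete gen n4 V3.
have lX2 : (\dim (RS X) <= \dim (RS (complete V)))%N by apply/dimvS/rowspanS/sub_verts.
have cXd := circuit_dim cX.
have [/exists_inP[w wV lw]|H] := boolP [exists w in V, #|nbhd X w| <= 5]%N.
  by exists w; split=> //; move: wV; rewrite inE.
have : (#|V| * 6 <= #|X| * 2)%N.
  rewrite -(sum_deg_complete (sub_verts X)) -sum_nat_const; apply: leq_sum => w wV.
  by rewrite ltnNge; apply: contra H => lw; apply/exists_inP; exists w.
move: rk lX2 cXd; move: (\dim _) (\dim _) (#|_|) (#|_|) => p q s t; (clear; lia).
Qed.

(** * Matroids that agree with the cofactor matroid on small sets *)

Section TruncationAgree.
Variables (N : matroid (edge n)) (r : nat).
Hypotheses (mN : is_matroid N) (r10 : (10 <= r)%N).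
Hypothesis agree : forall S : {set edge n}, (#|S| <= r)%N -> N S = Cof S.

(** A larger independent set of [N] could be cut down to [d + 1] elements, still within the range
    where both matroids agree. *)
Lemma mrank_agree S (d : nat) : (\dim (RS S) <= d)%N -> (d < r)%N -> (mrank N S <= d)%N.
Proof.
move=> dS dr; rewrite leqNgt; apply/negP => lt.
have [Y [sY NY cY]] := mrank_basis mN S.
have N0 : N set0 by case: mN.
have [|Z [_ sZ NZ cZ]] := @augment _ _ mN set0 Y d.+1 N0 NY; first by rewrite cards0 cY lt.
rewrite set0U in sZ; have CZ : Cof Z by rewrite -agree ?cZ.
have : (#|Z| <= mrank Cof S)%N by apply: leq_mrank => //; apply: subset_trans sY.
by rewrite cZ mrank_cofactor ltnNge dS.
Qed.

(* Otherwise a basis of the complete graph on four neighbours, extended by the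
   four edges to [v], would be an independent [K_5]. *)
Lemma star_dependent X v : (4 <= #|nbhd X v|)%N -> (#|X| <= r.+1)%N ->
  (\dim (RS (without X v :|: complete (nbhd X v))) + 4 <= #|X|)%N -> ~~ N X.
Proof.
move=> A4 lX dB; apply/negP => NX; set B := without X v :|: complete (nbhd X v).
have rB : (mrank N B + 4 <= #|X|)%N.
  apply: (leq_trans _ dB); rewrite leq_add2r; apply: mrank_agree => //.
  by move: dB lX; rewrite -/B; move: (\dim _) (#|X|) => p q; (clear; lia).
have N0 : N set0 by case: mN.
have [I [NI _ sIX cD cI]] := extend_in_span mN (sub0set B) N0 NX rB.
set D := I :\: B in sIX cD.
have Dv e : e \in D -> inc v e.
  move=> eD; have eX := subsetP sIX _ eD; move: eD; rewrite in_setD => /andP[eB _].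
  by apply: contraR eB => ne; rewrite in_setU inE eX ne.
pose A' := nbhd D v.
have cA' : #|A'| = 4%N.
  rewrite card_nbhd -cD; congr #|pred_of_set _|; apply/setP=> e; rewrite inE.
  by case: (boolP (e \in D)) => // /Dv.
have sA' : A' \subset nbhd X v.
  by apply/subsetP=> i /nbhdP[e /(subsetP sIX) eX J]; apply/nbhdP; exists e.
have [CQ cQ] := complete4_indep cA'.
have sQB : complete A' \subset B.
  by apply: subset_trans (subsetUr _ _); apply: completeS.
have NQ : N (complete A') by rewrite agree // cQ (leq_trans _ r10).
(* [I] has only the four elements of [D] outside [B], so the new set, which contains [complete A'],
   must pick up the same four. *)
have [|I' [NI' sQI' sI'I cD' _]] := extend_in_span (d := 4) mN sQB NQ NI; first by rewrite cI.
have DE : I' :\: B = D.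
  apply/eqP; rewrite eqEcard cD cD' leqnn andbT; apply/subsetP=> e eD'.
  by rewrite in_setD (subsetP sI'I) // andbT; move: eD'; rewrite in_setD => /andP[].
have vA' : v \notin A' by apply: nbhd_neq.
have cW : #|v |: A'| = 5%N by rewrite cardsU1 vA' cA'.
have [dW cW10] := complete5_rank cW.
have sW : complete A' :|: D \subset complete (v |: A').
  rewrite subUset completeS ?subsetUr //=; apply/subsetP=> e eD.
  have [i J] := inc_joins (Dv _ eD); rewrite (joins_complete _ J) !in_setU1 eqxx /=.
  by apply/orP; right; apply/nbhdP; exists e.
have cQD : #|complete A' :|: D| = 10%N.
  rewrite cardsU (_ : complete A' :&: D = set0) ?cards0 ?cQ ?cD //.
  apply/setP=> e; rewrite in_setI in_set0 in_setD; apply/negP => /and3P[eQ eB _].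
  by rewrite (subsetP sQB) in eB.
have : N (complete A' :|: D).
  by apply: (indep_sub mN _ NI'); rewrite subUset sQI' -DE subsetDl.
rewrite agree ?cQD // cofactorE cQD => /eqP d10.
by have := dimvS (rowspanS x y sW); rewrite d10 dW.
Qed.

Lemma circuit_dependent X : is_circuit Cof X -> #|X| = r.+1 -> ~~ N X.
Proof.
move=> cX cXr; have [|v [v0 lv]] := low_degree cX; first by rewrite cXr ltnS (leq_trans _ r10).
have dv := circuit_deg cX v0; set A := nbhd X v in lv dv.
set Y := without X v; have vA : v \notin A by apply: nbhd_neq.
have cXY : #|X| = (#|Y| + #|A|)%N by apply: card_without.
have [z zA] := set0Pn _ v0; have [g gX J] := nbhdP _ _ _ zA.
have sYg : Y \subset X :\ g.
  apply/subsetP=> e; rewrite inE in_setD1 => /andP[-> ne]; rewrite andbT.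
  by apply: contraNneq ne => ->; rewrite (joins_inc _ J) eqxx.
have Yp : Y \proper X by apply: (sub_proper_trans sYg); rewrite properD1.
have dY : \dim (RS Y) = #|Y| by apply: indep_dim; apply: circuit_proper Yp.
have dX := circuit_dim cX.
have Yoff : (RS Y <= off R v)%VS by apply: without_off.
have tight s t : (\dim (RS Y + star (mv x v s) (mv y v t) v A)%VS < #|X|)%N.
  by have := move_dim gen X v s t [::]; rewrite /= span_nil !addv0 -dX ltnS.
have HB W : (RS Y <= W)%VS -> (forall i j, labels A [:: i; j] -> rowv x y i j \in W) ->
    (RS (Y :|: complete A) <= W)%VS.
  move=> YW AW; apply/rowspan_subP => h i j; rewrite in_setU => /orP[hY|hA] Jh.
    by apply: (subvP YW); apply: rowv_rowspan Jh hY.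
  by apply: AW; move: hA; rewrite (joins_complete _ Jh) labels2E (joins_neq Jh).
have concl W : (RS Y <= W)%VS -> (forall i j, labels A [:: i; j] -> rowv x y i j \in W) ->
    (\dim W + 4 <= #|X|)%N -> ~~ N X.
  move=> YW AW dW; apply: (star_dependent dv); first by rewrite cXr.
  by apply: leq_trans dW; rewrite leq_add2r; apply/dimvS/HB.
have [A4|A5] : #|A| = 4%N \/ #|A| = 5%N.
  move: lv dv; rewrite leq_eqVlt ltnS => /orP[/eqP->|l5] l4; [by right|left].
  by apply/eqP; rewrite eqn_leq l5 l4.
  apply: (concl (RS Y)) => //; last by rewrite dY cXY A4.
  move=> i j; apply: (star_tight3 gen vA Yoff) => // s t.
  by have := tight s t; rewrite cXY A4 addnS ltnS dY.
have t4 s t : (\dim (RS Y + star (mv x v s) (mv y v t) v A)%VS <= \dim (RS Y) + 4)%N.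
  by have := tight s t; rewrite cXY A5 addnS ltnS dY.
have [[b Hb]|[i0 i0A Hs]|[a [b [c [d [e [L5 he hg ab ac]]]]]]] :=
  local_trichotomy gen vA Yoff A5 t4.
- apply: (concl (RS Y + <[b]>)%VS) => //; first exact: addvSl.
  rewrite cXY A5; apply: leq_trans (leq_add (dim_add_line _ _) (leqnn 4)) _.
  by rewrite dY addSn -addnS.
- have [||t [st L0]] := @labels_extend _ A 4 [:: i0]; rewrite ?labels_cons ?i0A ?A5 //.
  case: t st L0 => [|i [|j [|k [|l []]]]] //= _ L0.
  have [[_ iA jA kA _] [ni nj nk _] _ _ _] := labels5P L0.
  pose A' := A :\ i0.
  have vA' : v \notin A' by rewrite in_setD1 negb_and vA orbT.
  have LA' : labels A' [:: i; j; k].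
    have /andP[u3 _] : labels A [:: i; j; k] by sub_labels L0 [:: l; i0].
    by rewrite /labels u3 /= !in_setD1 !(eq_sym _ i0) ni nj nk iA jA kA.
  have UA' p q : labels A' [:: p; q] -> rowv x y p q \in RS Y.
    rewrite labels2E !in_setD1 => /and3P[pq /andP[p0 pA] /andP[q0 qA]].
    by apply: Hs; rewrite ?labels2E ?pq ?pA ?qA.
  have sS := star_line3 gen LA' vA' UA'; have [b1 b2 b3] := br_labels gen vA' LA'.
  have [g0 g0X J0] := nbhdP _ _ _ i0A.
  have pX : X :\ g0 \proper X by rewrite properD1.
  have SX : (RS (X :\ g0) <= RS Y + line3 x y v i j k)%VS.
    apply/rowspan_subP => h p q; rewrite in_setD1 => /andP[hg0 hX] Jh.
    have [/inc_joins[z' Jz]|ni'] := boolP (inc v h); last first.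
      by apply: (subvP (addvSl _ _)); apply: rowv_rowspan Jh _; rewrite inE hX ni'.
    rewrite -(cof_row_mem _ _ _ Jh) (cof_row_mem _ _ _ Jz); apply: (subvP sS).
    apply: (span_set_mem (rowv x y v)); rewrite in_setD1; apply/andP; split.
      by apply: contraNneq hg0 => E; apply/eqP; apply: joins_inj J0; rewrite -E.
    by apply/nbhdP; exists h.
  (* [X] without [g0] is independent with [|Y| + 4] edges, but its rows lie in a space of dimension
     [|Y| + 3]. *)
  have := dimvS SX; rewrite (dim_line3 b1 b2 b3 Yoff) dY (indep_dim (circuit_proper mC cX pX)).
  move: cXY; rewrite A5 (cardsD1 g0 X) g0X add1n addnS => -[->].
  by rewrite leq_add2l.
have [[aA bA cA dA eA] [nab _ _ _] _ _ _] := labels5P L5.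
have Lac : labels A [:: a; c; b; d; e] by perm_labels L5.
(* Adding the single edge [ab] to [Y] brings the rank-two quadrilateral into the form required by
   [twisted]; [no_twist] then contradicts the independence of [ab] and [ac] modulo [RS Y]. *)
have [g1 J1] := joins_ex nab.
have abU : stress x y a b c d e \in (RS Y + <[stress x y a b c d e]>)%VS.
  by rewrite (subvP (addvSr _ _)) ?memv_line.
have S1U : (RS (g1 |: Y) <= RS Y + <[stress x y a b c d e]>)%VS.
  rewrite rowspan_add subv_add addvSl andbT -memvE (cof_row_mem _ _ _ J1).
  by rewrite -(stress_in gen _ L5).
have abS : stress x y a b c d e \in RS (g1 |: Y).
  by rewrite (stress_in gen _ L5); apply: (rowv_rowspan _ _ J1); rewrite in_setU1 eqxx.
have YS : (RS Y <= RS (g1 |: Y))%VS by apply: rowspanS; apply: subsetUr.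
have tS : twisted x y (RS (g1 |: Y)) a b c d e.
  have [he1 he2 he3 he4] := he; have [h1 h2 h3 h4] := hg.
  by apply: (twisted_stress gen L5) abS; split; apply: (subvP YS).
have LT : labels [set: 'I_n] [:: a; b; c; d; e].
  by have /andP[u5 _] := L5; rewrite /labels u5 /= !in_setT.
have sT : g1 |: Y \subset complete [set: 'I_n] by apply/subsetP=> h _; rewrite inE !in_setT.
have := no_twist gen n4 sT LT tS; rewrite -(stress_in gen _ Lac) => acS.
by case/negP: ac; apply: (subvP S1U).
Qed.

End TruncationAgree.

End Circuits.

(** * The free elevation *)

Section Elevation.
Variables (R : realFieldType) (n : nat) (x y : 'I_n -> R).
Hypothesis gen : alg_indep_Q (coords x y).
Hypothesis n5 : (5 <= n)%N.
Local Notation Cof := (cofactor_matroid x y).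
Let m := mrank Cof setT.
Let mC : is_matroid Cof := cofactor_matroidP x y.

Implicit Types (S X : {set edge n}) (N : matroid (edge n)).

Lemma cofactor_card S : Cof S -> (#|S| <= m)%N.
Proof. by move=> CS; apply: leq_mrank; rewrite ?subsetT. Qed.

Lemma trunc_top : meq (trunc Cof m) Cof.
Proof. by move=> S; rewrite /trunc; have [/cofactor_card ->|] := boolP (Cof S). Qed.

Section Step.
Variables (r : nat) (M : matroid (edge n)).
Hypotheses (r10 : (10 <= r)%N) (rm : (r <= m)%N) (EM : meq M (trunc Cof r)).

Lemma mrank_step S : mrank M S = minn (mrank Cof S) r.
Proof. by rewrite (mrank_meq _ EM) mrank_trunc. Qed.

Lemma mrank_stepT : mrank M setT = r.
Proof. by rewrite mrank_step; apply/minn_idPr. Qed.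

(** Truncation determines [N] on sets of at most [r] elements, so the only possible exception is a
    circuit with exactly [r + 1] elements, and [circuit_dependent] rules it out. *)
Lemma erection_indep N S : is_matroid N -> is_truncation M N -> N S -> Cof S /\ (#|S| <= r.+1)%N.
Proof.
move=> mN [rN tN] NS; have mM : is_matroid M.
  by apply: is_matroid_meq (trunc_matroid mC r) => X; rewrite EM.
have lS : (#|S| <= r.+1)%N by rewrite -mrank_stepT -rN; apply: leq_mrank; rewrite ?subsetT.
have agree (X : {set edge n}) : (#|X| <= r)%N -> N X = Cof X.
  move=> lX; have EMX : M X = Cof X by rewrite EM /trunc lX andbT.
  rewrite -EMX; have := tN X; rewrite mrank_stepT => E; apply/idP/idP => [NX|MX].
    by apply: (indep_mrank mM); rewrite E (mrank_indep mN NX); apply/minn_idPl.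
  apply: (indep_mrank mN); apply/eqP; rewrite eqn_leq mrank_leq_card //=.
  by rewrite -(mrank_indep mM MX) E geq_minl.
split=> //; move: lS; rewrite leq_eqVlt => /orP[/eqP cS|]; last first.
  by rewrite ltnS => /agree <-.
apply/negPn/negP => /dep_circuit[X sXS cX].
have [lX|] := leqP #|X| r.
  by case/andP: (cX) => /negP[]; rewrite -agree //; apply: indep_sub NS.
rewrite ltnNge -ltnS => gX; have E : X = S.
  apply/eqP; rewrite eqEcard sXS cS.
  by rewrite ltnNge; apply: contra gX.
have := circuit_dependent gen (leq_trans (isT : 3 < 5)%N n5) mN r10 agree cX.
by rewrite E cS NS => /(_ erefl).
Qed.

Lemma step_free : (r < m)%N -> is_free_erection M (trunc Cof r.+1) /\ ~ meq (trunc Cof r.+1) M.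
Proof.
move=> ltm; have rT : mrank (trunc Cof r.+1) setT = r.+1 by rewrite mrank_trunc //; apply/minn_idPr.
split; last first.
  by move=> E; have := mrank_meq setT E; rewrite rT mrank_stepT => /eqP; rewrite eqn_leq ltnn.
split; first split; first exact: trunc_matroid.
  right; split; first by rewrite rT mrank_stepT.
  by move=> X; rewrite mrank_stepT mrank_step mrank_trunc // -minnA (minn_idPr (leqnSn r)).
move=> N [mN [EN|tN]] S NS.
  by move: NS; rewrite EN EM /trunc => /andP[-> /leqW].
by have [CS lS] := erection_indep mN tN NS; rewrite /trunc CS.
Qed.

End Step.

(** The case [r = m] of [erection_indep]: a basis of a nontrivial erection would be
    cofactor-independent with [m + 1] elements. *)
Lemma cofactor_no_erection N : (10 <= m)%N -> is_erection Cof N -> meq N Cof.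
Proof.
move=> m10 [mN [//|tN]]; have [rN _] := tN.
have [S [_ NS cS]] := mrank_basis mN setT.
have Et : meq Cof (trunc Cof m) by move=> X; rewrite trunc_top.
have [/cofactor_card] := erection_indep m10 (leqnn m) Et mN tN NS.
by rewrite cS rN ltnn.
Qed.

Variable Rn : matroid (edge n).
Hypotheses (mR : is_matroid Rn) (rR : mrank Rn setT = 10%N).
Hypothesis cR : forall C : {set edge n}, (is_circuit Rn C && ~~ spanning Rn C) = is_K5 C.

Let n4 : (3 < n)%N. Proof. exact: leq_trans n5. Qed.

Lemma K5_dependent S : is_K5 S -> ~~ Cof S.
Proof.
case/existsP=> W /andP[/eqP cW /eqP ->]; rewrite -/(complete W) cofactorE.
by have [-> ->] := complete5_rank gen n4 cW.
Qed.

(** A circuit of [Rn] with at most ten edges has rank below ten, so it is non-spanning and hence a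
    [K_5]; by [small_circuit] the same sets are the small circuits of the cofactor matroid. *)
Lemma Rn_trunc : meq Rn (trunc Cof 10).
Proof.
move=> S; rewrite /trunc; have [lS|gS] := leqP #|S| 10; last first.
  rewrite andbF; apply/negP => RS; have := leq_mrank (subsetT S) RS.
  by rewrite rR leqNgt gS.
rewrite andbT; apply/idP/idP; apply: contraTT => /dep_circuit[X sXS cX];
  have lX : (#|X| <= 10)%N by apply: leq_trans (subset_leq_card sXS) lS.
  have := small_circuit gen n4 cX lX; rewrite -cR => /andP[/andP[nX _] _].
  by apply: contra nX; apply: (indep_sub mR).
have : is_K5 X.
  rewrite -cR cX /= /spanning rR; apply: contraTneq lX => E.
  by rewrite -(circuit_mrank mR cX) E.
by move/K5_dependent; apply: contra; apply: (indep_sub mC).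
Qed.

Lemma Rn_elevation : is_free_elevation Rn Cof.
Proof.
have m10 : (10 <= m)%N.
  have [S [_ RS cS]] := mrank_basis mR setT; move: RS; rewrite Rn_trunc => /andP[CS _].
  by rewrite -rR -cS; apply: cofactor_card.
(* The first term has to be [Rn] itself, whereas [Rn_trunc] identifies it with a truncation only up
   to [meq]. *)
pose s i := if i is 0%N then Rn else trunc Cof (10 + i).
have sE i : meq (s i) (trunc Cof (10 + i)).
  by case: i => [|i] X //; apply: Rn_trunc.
exists (m - 10)%N, s; split=> //.
- move=> i lt; rewrite -[s i.+1]/(trunc Cof (10 + i.+1)) addnS.
  by apply: (step_free _ _ (sE i)); rewrite ?leq_addr // -?ltn_subRL // ltnW // -ltn_subRL.
- by move=> X; rewrite sE subnKC // trunc_top.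
by move=> N; apply: cofactor_no_erection.
Qed.

End Elevation.

Theorem theorem5p1 (n : nat) (R : realFieldType) (x y : 'I_n -> R)
    (Rn : matroid (edge n)) :
  (5 <= n)%N ->
  alg_indep_Q (coords x y) ->
  is_matroid Rn ->
  mrank Rn setT = 10%N ->
  (forall C : {set edge n}, (is_circuit Rn C && ~~ spanning Rn C) = is_K5 C) ->
  is_free_elevation Rn (cofactor_matroid x y).
Proof. by move=> n5 gen; apply: Rn_elevation. Qed.
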